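(* Let $n\ge r\ge1$ be integers with $n=q_1r+r_1$, $0<r_1<r$, and $r=q_2r_1+r_2$, $0\le r_2<r_1$. Then for $s=1,\dots,q_2$, $$\underbrace{\Delta^{r_1}\cdots\Delta^{r_1}}_{s}\,\underbrace{\Delta^r\cdots\Delta^r}_{q_1}\, I(\mu_{n,r}) = I(\mu_{n,r})+(\psi_0,\dots,\psi_{q_1r-1},\varphi_0,\dots,\varphi_{sr_1-1}),$$ and, if $r_2>0$, $$\Delta^{r_2}\bigl(\underbrace{\Delta^{r_1}\cdots\Delta^{r_1}}_{q_2}\,\underbrace{\Delta^r\cdots\Delta^r}_{q_1}\, I(\mu_{n,r})\bigr) = I(\mu_{n,r})+(\psi_0,\dots,\psi_{q_1r-1},\varphi_0,\dots,\varphi_{q_2r_1-1},\varphi_{q_2r_1},\dots,\varphi_{q_2r_1+r_2-1}).$$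
   Context: Write $f(x)=x^n+a_{n-1}x^{n-1}+\cdots+a_0$, $g(x)=x^r+b_{r-1}x^{r-1}+\cdots+b_0$ and $f(x)g(x)=x^{n+r}+c_{n+r-1}x^{n+r-1}+\cdots+c_0$, so each $c_j$ is a polynomial in the coordinates $(a_0,\dots,a_{n-1},b_0,\dots,b_{r-1})$ of $\mathbb{C}^n\times\mathbb{C}^r$. Let $\mathcal{A}$ be the algebra of germs at the origin of holomorphic functions on $\mathbb{C}^n\times\mathbb{C}^r$, and $I(\mu_{n,r})\subset\mathcal{A}$ the ideal generated by $c_0,\dots,c_{n+r-1}$. For an ideal $J\subset\mathcal{A}$, $\Delta_kJ$ is the ideal generated by $J$ and all $k\times k$ minors of the matrices of first partial derivatives (with respect to the $n+r$ coordinates) of finite families of functions in $J$, and $\Delta^iJ=\Delta_{n+r-i+1}J$. $L_m$ denotes the $m\times m$ lower shift matrix (ones on the subdiagonal, zeros elsewhere). General construction. For integers $N\ge R\ge1$ with $N=QR+R_1$, $0\le R_1<R$, and variables $u_0,\dots,u_{N-1},v_0,\dots,v_{R-1}$, define polynomials $\Psi^{(N,R)}_0,\dots,\Psi^{(N,R)}_{QR+R_1-1}$ in $(u,v)$ as follows. Let $\delta_N=1$ and $\delta_{N-j}=u_{N-j}-\sum_{k=1}^{\min(j,R)}v_{R-k}\,\delta_{N-j+k}$ for $1\le j\le N$. Put $\Psi^{(N,R)}_i=\delta_i$ for $0\le i\le R-1$; $\Psi^{(N,R)}_{sR+i}=\dfrac{\partial^s\delta_{R-1}}{\partial v_0^{\,s-1}\,\partial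 v_{R-1-i}}$ for $0\le i\le R-1$, $1\le s\le Q-1$; and $\Psi^{(N,R)}_{QR+i}=\beta_{(Q-1)R+R_1+i}$ for $0\le i\le R_1-1$, where $\beta_1,\dots,\beta_{N-1}$ are defined by $(V^{-Q}E)^{-1}=I_N+\beta_{N-1}L_N+\cdots+\beta_1L_N^{N-1}$ with $V=I_N+v_{R-1}L_N+\cdots+v_0L_N^R$ and $E=I_N+\delta_{N-1}L_N+\cdots+\delta_1L_N^{N-1}$. The polynomials $\psi_j$: $\psi_j=\Psi^{(n,r)}_j$ with $u_i=a_i$, $v_i=b_i$. The polynomials $\varphi_j$: let $\widehat{A}=I_n+a_{n-1}L_n+\cdots+a_1L_n^{n-1}$ and $B=I_n+b_{r-1}L_n+\cdots+b_0L_n^r$, and define polynomials $\gamma_1,\dots,\gamma_{n-1}$ in $(a,b)$ by $B^{-q_1}\widehat{A}=I_n+\gamma_{n-1}L_n+\cdots+\gamma_1L_n^{n-1}$. Let $f_2(x)=x^{r_1}+\gamma_{n-1}x^{r_1-1}+\cdots+\gamma_{n-r_1}$. Then $\varphi_j$ is $\Psi^{(r,r_1)}_j$ with $u_i=b_i$ ($0\le i\le r-1$) and $v_i=\gamma_{n-r_1+i}$ ($0\le i\le r_1-1$), i.e. the same construction applied to the pair $(g,f_2)$ in place of $(f,g)$ (derivatives being taken in the variables $u,v$ before substitution). *)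

(* Defs.v *)
From HB Require Import structures.
From mathcomp Require Import all_boot all_order all_algebra.
From mathcomp Require Import complex.
(* mpoly is only imported inside the module MPsi: its notations are not
   compatible with those of MathComp-Analysis. *)
From mathcomp Require mpoly.

Set Implicit Arguments.
Unset Strict Implicit.
Unset Printing Implicit Defensive.

Import Order.TTheory GRing.Theory Num.Theory.
Local Open Scope ring_scope.

Definition vnth (A : nmodType) (m : nat) (w : 'rV[A]_m) (i : nat) : A :=
  if insub i is Some j then w 0 j else 0.

Section LowerShift.
Variable A : comUnitRingType.

Definition lshift_mx (m : nat) : 'M[A]_m :=
  \matrix_(i < m, j < m) (i == j.+1 :> nat)%:R.

(* The coefficient of L^k in a matrix \sum_(k < m) c_k L^k, where
   L = lshift_mx m; by lshift_expansion below, the matrices of this form are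
   exactly those which commute with L. *)
Definition lcoef (m : nat) : 'M[A]_m -> nat -> A :=
  match m return 'M[A]_m -> nat -> A with
  | 0 => fun _ _ => 0
  | m'.+1 => fun M k => M (inord k) ord0
  end.

Lemma lshift_mxXE (m k : nat) (i j : 'I_m) :
  (lshift_mx m ^+ k) i j = (i == (j + k)%N :> nat)%:R.
Proof.
elim: k i j => [|k IHk] i j; first by rewrite expr0 addn0 mxE.
rewrite exprSr mxE.
have E (l : 'I_m) : (lshift_mx m ^+ k) i l * lshift_mx m l j
    = if (l == j.+1 :> nat) then (i == (j + k.+1)%N :> nat)%:R else 0.
  rewrite IHk mxE; case: (@eqP _ (l : nat) j.+1) => [->|_]; last by rewrite mulr0.
  by rewrite mulr1 addSnnS.
rewrite (eq_bigr _ (fun l _ => E l)) -big_mkcond /=.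
have [ltj|gej] := ltnP j.+1 m.
  by rewrite (big_pred1 (Ordinal ltj)).
rewrite big1 => [|l /eqP el]; last by have := ltn_ord l; rewrite el ltnNge gej.
case: eqP => // ei; have := ltn_ord i; rewrite ei.
by rewrite addnS ltnNge (leq_trans gej) // ltnS leq_addr.
Qed.

Lemma lshift_expansion (m : nat) (M : 'M[A]_m) :
  M *m lshift_mx m = lshift_mx m *m M ->
  M = \sum_(k < m) lcoef M k *: lshift_mx m ^+ k.
Proof.
case: m M => [|m] M cML; first by rewrite big_ord0 flatmx0 [RHS]flatmx0.
have cX k : M *m lshift_mx m.+1 ^+ k = lshift_mx m.+1 ^+ k *m M.
  exact: (commrX k (cML : GRing.comm M (lshift_mx m.+1))).
apply/matrixP => i j; rewrite summxE.
under eq_bigr => k _ do rewrite mxE lshift_mxXE /= inord_val.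
have -> : M i j = (M *m lshift_mx m.+1 ^+ j) i ord0.
  rewrite mxE (bigD1 j) //= lshift_mxXE eqxx mulr1 big1 ?addr0 // => l nlj.
  by rewrite lshift_mxXE add0n (inj_eq val_inj) (negPf nlj) mulr0.
rewrite cX mxE; apply: eq_bigr => l _.
by rewrite lshift_mxXE mulrC addnC.
Qed.

(* The matrices 1 + c_1 L + ... + c_(m-1) L^(m-1). *)
Definition lunip (m : nat) (M : 'M[A]_m) : Prop :=
  M *m lshift_mx m = lshift_mx m *m M /\ forall i : 'I_m, M i i = 1.

Lemma lcommE (m : nat) (M : 'M[A]_m.+1) (i j : 'I_m.+1) :
  M *m lshift_mx m.+1 = lshift_mx m.+1 *m M ->
  M i j = if (j <= i)%N then lcoef M (i - j) else 0.
Proof.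
move=> cML; rewrite {1}(lshift_expansion cML) summxE.
under eq_bigr => k _ do rewrite mxE lshift_mxXE.
case: leqP => [ji|ij].
  have lt : (i - j < m.+1)%N by rewrite (leq_ltn_trans (leq_subr _ _)).
  rewrite (bigD1 (Ordinal lt)) //= subnKC // eqxx mulr1 big1 ?addr0 // => k nk.
  case: eqP => [e|_]; last by rewrite mulr0.
  by case/eqP: nk; apply: val_inj; rewrite /= e addKn.
rewrite big1 // => k _; case: eqP => [e|_]; last by rewrite mulr0.
by move: ij; rewrite e ltnNge leq_addr.
Qed.

Lemma lunip1 (m : nat) (c : nat -> A) (l : nat) :
  lunip (1%:M + \sum_(1 <= k < l) c k *: lshift_mx m ^+ k).
Proof.
split; last first.
  move=> i; rewrite !mxE eqxx summxE big1_seq ?addr0 // => k.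
  rewrite mem_index_iota => /andP[_ /andP[k0 _]].
  by rewrite mxE lshift_mxXE -{1}[i : nat]addn0 eqn_add2l eq_sym gtn_eqF // mulr0.
rewrite mulmxDl mulmxDr mul1mx mulmx1; congr (_ + _).
rewrite mulmx_suml mulmx_sumr; apply: eq_bigr => k _.
rewrite -scalemxAl -scalemxAr; congr (_ *: _).
by rewrite -[LHS]/(_ * _) -[RHS]/(_ * _) -exprSr exprS.
Qed.

Lemma lunip_mul (m : nat) (M M' : 'M[A]_m) :
  lunip M -> lunip M' -> lunip (M *m M').
Proof.
case: m M M' => [|m] M M' [cM dM] [cM' dM'].
  by split=> [|[]//]; rewrite [LHS]flatmx0 [RHS]flatmx0.
split=> [|i]; first by rewrite -mulmxA cM' mulmxA cM mulmxA.
rewrite mxE (bigD1 i) //= dM dM' mulr1 big1 ?addr0 // => j nji.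
rewrite lcommE // (@lcommE _ M') //; case: leqP => [ji|]; last by rewrite mul0r.
by rewrite leqNgt ltn_neqAle nji ji /= mulr0.
Qed.

Lemma lunip_exp (m : nat) (M : 'M[A]_m) (k : nat) :
  lunip M -> lunip (M ^+ k).
Proof.
move=> uM; elim: k => [|k IHk]; last by rewrite exprS; apply: lunip_mul.
by split=> [|i]; rewrite ?expr0 ?mul1mx ?mulmx1 // mxE eqxx.
Qed.

Lemma lunip_unit (m : nat) (M : 'M[A]_m) : lunip M -> M \in unitmx.
Proof.
case: m M => [|m] M [cM dM]; first by rewrite unitmxE det_mx00 unitr1.
rewrite unitmxE det_trig ?big1 ?unitr1 //.
by apply/is_trig_mxP => i j ij; rewrite lcommE // leqNgt ij.
Qed.

Lemma lunip_inv (m : nat) (M : 'M[A]_m) : lunip M -> lunip (invmx M).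
Proof.
move=> uM; have Mu := lunip_unit uM; case: m M uM Mu => [|m] M [cM dM] Mu.
  by split=> [|[]//]; rewrite [LHS]flatmx0 [RHS]flatmx0.
have cI : invmx M *m lshift_mx m.+1 = lshift_mx m.+1 *m invmx M.
  by rewrite -[in LHS](mulmxK Mu (lshift_mx m.+1)) -cM !mulmxA mulVmx // mul1mx.
split=> // i; have := congr1 (fun X : 'M_m.+1 => X i i) (mulmxV Mu).
rewrite !mxE eqxx (bigD1 i) //= dM mul1r big1 ?addr0 // => j nji.
rewrite lcommE // (@lcommE _ (invmx M)) //.
case: leqP => [ji|]; last by rewrite mul0r.
by rewrite leqNgt ltn_neqAle nji ji /= mulr0.
Qed.

Lemma lunip_expansion (m : nat) (M : 'M[A]_m) : lunip M ->
  M = 1%:M + \sum_(1 <= k < m) lcoef M k *: lshift_mx m ^+ k.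
Proof.
case: m M => [|m] M [cM dM]; first by rewrite [LHS]flatmx0 [RHS]flatmx0.
rewrite {1}(lshift_expansion cM) big_ord_recl expr0 /=.
have -> : inord 0 = ord0 :> 'I_m.+1 by apply: val_inj; rewrite /= inordK.
by rewrite dM scale1r big_add1 /= big_mkord.
Qed.

End LowerShift.

Module MPsi.
Import mpoly.

Section Psi.
Variables (K : idomainType) (N R : nat).
Local Notation P := {mpoly K[N + R]}.

Definition uvar (i : nat) : P := vnth (\row_(j < N) 'X_(lshift R j)) i.
Definition vvar (i : nat) : P := vnth (\row_(j < R) 'X_(rshift N j)) i.

Definition dv (i : nat) (p : P) : P :=
  if insub i is Some j then p^`M(rshift N j) else 0.

(* [:: delta_(N-j); delta_(N-j+1); ...; delta_N] *)
Fixpoint delta_seq (j : nat) : seq P :=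
  if j is j'.+1 then
    let ds := delta_seq j' in
    (uvar (N - j) - \sum_(1 <= k < (minn j R).+1) vvar (R - k) * ds`_k.-1) :: ds
  else [:: 1].

Definition delta (i : nat) : P := (delta_seq (N - i))`_0.

Definition Vmx : 'M[P]_N :=
  1%:M + \sum_(1 <= k < R.+1) vvar (R - k) *: lshift_mx P N ^+ k.

Definition Emx : 'M[P]_N :=
  1%:M + \sum_(1 <= k < N) delta (N - k) *: lshift_mx P N ^+ k.

Definition beta (j : nat) : P :=
  lcoef (invmx (invmx (Vmx ^+ (N %/ R)) *m Emx)) (N - j).

Definition Psi (j : nat) : P :=
  let Q := (N %/ R)%N in let R1 := (N %% R)%N in
  let s := (j %/ R)%N in let i := (j %% R)%N in
  if s == 0%N then delta i
  else if (s < Q)%N then iter s.-1 (dv 0) (dv (R - 1 - i) (delta (R - 1)))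
  else beta ((Q - 1) * R + R1 + i).

Definition Psi_at (w : 'rV[K]_(N + R)) (j : nat) : K :=
  (Psi j).@[fun i => w 0 i].

End Psi.

Lemma deltaN (K : idomainType) (N R : nat) : delta K N R N = 1.
Proof. by rewrite /delta subnn. Qed.

Lemma delta_rec (K : idomainType) (N R j : nat) : (1 <= j <= N)%N ->
  delta K N R (N - j) = uvar K N R (N - j)
    - \sum_(1 <= k < (minn j R).+1) vvar K N R (R - k) * delta K N R (N - j + k).
Proof.
have nthE k d : (d <= k)%N ->
    (delta_seq K N R k)`_d = (delta_seq K N R (k - d))`_0.
  by elim: k d => [|k IHk] [|d] //= dk; rewrite IHk.
case: j => // j /andP[_ jN]; rewrite {1}/delta subKn //=.
congr (_ - _); apply: eq_big_nat => k /andP[k0 km]; congr (_ * _).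
have kj : (k <= j.+1)%N by move: km; rewrite ltnS leq_min => /andP[].
rewrite nthE; last by rewrite -ltnS prednK.
rewrite /delta; congr (delta_seq _ _ _ _)`_0.
case: k k0 km kj => // k _ _ kj /=.
by rewrite subnDA subKn // subSS.
Qed.

Lemma beta_expansion (K : idomainType) (N R : nat) :
  invmx (invmx (Vmx K N R ^+ (N %/ R)) *m Emx K N R)
  = 1%:M + \sum_(1 <= k < N) beta K N R (N - k) *: lshift_mx _ N ^+ k.
Proof.
rewrite [LHS]lunip_expansion; last first.
  apply/lunip_inv/lunip_mul; last exact: lunip1.
  exact/lunip_inv/lunip_exp/lunip1.
congr (_ + _); apply: eq_big_nat => k /andP[_ /ltnW kN].
by rewrite /beta subKn.
Qed.

End MPsi.

From mathcomp Require Import all_classical all_reals all_analysis.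
Import numFieldNormedType.Exports.
Local Open Scope classical_set_scope.

(* All notions are meant for K = R[i] with R : realType; they are stated over
   K : numFieldType, which is where MathComp-Analysis puts the topology. *)

Section Germs.
Variables (K : numFieldType) (m : nat).
Local Notation fn := ('rV[K]_m -> K).

(* Germs at the origin are handled through representatives, which are functions
   on the whole of K^m. *)
Definition holo_germ (f : fn) : Prop :=
  \forall z \near (0 : 'rV[K]_m), differentiable f z.

(* The germs of the ideal of germs of holomorphic functions generated by G: the
   set of all representatives of its elements, hence it is closed under equality
   near 0, and two such ideals are equal if and only if these sets are. *)
Definition ideal_gen (G : set fn) : set fn :=
  [set f | exists (p : nat) (h g : 'I_p -> fn),
     [/\ forall i, holo_germ (h i), forall i, G (g i)
       & \forall z \near (0 : 'rV[K]_m), f z = \sum_(i < p) h i z * g i z]].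

Definition jac (p : nat) (F : 'I_p -> fn) (z : 'rV[K]_m) : 'M[K]_(p, m) :=
  \matrix_(i < p, j < m) 'D_(delta_mx 0 j) (F i) z.

Definition jac_minors (k : nat) (J : set fn) : set fn :=
  [set f | exists (p : nat) (F : 'I_p -> fn) (rho : 'I_k -> 'I_p)
                  (kap : 'I_k -> 'I_m),
     [/\ forall i, J (F i), {homo rho : i j / (i < j)%N},
         {homo kap : i j / (i < j)%N}
       & f = fun z => \det (mxsub rho kap (jac F z))]].

Definition Delta_sub (k : nat) (J : set fn) : set fn :=
  ideal_gen (J `|` jac_minors k J).

Definition Delta_sup (i : nat) (J : set fn) : set fn := Delta_sub (m - i + 1) J.

End Germs.

Section Polynomials.
Variables (K : numFieldType) (n r : nat).
Implicit Type z : 'rV[K]_(n + r).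

(* A point z of K^n x K^r is (a_0, ..., a_(n-1), b_0, ..., b_(r-1)). *)
Definition acoef z : nat -> K := vnth (lsubmx z).
Definition bcoef z : nat -> K := vnth (rsubmx z).

Definition fpoly z : {poly K} := 'X^n + \poly_(i < n) acoef z i.
Definition gpoly z : {poly K} := 'X^r + \poly_(i < r) bcoef z i.

Definition ccoef (j : nat) z : K := (fpoly z * gpoly z)`_j.

Definition Imu : set ('rV[K]_(n + r) -> K) :=
  ideal_gen [set ccoef j | j in [set j | (j < n + r)%N]].

Definition psi (j : nat) z : K := MPsi.Psi_at z j.

Definition Amx z : 'M[K]_n :=
  1%:M + \sum_(1 <= k < n) acoef z (n - k) *: lshift_mx K n ^+ k.

Definition Bmx z : 'M[K]_n :=
  1%:M + \sum_(1 <= k < r.+1) bcoef z (r - k) *: lshift_mx K n ^+ k.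

Definition gamma z (j : nat) : K :=
  lcoef (invmx (Bmx z ^+ (n %/ r)) *m Amx z) (n - j).

Lemma gamma_expansion z :
  invmx (Bmx z ^+ (n %/ r)) *m Amx z
  = 1%:M + \sum_(1 <= k < n) gamma z (n - k) *: lshift_mx K n ^+ k.
Proof.
rewrite [LHS]lunip_expansion; last first.
  by apply: lunip_mul; [exact/lunip_inv/lunip_exp/lunip1 | exact: lunip1].
congr (_ + _); apply: eq_big_nat => k /andP[_ /ltnW kn].
by rewrite /gamma subKn.
Qed.

Definition phi (j : nat) z : K :=
  MPsi.Psi_at
    (row_mx (rsubmx z) (\row_(i < n %% r) gamma z (n - n %% r + i))) j.

Definition psi_phi (k l : nat) : set ('rV[K]_(n + r) -> K) :=
  [set psi j | j in [set j | (j < k)%N]] `|`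
  [set phi j | j in [set j | (j < l)%N]].

End Polynomials.

Arguments Imu : clear implicits.
Arguments psi_phi : clear implicits.

(* Main.v *)
(* In the ring of germs, let J be generated by elements y and by the coefficients
   of P^p Q^e - x^M, where P and Q are monic of degrees a >= b and where y and the
   coefficients of P and Q form a system of coordinates.  Write P = P' Q + rho.
   Modulo J and rho, the variation of P^p Q^e is P'^(p-1) Q^(e+p-1) times
   p dP + e P' dQ, a polynomial of degree < a, while y has dim - a - b entries; so
   all the differentials lie in a space of rank dim - b, and the minors of size
   dim - b + 1 vanish; conversely a triangular minor yields each coefficient of rho.
   Hence Delta^b J = J + (rho), which is again of the same form, for P', Q,
   y together with rho, and the exponents p and e + p.  Iterating Delta thus runs
   the division of f by g, with digits rho_0, rho_1, ..., down to a quotient h of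
   degree r1, then that of g by h, and at last a division of h.

   The Psi's generate the same ideals as these digits: up to nonzero constants,
   Psi_(s R + i) is the residue at infinity of x^(R-1-i) F / G^(s+1), and the last
   ones are residues of x^j G / H, where H is the last quotient.

   The partial derivatives act on germs because derivatives of holomorphic
   functions are holomorphic.  This is obtained without integrals: Goursat's lemma
   for trapezoidal sums gives the mean value property, then the maximum principle,
   applied to divided differences, bounds the Taylor remainder by a quadratic
   term, and the derivative is a locally uniform limit of difference quotients. *)
Require Import Defs.
From HB Require Import structures.
From mathcomp Require Import all_boot all_order all_algebra.
From mathcomp Require Import complex ring lra zify perm boolp.
From mathcomp Require mpoly.
Import Order.TTheory GRing.Theory Num.Theory.
Local Open Scope ring_scope.

Set Implicit Arguments.
Unset Strict Implicit.
Unset Printing Implicit Defensive.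

(** * Ideals and derivations *)

(** The c_j are the coefficients of f g - x^(n+r), and x^M has zero variation: hence the form P^p
    Q^e - x^M. Each division lowers the degree a of P by b and adds b entries to y, so the order dim
    - b + 1 of the minors does not change; the same Delta^b can be repeated until the degree of P
    falls below b, when P and Q exchange roles. The triangular minor equals a coefficient of rho
    times powers of the exponents, which therefore have to be invertible integers. The obstacle with
    the Psi's is that they are differentiated in u and v before substitution, while the elements put
    for these variables (the coefficients of h, for instance) are themselves functions of a and b.
    Their ideals are therefore compared in the polynomial ring in u and v, and the result is carried
    over by ring morphisms, which commute with division by monic polynomials. Polynomials are kept
    over functions wherever values at points are needed, since a germ has no value away from 0. *)

Section Ideals.
Variable A : comNzRingType.
Implicit Types (J G : A -> Prop) (x y : A) (p q : {poly A}).

Record is_ideal J : Prop := IsIdeal {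
  ideal0 : J 0;
  idealD : forall x y, J x -> J y -> J (x + y);
  idealM : forall a x, J x -> J (a * x) }.

Definition idl G x : Prop := exists (k : nat) (h g : 'I_k -> A),
  (forall i, G (g i)) /\ x = \sum_i h i * g i.

Lemma idealN J x : is_ideal J -> J x -> J (- x).
Proof. by move=> iJ Jx; rewrite -mulN1r; apply: idealM. Qed.

Lemma idealB J x y : is_ideal J -> J x -> J y -> J (x - y).
Proof. by move=> iJ Jx Jy; apply: idealD => //; apply: idealN. Qed.

Lemma ideal_sum J (I : Type) (s : seq I) (P : pred I) (F : I -> A) : is_ideal J ->
  (forall i, P i -> J (F i)) -> J (\sum_(i <- s | P i) F i).
Proof. by move=> iJ JF; elim/big_ind: _ => //; [apply: ideal0 | apply: idealD]. Qed.

Lemma ideal_trans J x y : is_ideal J -> J (x - y) -> J y -> J x.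
Proof. by move=> iJ Jxy Jy; rewrite -(subrK y x); apply: idealD. Qed.

Lemma idl_ideal G : is_ideal (idl G).
Proof.
split.
- by exists 0%N, (fun=> 0), (fun=> 0); split=> [[]|] //; rewrite big_ord0.
- move=> x y [k [h [g [Gg ->]]]] [k' [h' [g' [Gg' ->]]]].
  exists (k + k')%N, (fun i => match split i with inl j => h j | inr j => h' j end),
    (fun i => match split i with inl j => g j | inr j => g' j end); split.
    by move=> i; case: (split i).
  rewrite big_split_ord /=; congr (_ + _); apply: eq_bigr => i _.
    by have := unsplitK (inl i : 'I_k + 'I_k') => /= ->.
  by have := unsplitK (inr i : 'I_k + 'I_k') => /= ->.
move=> a x [k [h [g [Gg ->]]]]; exists k, (fun i => a * h i), g; split=> //.
by rewrite mulr_sumr; apply: eq_bigr => i _; rewrite mulrA.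
Qed.

Lemma idl_gen G x : G x -> idl G x.
Proof.
by move=> Gx; exists 1%N, (fun=> 1), (fun=> x); split=> //; rewrite big_ord1 mul1r.
Qed.

Lemma idl_min G J : is_ideal J -> (forall x, G x -> J x) -> forall x, idl G x -> J x.
Proof.
move=> iJ GJ x [k [h [g [Gg ->]]]]; apply: ideal_sum => // i _.
by apply: idealM => //; apply: GJ.
Qed.

Lemma idl_eq G G' : (forall x, G x -> idl G' x) -> (forall x, G' x -> idl G x) ->
  idl G = idl G'.
Proof.
move=> h1 h2; apply/funext => x; apply/propext.
by split; apply: idl_min => //; apply: idl_ideal.
Qed.

Lemma idlU_idl G G' : idl (fun x => idl G x \/ G' x) = idl (fun x => G x \/ G' x).
Proof.
apply: idl_eq => x [].
- apply: idl_min => [|y Gy]; first exact: idl_ideal.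
  by apply: idl_gen; left.
- by move=> Gx; apply: idl_gen; right.
- by move=> Gx; apply/idl_gen; left; apply: idl_gen.
- by move=> Gx; apply: idl_gen; right.
Qed.

(** [inJ J (p - q)] plays the role of p = q over the quotient by [J], without forming that quotient;
    the lemmas below make it a congruence. *)
Definition inJ J p := forall i, J p`_i.

Lemma inJ0 J : is_ideal J -> inJ J 0.
Proof. by move=> iJ i; rewrite coef0; apply: ideal0. Qed.

Lemma inJD J p q : is_ideal J -> inJ J p -> inJ J q -> inJ J (p + q).
Proof. by move=> iJ Jp Jq i; rewrite coefD; apply: idealD. Qed.

Lemma inJN J p : is_ideal J -> inJ J p -> inJ J (- p).
Proof. by move=> iJ Jp i; rewrite coefN; apply: idealN. Qed.

Lemma inJM J p q : is_ideal J -> inJ J q -> inJ J (p * q).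
Proof.
by move=> iJ Jq i; rewrite coefM; apply: ideal_sum => // j _; apply: idealM.
Qed.

Lemma inJMr J p q : is_ideal J -> inJ J p -> inJ J (p * q).
Proof. by move=> iJ Jp; rewrite mulrC; apply: inJM. Qed.

Lemma inJ_trans J p q : is_ideal J -> inJ J (p - q) -> inJ J q -> inJ J p.
Proof. by move=> iJ Jpq Jq; rewrite -(subrK q p); apply: inJD. Qed.

Lemma inJX J p q n : is_ideal J -> inJ J (p - q) -> inJ J (p ^+ n - q ^+ n).
Proof. by move=> iJ Jpq; rewrite subrXX; apply: inJMr. Qed.

Lemma det_congr J k (M N : 'M[A]_k) : is_ideal J ->
  (forall i j, J (M i j - N i j)) -> J (\det M - \det N).
Proof.
move=> iJ MN; rewrite -sumrB; apply: ideal_sum => // s _.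
rewrite -mulrBr; apply: idealM => //; elim/big_rec2: _ => [|i x y _ Jxy].
  by rewrite subrr; apply: ideal0.
have -> : M i (s i) * y - N i (s i) * x =
  y * (M i (s i) - N i (s i)) + N i (s i) * (y - x) by ring.
by apply: idealD => //; apply: idealM.
Qed.

End Ideals.

Lemma idl_or (A : comNzRingType) (G G' L L' : A -> Prop) : idl G = idl G' -> idl L = idl L' ->
  idl (fun x => G x \/ L x) = idl (fun x => G' x \/ L' x).
Proof.
have key (G1 G1' L1 L1' : A -> Prop) : idl G1 = idl G1' -> idl L1 = idl L1' ->
    forall x, G1 x \/ L1 x -> idl (fun x => G1' x \/ L1' x) x.
  move=> eG eL x [Gx|Lx].
    have : idl G1' x by rewrite -eG; apply: idl_gen.
    by apply: idl_min => [|y Gy]; [apply: idl_ideal | apply: idl_gen; left].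
  have : idl L1' x by rewrite -eL; apply: idl_gen.
  by apply: idl_min => [|y Gy]; [apply: idl_ideal | apply: idl_gen; right].
by move=> eG eL; apply: idl_eq; apply: key.
Qed.

(** * Cauchy-Binet and sorted minors *)

Section Determinants.
Variable A : comNzRingType.

(** Cauchy-Binet before its terms are grouped: with all maps f instead of the increasing ones there
    is nothing to sort. A map that is not injective repeats a row, so its term vanishes. *)
Lemma cauchy_binet_expand (k l : nat) (X : 'M[A]_(k, l)) (Y : 'M[A]_(l, k)) :
  \det (X *m Y) = \sum_(f : {ffun 'I_k -> 'I_l})
    (\prod_i X i (f i)) * \det (\matrix_(i, j) Y (f i) j).
Proof.
rewrite /determinant.
transitivity (\sum_(s : 'S_k) \sum_(f : {ffun 'I_k -> 'I_l})
   (-1) ^+ s * \prod_i (X i (f i) * Y (f i) (s i))).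
  apply: eq_bigr => s _; rewrite -mulr_sumr; congr (_ * _).
  by under eq_bigr => i _ do rewrite mxE; rewrite bigA_distr_bigA.
rewrite exchange_big; apply: eq_bigr => f _ /=; rewrite mulr_sumr.
apply: eq_bigr => s _; rewrite big_split /= mulrCA; congr (_ * (_ * _)).
by apply: eq_bigr => i _; rewrite mxE.
Qed.

Lemma det_rows_ninj (k l : nat) (Y : 'M[A]_(l, k)) (f : 'I_k -> 'I_l) :
  ~ injective f -> \det (\matrix_(i, j) Y (f i) j) = 0.
Proof.
move=> ninj; have [/injectiveP//|/injectivePn[i [j ij fij]]] := boolP (injectiveb f).
by apply: (determinant_alternate ij) => c; rewrite !mxE fij.
Qed.

Lemma det_thin (k l : nat) (X : 'M[A]_(k, l)) (Y : 'M[A]_(l, k)) :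
  (l < k)%N -> \det (X *m Y) = 0.
Proof.
move=> lk; rewrite cauchy_binet_expand big1 // => f _.
rewrite det_rows_ninj ?mulr0 // => /leq_card.
by rewrite !card_ord leqNgt lk.
Qed.

(** Minors are defined with increasing indices, so an arbitrary choice of columns has to be sorted;
    the permutation only costs a sign. *)
Lemma sort_injection (k l : nat) (f : 'I_k -> 'I_l) : injective f ->
  exists (s : 'S_k) (g : 'I_k -> 'I_l),
    {homo g : i j / (i < j)%N} /\ forall i, f i = g (s i).
Proof.
move=> injf; pose t := [tuple f i | i < k].
pose leo := relpre (@nat_of_ord l) leq.
have st : size (sort leo t) == k by rewrite size_sort size_tuple.
have /tuple_permP[s ts] : perm_eq t (Tuple st) by rewrite perm_sym /= perm_sort.
pose g i := tnth (Tuple st) i.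
have fg i : f i = g (s i).
  have -> : f i = tnth t i by rewrite tnth_mktuple.
  rewrite (tnth_nth (f i)) ts -(tnth_nth (f i) [tuple tnth (Tuple st) (s j) | j < k]).
  by rewrite tnth_mktuple.
exists s, g; split=> // i j ij.
have g_inj : injective g.
  move=> a b; rewrite -(permKV s a) -(permKV s b) -!fg => /injf.
  by move/(congr1 s).
have gle : (g i <= g j)%N.
  have srt : sorted leo (Tuple st) by apply: sort_sorted => a b; apply: leq_total.
  have tr : transitive leo by move=> a b c; apply: leq_trans.
  rewrite /g !(tnth_nth (g i)).
  by apply: (sorted_ltn_nth tr) => //; rewrite inE size_tuple.
by rewrite ltn_neqAle gle andbT; apply: contraTneq ij => /val_inj/g_inj ->; rewrite ltnn.
Qed.

End Determinants.

(** * Derivations, vector fields and ideals of minors in an abstract ring *)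

Section Derivations.
Variable A : comNzRingType.

Record is_der (d : A -> A) : Prop := IsDer {
  derD : forall x y, d (x + y) = d x + d y;
  derM : forall x y, d (x * y) = d x * y + x * d y }.

Section OneDerivation.
Variables (d : A -> A) (dd : is_der d).

Lemma der0 : d 0 = 0.
Proof. by apply: (addrI (d 0)); rewrite -(derD dd) !addr0. Qed.

Lemma der1 : d 1 = 0.
Proof. by apply: (addrI (d 1)); rewrite addr0 -{3}[1]mulr1 (derM dd) mulr1 mul1r. Qed.

Lemma derN x : d (- x) = - d x.
Proof. by apply: (addrI (d x)); rewrite -(derD dd) !subrr der0. Qed.

Lemma der_sum (I : Type) (s : seq I) (P : pred I) (F : I -> A) :
  d (\sum_(i <- s | P i) F i) = \sum_(i <- s | P i) d (F i).
Proof. by apply: (big_morph d (derD dd) der0). Qed.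

(** The extension of [d] to A[x] that treats x as a constant. *)
Definition dpoly (p : {poly A}) : {poly A} := map_poly d p.

Lemma coef_dpoly p i : (dpoly p)`_i = d p`_i.
Proof. by rewrite coef_map_id0 // der0. Qed.

Lemma dpolyD p q : dpoly (p + q) = dpoly p + dpoly q.
Proof. by apply/polyP => i; rewrite !(coefD, coef_dpoly) (derD dd). Qed.

Lemma dpolyN p : dpoly (- p) = - dpoly p.
Proof. by apply/polyP => i; rewrite !(coefN, coef_dpoly) derN. Qed.

Lemma dpolyM p q : dpoly (p * q) = dpoly p * q + p * dpoly q.
Proof.
apply/polyP => i; rewrite coef_dpoly coefD !coefM der_sum -big_split /=.
by apply: eq_bigr => j _; rewrite (derM dd) !coef_dpoly.
Qed.

Lemma dpolyXn n : dpoly 'X^n = 0.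
Proof.
by apply/polyP => i; rewrite coef_dpoly coefXn coef0; case: eqP; rewrite ?der1 ?der0.
Qed.

Lemma dpolyX p n : dpoly (p ^+ n.+1) = n.+1%:R * p ^+ n * dpoly p.
Proof.
elim: n => [|n IH]; first by rewrite expr1 expr0 mulr1 mul1r.
rewrite exprS dpolyM IH [in RHS]mulrS exprS; ring.
Qed.

(** The leading coefficient 1 is killed. This drop of the degree is what bounds the rank of the
    differentials later. *)
Lemma size_dpoly_monic p n : p \is monic -> size p = n.+1 -> (size (dpoly p) <= n)%N.
Proof.
move=> /monicP lp sp; apply/leq_sizeP => j nj; rewrite coef_dpoly.
move: nj; rewrite leq_eqVlt => /orP[/eqP <-|nj].
  by move: lp; rewrite lead_coefE sp /= => ->; apply: der1.
by rewrite nth_default ?der0 // sp.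
Qed.

End OneDerivation.

Variables (m : nat) (D : 'I_m -> A -> A) (Dder : forall j, is_der (D j)).

Definition vfield (w : 'I_m -> A) (x : A) : A := \sum_j w j * D j x.

Lemma vfield_der w : is_der (vfield w).
Proof.
split=> x y; rewrite /vfield.
  by rewrite -big_split; apply: eq_bigr => j _; rewrite (derD (Dder j)) mulrDr.
rewrite mulr_suml mulr_sumr -big_split; apply: eq_bigr => j _.
by rewrite (derM (Dder j)) /=; ring.
Qed.

Definition minors (k : nat) (J : A -> Prop) (x : A) : Prop :=
  exists (p : nat) (F : 'I_p -> A) (rho : 'I_k -> 'I_p) (kap : 'I_k -> 'I_m),
    [/\ forall i, J (F i), {homo rho : i j / (i < j)%N},
        {homo kap : i j / (i < j)%N}
      & x = \det (\matrix_(i, j) D (kap j) (F (rho i)))].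

Definition DeltaA (k : nat) (J : A -> Prop) : A -> Prop :=
  idl (fun x => J x \/ minors k J x).

Lemma DeltaA_ideal k J : is_ideal (DeltaA k J).
Proof. exact: idl_ideal. Qed.

Lemma DeltaA_sub k (J : A -> Prop) x : J x -> DeltaA k J x.
Proof. by move=> Jx; apply: idl_gen; left. Qed.

(** The matrix is the Jacobian times the matrix of components of the fields, so its determinant is a
    combination of coordinate minors. Minors may thus be computed along fields adapted to a
    chart. *)
Lemma DeltaA_vfield k (J : A -> Prop) (F : 'I_k -> A) (w : 'I_k -> 'I_m -> A) :
  (forall i, J (F i)) -> DeltaA k J (\det (\matrix_(i, l) vfield (w l) (F i))).
Proof.
move=> JF; rewrite -det_tr.
have -> : (\matrix_(i, l) vfield (w l) (F i))^T
    = (\matrix_(l, j) w l j) *m (\matrix_(j, i) D j (F i)).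
  by apply/matrixP => l i; rewrite !mxE; apply: eq_bigr => j _; rewrite !mxE.
rewrite cauchy_binet_expand; apply: ideal_sum => [|f _]; first exact: DeltaA_ideal.
apply: (idealM (DeltaA_ideal k J)).
case: (pselect (injective f)) => [/sort_injection[s [g [gh fg]]]|/det_rows_ninj ->];
  last exact: (ideal0 (DeltaA_ideal k J)).
have -> : \matrix_(i, j) (\matrix_(j0, i0) D j0 (F i0)) (f i) j
    = row_perm s (\matrix_(i, l) D (g l) (F i))^T.
  by apply/matrixP => i j; rewrite !mxE fg.
rewrite row_permE det_mulmx det_tr; apply: (idealM (DeltaA_ideal k J)).
apply: idl_gen; right; exists k, F, id, g; split=> //.
Qed.

End Derivations.

(** * The Euclidean step for the ideals of minors *)

Section MonicDivision.
Import Pdiv.CommonRing Pdiv.RingMonic.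
Variable A : comNzRingType.
Implicit Types (p q r d : {poly A}) (J : A -> Prop).

Lemma rdivp_uniq d p q r : d \is monic -> p = q * d + r ->
  (size r < size d)%N -> rdivp p d = q /\ rmodp p d = r.
Proof.
by move=> dm -> sr; rewrite rdivp_addl_mul_small // rmodp_addl_mul_small.
Qed.

Lemma size_rmodp_monic d p : d \is monic -> (size (rmodp p d) < size d)%N.
Proof. by move=> dm; rewrite ltn_rmodp monic_neq0. Qed.

Lemma rdivpD_monic d p q : d \is monic -> rdivp (p + q) d = rdivp p d + rdivp q d.
Proof.
move=> dm; apply: (proj1 (@rdivp_uniq d _ _ (rmodp p d + rmodp q d) dm _ _)).
  by rewrite {1}(rdivp_eq dm p) {1}(rdivp_eq dm q) mulrDl addrACA.
by rewrite (leq_ltn_trans (size_polyD _ _)) // gtn_max !size_rmodp_monic.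
Qed.

Lemma rdivpZ_monic d p (a : A) : d \is monic -> rdivp (a *: p) d = a *: rdivp p d.
Proof.
move=> dm; apply: (proj1 (@rdivp_uniq d _ _ (a *: rmodp p d) dm _ _)).
  by rewrite {1}(rdivp_eq dm p) scalerDr scalerAl.
by rewrite (leq_ltn_trans (size_scale_leq _ _)) ?size_rmodp_monic.
Qed.

Lemma monic_divl_eq0 d q r : d \is monic -> (size r < size d)%N ->
  q * d + r = 0 -> q = 0 /\ r = 0.
Proof.
move=> dm sr e0.
have [<- <-] := rdivp_uniq dm (esym e0) sr.
by rewrite rdiv0p rmod0p.
Qed.

Lemma size_rdivp_monic d p a b : d \is monic -> p \is monic ->
  size p = a.+1 -> size d = b.+1 -> (b <= a)%N ->
  size (rdivp p d) = (a - b).+1 /\ rdivp p d \is monic.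
Proof.
move=> dm pm sp sd ba.
have pe := rdivp_eq dm p; have sr := size_rmodp_monic p dm.
have qm : rdivp p d * d \is monic.
  have -> : rdivp p d * d = p - rmodp p d by rewrite {2}pe addrK.
  rewrite monicE lead_coefDl -?monicE // size_polyN sp.
  by rewrite (leq_trans sr) // sd ltnS.
have q0 : rdivp p d != 0.
  by apply: contraTneq qm => ->; rewrite mul0r monicE lead_coef0 eq_sym oner_eq0.
have sq : size (rdivp p d * d) = a.+1.
  have -> : rdivp p d * d = p - rmodp p d by rewrite {2}pe addrK.
  rewrite size_polyDl ?sp // size_polyN.
  by rewrite (leq_trans sr) // sd ltnS.
move: sq; rewrite size_Mmonic // sd => sq; split; first by lia.
by move: qm; rewrite monicMr.
Qed.

Definition linear_functional (lam : {poly A} -> A) : Prop :=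
  (forall p q, lam (p + q) = lam p + lam q) /\ (forall a p, lam (a *: p) = a * lam p).

Lemma functional_coef lam n p : linear_functional lam -> (size p <= n)%N ->
  lam p = \sum_(j < n) p`_j * lam 'X^j.
Proof.
move=> [lD lZ] sp; have l0 : lam 0 = 0 by rewrite -(scale0r 0) lZ mul0r.
rewrite -{1}(coefK p) poly_def (big_morph lam lD l0).
rewrite (big_ord_widen n (fun i => lam (p`_i *: 'X^i)) sp) big_mkcond /=.
apply: eq_bigr => j _; rewrite lZ; case: leqP => // sj.
by rewrite nth_default ?mul0r.
Qed.

Lemma functional_ideal J lam p : is_ideal J -> linear_functional lam ->
  inJ J p -> J (lam p).
Proof.
move=> iJ ll Jp; rewrite (functional_coef ll (leqnn _)).
by apply: ideal_sum => // j _; rewrite mulrC; apply: idealM.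
Qed.

(** In lam p = sum_j p_j lam(x^j), the terms p_j d(lam(x^j)) lie in J. Hence d and lam commute
    modulo J, although lam (below, a division by varying polynomials) is not constant for d. *)
Lemma functional_der J lam (d : A -> A) p : is_ideal J -> linear_functional lam ->
  is_der d -> inJ J p -> J (d (lam p) - lam (dpoly d p)).
Proof.
move=> iJ ll dd Jp.
have sd : (size (dpoly d p) <= size p)%N by apply: size_poly.
rewrite (functional_coef ll (leqnn (size p))) (functional_coef ll sd) (der_sum dd).
rewrite -sumrB; apply: ideal_sum => // j _.
rewrite (derM dd) (coef_dpoly dd) addrAC subrr add0r mulrC.
by rewrite mulrC mulrC; apply: idealM.
Qed.

Lemma functional_rdivp_coef d1 d2 l : d1 \is monic -> d2 \is monic ->
  linear_functional (fun p => (rdivp (rdivp p d1) d2)`_l).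
Proof.
move=> m1 m2; split=> [p q|a p]; first by rewrite !rdivpD_monic // coefD.
by rewrite !rdivpZ_monic // coefZ.
Qed.

Lemma functional_rmodp_coef d1 d2 l : d1 \is monic -> d2 \is monic ->
  linear_functional (fun p => (rmodp (rdivp p d1) d2)`_l).
Proof.
move=> m1 m2; split=> [p q|a p]; first by rewrite rdivpD_monic // rmodpD // coefD.
by rewrite rdivpZ_monic // rmodpZ // coefZ.
Qed.

End MonicDivision.

Section DeltaStep.
Import Pdiv.CommonRing Pdiv.RingMonic.
Variables (A : comNzRingType) (m : nat) (D : 'I_m -> A -> A).
Hypothesis Dder : forall j, is_der (D j).
Hypothesis natU : forall n, exists c : A, c * n.+1%:R = 1.
Implicit Types (P Q : {poly A}) (y : seq A) (J : A -> Prop).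

Definition coefs (b : nat) (p : {poly A}) : seq A := mkseq (fun i => p`_i) b.

(** The arguments p and e are the exponents minus one, so that derivatives show the common factor
    P^p Q^e. There is no bound on j: when M is the degree of the monic product, the coefficients
    from M on are zero. *)
Definition gens y P Q (p e M : nat) (x : A) : Prop :=
  x \in y \/ exists j, x = (P ^+ p.+1 * Q ^+ e.+1 - 'X^M)`_j.

(* The entries of y and the coefficients of P and Q, of degrees a and b, form a
   coordinate system: their differentials can be prescribed. *)
Record chart y (a b : nat) P Q : Prop := Chart {
  chart_monicl : P \is monic;
  chart_monicr : Q \is monic;
  chart_sizel : size P = a.+1;
  chart_sizer : size Q = b.+1;
  chart_vfield : forall (eta : nat -> A) (dP dQ : {poly A}),
    (size dP <= a)%N -> (size dQ <= b)%N ->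
    exists w : 'I_m -> A, [/\ forall i, (i < size y)%N -> vfield D w y`_i = eta i,
      dpoly (vfield D w) P = dP & dpoly (vfield D w) Q = dQ] }.

Lemma chart_swap y a b P Q : chart y a b P Q -> chart y b a Q P.
Proof.
case=> Pm Qm sP sQ sur; split=> // eta dQ dP sdQ sdP.
by have [w [h1 h2 h3]] := sur eta dP dQ sdP sdQ; exists w.
Qed.

Lemma gens_swap y P Q p e M : gens y P Q p e M = gens y Q P e p M.
Proof. by apply/funext => x; rewrite /gens mulrC. Qed.

(** Since P = P' Q + rho, prescribing dP', dQ and d rho amounts to prescribing dP = dP' Q + P' dQ +
    d rho. That dP' and d rho then come out as wanted is the uniqueness of division by Q. *)
Lemma chart_step y a b P Q : chart y a b P Q -> (b <= a)%N ->
  chart (y ++ coefs b (rmodp P Q)) (a - b) b (rdivp P Q) Q.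
Proof.
case=> Pm Qm sP sQ sur ba.
have [sq qm] := size_rdivp_monic Qm Pm sP sQ ba.
split=> // eta dP' dQ sdP' sdQ.
pose r := \poly_(i < b) eta (size y + i)%N.
have sr : (size r <= b)%N by apply: size_poly.
have [|w [wy wP wQ]] := sur eta (dP' * Q + rdivp P Q * dQ + r) dQ _ sdQ.
  rewrite (leq_trans (size_polyD _ _)) // geq_max (leq_trans sr ba) andbT.
  rewrite (leq_trans (size_polyD _ _)) // geq_max; apply/andP; split.
    rewrite (leq_trans (size_polyMleq _ _)) // sQ; lia.
  rewrite (leq_trans (size_polyMleq _ _)) // sq; lia.
have wd := vfield_der Dder w.
have := congr1 (dpoly (vfield D w)) (rdivp_eq Qm P).
rewrite (dpolyD wd) (dpolyM wd) wP wQ => /eqP.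
set dq := dpoly _ (rdivp P Q); set dr := dpoly _ (rmodp P Q).
rewrite eq_sym -subr_eq0.
have -> : dq * Q + rdivp P Q * dQ + dr - (dP' * Q + rdivp P Q * dQ + r)
  = (dq - dP') * Q + (dr - r) by ring.
have sdr : (size dr <= b)%N.
  rewrite (leq_trans (size_poly _ _)) //.
  by have := size_rmodp_monic P Qm; rewrite sQ ltnS.
move=> /eqP /(monic_divl_eq0 Qm)[|/eqP + /eqP].
  by rewrite sQ ltnS (leq_trans (size_polyD _ _)) // size_polyN geq_max sdr sr.
rewrite !subr_eq0 => /eqP dqE /eqP drE.
exists w; split=> // i; rewrite size_cat size_mkseq nth_cat => ilt.
case: ltnP => iy; first exact: wy.
have ib : (i - size y < b)%N by rewrite ltn_subLR.
rewrite nth_mkseq // -(coef_dpoly wd) -/dr drE coef_poly ib.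
by rewrite subnKC.
Qed.

(** Modulo rho, P^(p+1) Q^(e+1) becomes (P' Q)^(p+1) Q^(e+1), so the exponent of Q grows by p +
    1. *)
Lemma gens_step y a b P Q p e M : chart y a b P Q -> (b <= a)%N ->
  idl (fun x => idl (gens y P Q p e M) x \/ x \in coefs b (rmodp P Q))
  = idl (gens (y ++ coefs b (rmodp P Q)) (rdivp P Q) Q p (e + p.+1) M).
Proof.
case=> Pm Qm sP sQ _ ba; rewrite idlU_idl.
set r := rmodp P Q; set P' := rdivp P Q.
have sr : (size r <= b)%N by have := size_rmodp_monic P Qm; rewrite sQ ltnS.
have key J : is_ideal J -> (forall x, x \in coefs b r -> J x) ->
    inJ J ((P ^+ p.+1 * Q ^+ e.+1 - 'X^M) - (P' ^+ p.+1 * Q ^+ (e + p.+1).+1 - 'X^M)).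
  move=> iJ Jr; have -> : (P ^+ p.+1 * Q ^+ e.+1 - 'X^M)
      - (P' ^+ p.+1 * Q ^+ (e + p.+1).+1 - 'X^M)
      = (P ^+ p.+1 - (P' * Q) ^+ p.+1) * Q ^+ e.+1.
    by rewrite exprMn -addSn exprD; ring.
  apply: inJMr => //; apply: inJX => //.
  rewrite {1}(rdivp_eq Qm P) addrAC subrr add0r => i.
  have [ib|ib] := ltnP i b; last by rewrite nth_default; [apply: ideal0 | apply: leq_trans sr ib].
  by apply: Jr; apply/(nthP 0); exists i; rewrite ?size_mkseq // nth_mkseq.
apply: idl_eq => x.
  set J := idl _; have iJ : is_ideal J by apply: idl_ideal.
  have Jr z : z \in coefs b r -> J z.
    by move=> zr; apply: idl_gen; left; rewrite mem_cat zr orbT.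
  case=> [[xy|[j ->]]|xr].
  - by apply: idl_gen; left; rewrite mem_cat xy.
  - apply: (inJ_trans iJ (key J iJ Jr)) => i; apply: idl_gen; right.
    by exists i.
  - exact: Jr.
set J := idl _; have iJ : is_ideal J by apply: idl_ideal.
have Jr z : z \in coefs b r -> J z by move=> zr; apply: idl_gen; right.
case=> [|[j ->]].
  rewrite mem_cat => /orP[xy|/Jr//].
  by apply: idl_gen; left; left.
have kJ := inJN iJ (key J iJ Jr); rewrite opprB in kJ.
by apply: (inJ_trans iJ kJ) => i; apply: idl_gen; left; right; exists i.
Qed.

Lemma DeltaA_step_sub y a b P Q p e M : chart y a b P Q -> (b <= a)%N ->
  let J := idl (gens y P Q p e M) in
  forall x, DeltaA D (size y + a).+1 J x ->
    idl (fun x => J x \/ x \in coefs b (rmodp P Q)) x.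
Proof.
case=> Pm Qm sP sQ _ ba J.
set J' := idl (fun x => J x \/ _); have iJ' : is_ideal J' by apply: idl_ideal.
set r := rmodp P Q; set P' := rdivp P Q.
have [sq qm] := size_rdivp_monic Qm Pm sP sQ ba.
have JJ' x : J x -> J' x by move=> Jx; apply: idl_gen; left.
have Jr : inJ J' r.
  move=> i; have [ib|ib] := ltnP i b.
    by apply: idl_gen; right; apply/(nthP 0); exists i; rewrite ?size_mkseq // nth_mkseq.
  rewrite nth_default; first exact: ideal0.
  by rewrite (leq_trans _ ib) // -ltnS -sQ size_rmodp_monic.
(* Modulo rho the differential of the generating polynomial is P^p Q^(e+1) [T j], with [T j] of
   degree below a. *)
pose T j := p.+1%:R * dpoly (D j) P + e.+1%:R * (P' * dpoly (D j) Q).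
have sT j : (size (T j) <= a)%N.
  have n1 (k : nat) (u : {poly A}) : (size (k%:R * u)%R <= size u)%N.
    by rewrite -[k%:R]polyC_natr mul_polyC size_scale_leq.
  have sdP := size_dpoly_monic (Dder j) Pm sP; have sdQ := size_dpoly_monic (Dder j) Qm sQ.
  rewrite (leq_trans (size_polyD _ _)) // geq_max !(leq_trans (n1 _ _)) //.
  by rewrite (leq_trans (size_polyMleq _ _)) // sq; lia.
pose E (l : 'I_(size y + a)) j := match split l with
  | inl i => D j y`_i | inr i => (T j)`_i end.
(* Elements of J' whose differential lies, modulo J', in the span of the covectors [E]. Membership
   in J' is included to get an ideal: in d(u x) the term x du has to vanish modulo J'. *)
pose Cl x := J' x /\ exists c : 'I_(size y + a) -> A,
  forall j, J' (D j x - \sum_l c l * E l j).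
have iCl : is_ideal Cl.
  split.
  - split; first exact: ideal0; exists (fun=> 0) => j.
    by rewrite (der0 (Dder j)) sub0r big1 ?oppr0 => [|l _]; [apply: ideal0 | rewrite mul0r].
  - move=> x z [Jx [c Hc]] [Jz [c' Hc']]; split; first exact: idealD.
    exists (fun l => c l + c' l) => j; under eq_bigr do rewrite mulrDl.
    by rewrite big_split (derD (Dder j)) opprD addrACA; apply: idealD.
  - move=> u x [Jx [c Hc]]; split; first exact: idealM.
    exists (fun l => u * c l) => j; under eq_bigr do rewrite -mulrA.
    rewrite -mulr_sumr (derM (Dder j)) -addrA -mulrBr; apply: idealD => //.
      exact: idealM.
    exact: idealM.
have JCl x : J x -> Cl x.
  apply: idl_min => // z gz; split; first by apply/JJ'/idl_gen.
  case: gz => [/(nthP 0)[i iy <-]|[k ->]].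
    exists (fun l => (l == lshift a (Ordinal iy))%:R) => j.
    rewrite (bigD1 (lshift a (Ordinal iy))) //= eqxx mul1r big1 => [|l /negPf ->];
      last by rewrite mul0r.
    rewrite addr0 /E (unsplitK (inl (Ordinal iy) : 'I__ + 'I_a)) subrr.
    exact: ideal0.
  pose S := P ^+ p * Q ^+ e.+1.
  exists (fun l => match split l with inl _ => 0 | inr i =>
    if (i <= k)%N then S`_(k - i) else 0 end) => j.
  have -> : \sum_l (match split l with inl _ => 0 | inr i =>
      if (i <= k)%N then S`_(k - i) else 0 end) * E l j = (S * T j)`_k.
    rewrite big_split_ord /= big1 => [|i _]; last first.
      by have := unsplitK (inl i : 'I__ + 'I_a) => /= ->; rewrite mul0r.
    rewrite add0r mulrC coefM.
    transitivity (\sum_(i < a) if (i <= k)%N then (T j)`_i * S`_(k - i) else 0).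
      apply: eq_bigr => i _; rewrite /E.
      have := unsplitK (inr i : 'I_(size y) + 'I_a) => /= ->.
      by case: leqP => _; rewrite ?mul0r // mulrC.
    rewrite -big_mkcond /=.
    rewrite (big_ord_widen_cond (maxn a k.+1) (fun i => i <= k)%N
      (fun i => (T j)`_i * S`_(k - i))) ?leq_maxl //.
    rewrite (big_ord_widen (maxn a k.+1)
      (fun i => (T j)`_i * S`_(k - i))) ?leq_maxr //.
    rewrite [RHS](bigID (fun i : 'I_ _ => (i < a)%N)) /= [X in _ = _ + X]big1 ?addr0.
      by apply: eq_bigl => i; rewrite ltnS andbC.
    by move=> i; rewrite -leqNgt => /andP[_ ai]; rewrite nth_default ?mul0r // (leq_trans (sT j)).
  rewrite -(coef_dpoly (Dder j)) (dpolyD (Dder j)) (dpolyN (Dder j)) (dpolyXn (Dder j)).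
  rewrite oppr0 addr0 (dpolyM (Dder j)) !(dpolyX (Dder j)) -coefB.
  set dP := dpoly _ P; set dQ := dpoly _ Q.
  (* The error is a multiple of P - P' Q = rho, whose coefficients are in J'. *)
  have -> : p.+1%:R * P ^+ p * dP * Q ^+ e.+1 + P ^+ p.+1 * (e.+1%:R * Q ^+ e * dQ)
      - S * T j = P ^+ p * Q ^+ e * e.+1%:R * dQ * (P - P' * Q).
    by rewrite /S /T -/dP -/dQ !exprS; ring.
  apply: (inJM _ iJ'); rewrite {1}(rdivp_eq Qm P) addrAC subrr add0r.
  exact: Jr.
move=> x; apply: idl_min => // {}x [/JJ'//|[q [F [rho [kap [JF _ _ ->]]]]]].
have /choice[c Hc] i : exists c : 'I_(size y + a) -> A,
    forall j, J' (D j (F (rho i)) - \sum_l c l * E l j).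
  by have [_] := JCl _ (JF (rho i)).
(* Modulo J' the block of the Jacobian factors through dimension [size y + a], one less than its own
   size. *)
pose X := \matrix_(i, l) c i l; pose Y := \matrix_(l, j) E l (kap j).
have := @det_congr A J' _ (\matrix_(i, j) D (kap j) (F (rho i))) (X *m Y) iJ'.
rewrite det_thin // subr0; apply => i j; rewrite !mxE.
by under eq_bigr do rewrite !mxE; apply: Hc.
Qed.

(** The minor is taken for the entries of y, the first a coefficients of the quotient of Z by P^p
    Q^e and then by Q, and the i0-th coefficient of the remainder of this second division. Along
    suitable fields its matrix is triangular modulo J, with determinant (p+1)^a (e+1) rho_i0. *)
Lemma DeltaA_step_sup y a b P Q p e M : chart y a b P Q -> (0 < b <= a)%N ->
  let J := idl (gens y P Q p e M) in
  forall x, x \in coefs b (rmodp P Q) -> DeltaA D (size y + a).+1 J x.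
Proof.
case=> Pm Qm sP sQ sur /andP[b0 ba] J x /(nthP 0)[i0].
rewrite size_mkseq => ib <-; rewrite nth_mkseq //.
have iJ : is_ideal J by apply: idl_ideal.
set d := size y; set Z := P ^+ p.+1 * Q ^+ e.+1 - 'X^M.
have JZ : inJ J Z by move=> j; apply: idl_gen; right; exists j.
pose S := P ^+ p * Q ^+ e.
have Sm : S \is monic by rewrite rpredM ?rpredX.
pose lam l (U : {poly A}) := (rdivp (rdivp U S) Q)`_l.
pose lam' (U : {poly A}) := (rmodp (rdivp U S) Q)`_i0.
have Llam l : linear_functional (lam l) by apply: functional_rdivp_coef.
have Llam' : linear_functional lam' by apply: functional_rmodp_coef.
pose F (i : 'I_(d + a).+1) : A :=
  if (i < d)%N then y`_i else if (i < d + a)%N then lam (i - d)%N Z else lam' Z.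
have JF i : J (F i).
  rewrite /F; case: ltnP => id; first by apply: idl_gen; left; apply: mem_nth.
  by case: ltnP => _; apply: functional_ideal.
(* The field l moves y_l for l < d, the coefficient l - d of P for d <= l < d + a, and the constant
   coefficient of Q for l = d + a. *)
pose dP (l : nat) : {poly A} := if (d <= l < d + a)%N then 'X^(l - d) else 0.
pose dQ (l : nat) : {poly A} := if (l < d + a)%N then 0 else 1.
have /choice[w Hw] (l : 'I_(d + a).+1) : exists w : 'I_m -> A,
    [/\ forall i, (i < d)%N -> vfield D w y`_i = (i == l :> nat)%:R,
      dpoly (vfield D w) P = dP l & dpoly (vfield D w) Q = dQ l].
  apply: (sur (fun i => (i == l :> nat)%:R)).
    rewrite /dP; case: ifP => [/andP[dl la]|_]; last by rewrite size_poly0.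
    by rewrite size_polyXn; lia.
  by rewrite /dQ; case: ifP => _; rewrite ?size_poly0 ?size_poly1.
have wd l := vfield_der Dder (w l).
pose U l := p.+1%:R * Q * dP l + e.+1%:R * P * dQ l.
have dZ l : rdivp (dpoly (vfield D (w l)) Z) S = U l.
  rewrite (dpolyD (wd l)) (dpolyN (wd l)) (dpolyXn (wd l)) oppr0 addr0.
  rewrite (dpolyM (wd l)) !(dpolyX (wd l)); have [_ -> ->] := Hw l.
  have -> : p.+1%:R * P ^+ p * dP l * Q ^+ e.+1 + P ^+ p.+1 * (e.+1%:R * Q ^+ e * dQ l)
      = U l * S by rewrite /U /S !exprS; ring.
  by rewrite rdivp_mull.
(* By [functional_der] this is the matrix of variations only modulo J, which suffices because J is
   contained in Delta J. *)
pose N := \matrix_(i < (d + a).+1, l < (d + a).+1)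
  if (i < d)%N then (i == l)%:R else
  if (i < d + a)%N then (rdivp (U l) Q)`_(i - d) else (rmodp (U l) Q)`_i0.
have iD := DeltaA_ideal D (d + a).+1 J.
have detN : DeltaA D (d + a).+1 J (\det N).
  rewrite -[\det N]opprK -[- \det N](addrK (\det (\matrix_(i, l) vfield D (w l) (F i)))).
  rewrite opprB; apply: (idealB iD); first exact: DeltaA_vfield.
  apply: DeltaA_sub; rewrite addrC; apply: det_congr => // i l.
  rewrite !mxE /F; case: ltnP => id.
    have [-> // _ _] := Hw l; rewrite subrr; exact: ideal0.
  by case: ltnP => ida; rewrite -dZ; apply: functional_der.
have n1 (k : nat) (u : {poly A}) : k%:R * u = k%:R *: u.
  by rewrite -[k%:R]polyC_natr mul_polyC.
have rU (l : nat) : (l < d + a)%N ->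
    rdivp (U l) Q = p.+1%:R *: dP l /\ rmodp (U l) Q = 0.
  move=> la; have -> : U l = p.+1%:R *: dP l * Q.
    by rewrite /U /dQ la mulr0 addr0 -n1; ring.
  by rewrite rdivp_mull // rmodp_mull.
have trigN : is_trig_mx N^T.
  apply/is_trig_mxP => l i li; rewrite !mxE.
  have lt := ltn_ord i; rewrite ltnS in lt.
  have la : (l < d + a)%N by rewrite (leq_trans li).
  case: ltnP => id; first by rewrite -val_eqE /= gtn_eqF.
  have [-> ->] := rU l la; rewrite coef0; case: ltnP => // ida.
  rewrite coefZ /dP la andbT; case: leqP => dl; rewrite ?coef0 ?mulr0 //.
  rewrite coefXn; case: eqP => [|_]; last by rewrite mulr0.
  by move=> e1; exfalso; lia.
(* The last field gives U = (e+1) P: here rho enters the determinant. *)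
have dU : rmodp (U (d + a)%N) Q = e.+1%:R *: rmodp P Q.
  rewrite /U /dP /dQ ltnn andbF mulr0 add0r mulr1 n1.
  by rewrite rmodpZ.
have detNE : \det N = p.+1%:R ^+ a * (e.+1%:R * (rmodp P Q)`_i0).
  rewrite -det_tr (det_trig trigN) big_ord_recr /=; congr (_ * _); last first.
    by rewrite !mxE /= ltnNge leq_addr /= ltnn dU coefZ.
  under eq_bigr => i _ do rewrite !mxE /=.
  rewrite big_split_ord /= big1 ?mul1r => [|i _]; last by rewrite ltn_ord eqxx.
  rewrite (eq_bigr (fun=> p.+1%:R)) ?prodr_const ?card_ord // => i _.
  rewrite ltnNge leq_addr /= ltn_add2l ltn_ord.
  have [|-> _] := rU (d + i)%N; first by rewrite ltn_add2l.
  by rewrite /dP leq_addr ltn_add2l ltn_ord /= coefZ coefXn eqxx mulr1.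
have [c1 hc1] := natU p; have [c2 hc2] := natU e.
have -> : (rmodp P Q)`_i0 = c1 ^+ a * c2 * \det N.
  transitivity ((c1 * p.+1%:R) ^+ a * (c2 * e.+1%:R) * (rmodp P Q)`_i0).
    by rewrite hc1 hc2 expr1n !mul1r.
  by rewrite detNE exprMn; ring.
exact: (idealM iD).
Qed.

Lemma DeltaA_step y a b P Q p e M : chart y a b P Q -> (0 < b <= a)%N ->
  let J := idl (gens y P Q p e M) in
  DeltaA D (size y + a).+1 J = idl (fun x => J x \/ x \in coefs b (rmodp P Q)).
Proof.
move=> ch /andP[b0 ba] J; apply/funext => x; apply/propext; split.
  exact: (DeltaA_step_sub (p := p) (e := e) (M := M) ch ba).
apply: idl_min => [|z [/DeltaA_sub //|]]; first exact: DeltaA_ideal.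
by apply: DeltaA_step_sup => //; rewrite b0.
Qed.

End DeltaStep.

(** * Expansion of P in base Q *)

Section EuclideanChains.
Import Pdiv.CommonRing Pdiv.RingMonic.
Variable A : comNzRingType.
Implicit Types (P Q : {poly A}).

Definition quo P Q (i : nat) : {poly A} := iter i (fun p => rdivp p Q) P.

Definition digit P Q (i : nat) : {poly A} := rmodp (quo P Q i) Q.

Definition rems P Q (b s : nat) (x : A) : Prop :=
  exists i l, [/\ (i < s)%N, (l < b)%N & x = (digit P Q i)`_l].

Lemma quo_digits P Q s : Q \is monic ->
  P = quo P Q s * Q ^+ s + \sum_(i < s) digit P Q i * Q ^+ i.
Proof.
move=> Qm; elim: s => [|s IH]; first by rewrite big_ord0 mulr1 addr0.
rewrite {1}IH big_ord_recr /= {1}(rdivp_eq Qm (quo P Q s)) -/(quo P Q s.+1).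
by rewrite mulrDl -mulrA -exprS -addrA [\sum_(_ < _) _ + _]addrC.
Qed.

Lemma remsS P Q b s x : rems P Q b s.+1 x <-> rems P Q b s x \/ x \in coefs b (digit P Q s).
Proof.
split=> [[i [l [+ lb ->]]]|].
  rewrite ltnS leq_eqVlt => /orP[/eqP ->|si]; last by left; exists i, l.
  by right; apply/(nthP 0); exists l; rewrite ?size_mkseq // nth_mkseq.
case=> [[i [l [si lb ->]]]|/(nthP 0)[l]]; first by exists i, l; rewrite ltnS ltnW.
by rewrite size_mkseq => lb <-; exists s, l; rewrite nth_mkseq.
Qed.

Lemma rems0 P Q b x : ~ rems P Q b 0 x.
Proof. by case=> i [l []]. Qed.

End EuclideanChains.

Section DeltaIteration.
Import Pdiv.CommonRing.
Variables (A : comNzRingType) (m : nat) (D : 'I_m -> A -> A).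
Hypothesis Dder : forall j, is_der (D j).
Hypothesis natU : forall n, exists c : A, c * n.+1%:R = 1.
Implicit Types (P Q : {poly A}) (y : seq A).

Lemma DeltaA_iter y a b P Q p e M s : chart D y a b P Q ->
  (size y + a + b)%N = m -> (0 < b)%N -> (s * b <= a)%N ->
  let J := idl (gens y P Q p e M) in
  exists y', [/\ chart D y' (a - s * b) b (quo P Q s) Q, size y' = (size y + s * b)%N,
    iter s (DeltaA D (m - b + 1)) J = idl (fun x => J x \/ rems P Q b s x) &
    idl (fun x => J x \/ rems P Q b s x)
      = idl (gens y' (quo P Q s) Q p (e + s * p.+1) M)].
Proof.
move=> ch dm b0 + J; elim: s => [_|s IH sba].
  have J0 : idl (fun x => J x \/ rems P Q b 0 x) = J.
    rewrite idlU_idl; apply: idl_eq => x; last by move=> gx; apply: idl_gen; left.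
    by case=> [gx|/rems0//]; apply: idl_gen.
  by exists y; rewrite subn0 addn0 J0 addn0.
have [|y' [ch' sy' itE JE]] := IH; first by apply: leq_trans sba; rewrite leq_mul2r leqnSn orbT.
have ba : (b <= a - s * b)%N by move: sba; rewrite mulSn; lia.
have bb : (0 < b <= a - s * b)%N by rewrite b0.
exists (y' ++ coefs b (digit P Q s)).
have JE' : idl (fun x => J x \/ rems P Q b s.+1 x)
    = idl (fun x => idl (fun x => J x \/ rems P Q b s x) x \/ x \in coefs b (digit P Q s)).
  rewrite [RHS]idlU_idl; congr idl; apply/funext => x; apply/propext.
  rewrite remsS; tauto.
split.
- have -> : (a - s.+1 * b = a - s * b - b)%N by rewrite mulSn addnC subnDA.
  exact: (chart_step Dder ch' ba).
- by rewrite size_cat sy' size_mkseq mulSn -addnA [(s * b + b)%N]addnC.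
- rewrite iterS itE JE' {1}JE; have := DeltaA_step Dder natU p (e + s * p.+1) M ch' bb.
  have -> : (size y' + (a - s * b)).+1 = (m - b + 1)%N.
    rewrite sy' -dm addnK addn1 -addnA subnKC //.
    by apply: leq_trans sba; rewrite leq_mul2r leqnSn orbT.
  by move=> ->; rewrite -JE.
rewrite JE' JE (gens_step p (e + s * p.+1) M ch' ba).
by rewrite mulSn [(p.+1 + _)%N]addnC addnA.
Qed.

Theorem DeltaA_euclid (f g : {poly A}) (n r q1 r1 q2 r2 : nat) :
  chart D [::] n r f g -> (n + r)%N = m -> n = (q1 * r + r1)%N ->
  r = (q2 * r1 + r2)%N -> (0 < r1)%N -> (0 < r)%N -> (r2 <= r1)%N ->
  let J := idl (gens [::] f g 0 0 m) in
  let h := quo f g q1 in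
  (forall s, (s <= q2)%N ->
    iter s (DeltaA D (m - r1 + 1)) (iter q1 (DeltaA D (m - r + 1)) J) =
    idl (fun x => (J x \/ rems f g r q1 x) \/ rems g h r1 s x)) /\
  ((0 < r2)%N ->
    DeltaA D (m - r2 + 1)
      (iter q2 (DeltaA D (m - r1 + 1)) (iter q1 (DeltaA D (m - r + 1)) J)) =
    idl (fun x => ((J x \/ rems f g r q1 x) \/ rems g h r1 q2 x)
       \/ x \in coefs r2 (rmodp h (quo g h q2)))).
Proof.
move=> ch dm nE rE r10 r0 r21 J h.
have q1n : (q1 * r <= n)%N by rewrite nE leq_addr.
have [|y [ch1 sy it1 J1]] := DeltaA_iter 0 0 m ch _ r0 q1n; first by [].
have r1E : (n - q1 * r = r1)%N by rewrite nE addKn.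
rewrite r1E in ch1; have ch2 := chart_swap ch1; rewrite -/h in ch2.
have dm2 : (size y + r + r1)%N = m by rewrite sy /=; lia.
have step s : (s <= q2)%N -> (s * r1 <= r)%N.
  by move=> sq; rewrite rE (leq_trans _ (leq_addr _ _)) // leq_mul2r sq orbT.
have main s : (s <= q2)%N -> exists y', [/\ chart D y' (r - s * r1) r1 (quo g h s) h,
    (size y' + (r - s * r1) + r1)%N = m,
    iter s (DeltaA D (m - r1 + 1)) (iter q1 (DeltaA D (m - r + 1)) J) =
    idl (fun x => (J x \/ rems f g r q1 x) \/ rems g h r1 s x) &
    exists p e, idl (fun x => (J x \/ rems f g r q1 x) \/ rems g h r1 s x)
      = idl (gens y' (quo g h s) h p e m)].
  move=> sq; have [y' [ch' sy' it' J']] := DeltaA_iter (0 + q1 * 1) 0 m ch2 dm2 r10 (step s sq).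
  have E : idl (gens y g h (0 + q1 * 1) 0 m) = idl (fun x => J x \/ rems f g r q1 x).
    by rewrite -/J J1 [in RHS]gens_swap.
  exists y'; split=> //.
  - by rewrite sy'; have := step s sq; lia.
  - by rewrite it1 -/J -E it' E idlU_idl.
  by exists (0 + q1 * 1)%N, (0 + s * (0 + q1 * 1).+1)%N; rewrite -J' E idlU_idl.
split=> [s /main[y' []//]|r20].
have [y' [ch' dm' -> [p [e JE]]]] := main q2 (leqnn _).
have r2E : (r - q2 * r1 = r2)%N by rewrite rE addKn.
rewrite r2E in ch' dm'; have ch3 := chart_swap ch'.
have r2b : (0 < r2 <= r1)%N by rewrite r20.
have := DeltaA_step Dder natU e p m ch3 r2b.
have -> : (size y' + r1).+1 = (m - r2 + 1)%N by lia.
by rewrite gens_swap -JE => ->; rewrite idlU_idl.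
Qed.

End DeltaIteration.

(** * Residues and Toeplitz matrices *)

Section ReversedPolynomials.
Variable A : comNzRingType.
Implicit Types (p q : {poly A}) (J : A -> Prop).

(** This is x^n p(1/x) when p has degree at most n: expansions at infinity become power series at 0,
    the form in which the shift matrices present them. *)
Definition revpoly (n : nat) p : {poly A} := \poly_(i < n.+1) p`_(n - i).

Lemma coef_rev n p i : (revpoly n p)`_i = if (i <= n)%N then p`_(n - i) else 0.
Proof. by rewrite coef_poly ltnS. Qed.

Lemma revD n p q : revpoly n (p + q) = revpoly n p + revpoly n q.
Proof.
by apply/polyP => i; rewrite coefD !coef_rev; case: ifP; rewrite ?coefD ?addr0.
Qed.

Lemma revZ n a p : revpoly n (a *: p) = a *: revpoly n p.
Proof.
by apply/polyP => i; rewrite coefZ !coef_rev; case: ifP; rewrite ?coefZ ?mulr0.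
Qed.

Lemma rev0 n : revpoly n 0 = 0.
Proof. by apply/polyP => i; rewrite coef_rev !coef0; case: ifP. Qed.

Lemma rev_sum n (I : Type) (s : seq I) (P : pred I) (F : I -> {poly A}) :
  revpoly n (\sum_(i <- s | P i) F i) = \sum_(i <- s | P i) revpoly n (F i).
Proof. exact: (big_morph (revpoly n) (revD n) (rev0 n)). Qed.

Lemma revXn n i : (i <= n)%N -> revpoly n 'X^i = 'X^(n - i).
Proof.
move=> le_in; apply/polyP => j; rewrite coef_rev !coefXn.
case: leqP => jn; last by rewrite gtn_eqF // (leq_ltn_trans (leq_subr _ _)).
by congr (_ %:R); congr nat_of_bool; apply/eqP/eqP; lia.
Qed.

Lemma revM a b p q : (size p <= a.+1)%N -> (size q <= b.+1)%N ->
  revpoly (a + b) (p * q) = revpoly a p * revpoly b q.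
Proof.
have ex n (u : {poly A}) : (size u <= n.+1)%N -> u = \sum_(i < n.+1) u`_i *: 'X^i.
  move=> su; apply/polyP => j; rewrite coef_sum.
  under eq_bigr => i _ do rewrite coefZ coefXn.
  have [jn|jn] := ltnP j n.+1; last first.
    rewrite nth_default ?(leq_trans su) // big1 // => i _.
    by rewrite gtn_eqF ?mulr0 // (leq_trans (ltn_ord i)).
  rewrite (bigD1 (Ordinal jn)) //= eqxx mulr1 big1 ?addr0 // => i.
  by rewrite -val_eqE /= eq_sym => /negPf ->; rewrite mulr0.
move=> sp sq; rewrite {1}(ex a p sp) {1}(ex b q sq) {2}(ex a p sp) {2}(ex b q sq).
rewrite !rev_sum !big_distrl rev_sum; apply: eq_bigr => i _ /=.
rewrite !big_distrr rev_sum; apply: eq_bigr => j _ /=.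
rewrite -!scalerAl -!scalerAr !revZ -!scalerAl -!scalerAr -exprD !revXn ?leq_ord //.
  rewrite -exprD; congr (_ *: (_ *: 'X^_)).
  by have := ltn_ord i; have := ltn_ord j; lia.
by rewrite leq_add ?leq_ord.
Qed.

Lemma rev_widen n k p : (size p <= n.+1)%N -> revpoly (n + k) p = revpoly n p * 'X^k.
Proof.
move=> sp; rewrite -[p in LHS]mulr1 revM ?size_poly1 //.
by congr (_ * _); rewrite -(expr0 'X) revXn // subn0.
Qed.

Lemma rev_exp n k p : (size p <= n.+1)%N -> revpoly (k * n) (p ^+ k) = revpoly n p ^+ k.
Proof.
move=> sp; elim: k => [|k IH]; first by rewrite mul0n !expr0 (@revXn 0 0).
rewrite exprS mulSn revM ?IH ?exprS //.
rewrite (leq_trans (size_poly_exp_leq _ _)) // ltnS mulnC leq_mul2l.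
by rewrite -subn1 leq_subLR add1n sp orbT.
Qed.

(** q is invertible as a power series, so the first coefficients of p are recovered from those of p
    q by a triangular system. *)
Lemma series_ideal_div J p q n : is_ideal J -> q`_0 = 1 ->
  (forall j, (j < n)%N -> J (p * q)`_j) -> forall j, (j < n)%N -> J p`_j.
Proof.
move=> iJ q0 Jpq; elim/ltn_ind => j IH jn.
have := Jpq j jn; rewrite coefM big_ord_recr /= subnn q0 mulr1 => H.
apply: (ideal_trans iJ (y := - \sum_(i < j) p`_i * q`_(j - i))).
  by rewrite opprK addrC.
apply: (idealN iJ); apply: ideal_sum => // i _; rewrite mulrC; apply: idealM => //.
by apply: IH => //; apply: ltn_trans jn.
Qed.

Lemma size_mul_bound p q a b : (size p <= a.+1)%N -> (size q <= b.+1)%N ->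
  (size (p * q)%R <= (a + b).+1)%N.
Proof.
by move=> sp sq; rewrite (leq_trans (size_polyMleq _ _)) //; lia.
Qed.

Lemma coef_top p q a b : (size p <= a.+1)%N -> (size q <= b.+1)%N ->
  (p * q)`_(a + b) = p`_a * q`_b.
Proof.
move=> sp sq; have := congr1 (fun u : {poly A} => u`_0) (revM sp sq).
by rewrite coef0M !coef_rev !subn0.
Qed.

End ReversedPolynomials.

Section Residues.
Import Pdiv.CommonRing Pdiv.RingMonic.
Variable A : comNzRingType.
Implicit Types (p q g : {poly A}) (J : A -> Prop).

(* The coefficient of 1/x in the expansion of p/g at infinity. *)
Definition Res p g : A := (rmodp p g)`_(size g).-2.

Lemma Res_linear g : g \is monic -> linear_functional (Res^~ g).
Proof.
move=> gm; split=> [p q|a p]; first by rewrite /Res rmodpD // coefD.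
by rewrite /Res rmodpZ // coefZ.
Qed.

Lemma ResD g p q : g \is monic -> Res (p + q) g = Res p g + Res q g.
Proof. by move=> /Res_linear[]. Qed.

Lemma Res_mull g p : g \is monic -> Res (p * g) g = 0.
Proof. by move=> gm; rewrite /Res rmodp_mull // coef0. Qed.

Lemma Res_mod g p q : g \is monic -> Res (q * rmodp p g) g = Res (q * p) g.
Proof. by move=> gm; rewrite /Res rmodp_mulmr. Qed.

Lemma Res_small g b p : size g = b.+2 -> (size p <= b.+1)%N -> Res p g = p`_b.
Proof. by move=> sg sp; rewrite /Res rmodp_small sg. Qed.

Lemma Res_cancel p g q : g \is monic -> q \is monic -> (1 < size g)%N ->
  Res (p * q) (g * q) = Res p g.
Proof.
move=> gm qm; case sg : (size g) => [|[|b]] // _.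
have [c sq] : exists c, size q = c.+1.
  by exists (size q).-1; rewrite prednK // lt0n size_poly_eq0 monic_neq0.
have sr : (size (rmodp p g) <= b.+1)%N by have := size_rmodp_monic p gm; rewrite sg ltnS.
have sgq : size (g * q) = (b + c).+2 by rewrite size_Mmonic ?monic_neq0 // sg sq; lia.
have gqm : g * q \is monic by rewrite monicMl.
have srq : (size (rmodp p g * q)%R <= (b + c).+1)%N.
  by rewrite (leq_trans (size_polyMleq _ _)) // sq; lia.
have [_ E] : rdivp (p * q) (g * q) = rdivp p g /\ rmodp (p * q) (g * q) = rmodp p g * q.
  apply: rdivp_uniq => //; last by rewrite sgq ltnS.
  by rewrite {1}(rdivp_eq gm p); ring.
rewrite /Res E sgq sg /= coef_top ?sq //.
by have /monicP := qm; rewrite lead_coefE sq /= => ->; rewrite mulr1.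
Qed.

(** The quotient rule for p/g. With r the remainder of p, the fraction r dg / g^2 is O(1/x^2)
    because dg has smaller degree than g, so it has no residue. *)
Lemma Res_der (d : A -> A) g b p : is_der d -> g \is monic -> size g = b.+2 ->
  d (Res p g) = Res (dpoly d p) g - Res (p * dpoly d g) (g * g).
Proof.
move=> dd gm sg; set r := rmodp p g; set q := rdivp p g.
have sr : (size r <= b.+1)%N by have := size_rmodp_monic p gm; rewrite sg ltnS.
have sdr : (size (dpoly d r) <= b.+1)%N by apply: leq_trans sr; apply: size_poly.
have sdg := size_dpoly_monic dd gm sg.
have sgg : size (g * g) = (b + b).+3 by rewrite size_Mmonic ?monic_neq0 // sg; lia.
have ggm : g * g \is monic by rewrite monicMl.
have -> : dpoly d p = dpoly d q * g + (q * dpoly d g + dpoly d r).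
  by rewrite {1}(rdivp_eq gm p) (dpolyD dd) (dpolyM dd) addrA.
have -> : p * dpoly d g = q * dpoly d g * g + r * dpoly d g.
  by rewrite {1}(rdivp_eq gm p) -/q -/r; ring.
rewrite !ResD // Res_mull // add0r Res_cancel ?sg //.
rewrite (Res_small sg sdr) (coef_dpoly dd).
have srg : (size (r * dpoly d g)%R <= (b + b).+1)%N.
  exact: size_mul_bound.
rewrite (Res_small sgg); last by rewrite (leq_trans srg).
rewrite [(r * _)`_ _]nth_default // addr0 addrAC subrr add0r.
by rewrite /Res sg.
Qed.

(** The pairing of x^t and x^l by the residue of x^(t+l)/g is antitriangular with ones on the
    antidiagonal, hence invertible over any ring. *)
Lemma Res_coefs J g b p : is_ideal J -> g \is monic -> size g = b.+1 ->
  (forall t, (t < b)%N -> J (Res ('X^t * p) g)) <-> inJ J (rmodp p g).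
Proof.
move=> iJ gm sg; set r := rmodp p g.
have sr : (size r <= b)%N by have := size_rmodp_monic p gm; rewrite sg ltnS.
case: b => [|b] in sg sr *.
  split=> // _; have /eqP -> : r == 0 by rewrite -size_poly_leq0.
  exact: inJ0.
have RE t : Res ('X^t * p) g = \sum_(l < b.+1) r`_l * Res ('X^(l + t)) g.
  rewrite -Res_mod // -/r.
  have ll : linear_functional (fun u => Res ('X^t * u) g).
    have [lD lZ] := Res_linear gm; split=> [u v|a u]; first by rewrite mulrDr lD.
    by rewrite -scalerAr lZ.
  rewrite (functional_coef ll sr); apply: eq_bigr => l _.
  by rewrite addnC exprD.
split=> [H|Jr t tb]; last first.
  by rewrite RE; apply: ideal_sum => // l _; rewrite mulrC; apply: idealM.
have key t : (t < b.+1)%N -> J r`_(b - t).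
  elim/ltn_ind: t => t IH tb; have := H t tb; rewrite RE.
  have lt : (b - t < b.+1)%N by lia.
  rewrite (bigD1 (Ordinal lt)) //= subnK //.
  rewrite (@Res_small g b) ?size_polyXn // coefXn eqxx mulr1 => H'.
  apply: (ideal_trans iJ (y := - \sum_(i < b.+1 | i != Ordinal lt) r`_i * Res 'X^(i + t) g)).
    by rewrite opprK.
  apply: (idealN iJ); apply: ideal_sum => // l lne.
  have [lb|lb] := ltnP (l + t) b.
    rewrite (@Res_small g b) ?size_polyXn // ?coefXn; last by lia.
    by rewrite gtn_eqF // mulr0; apply: ideal0.
  rewrite mulrC; apply: idealM => //.
  have lne' : (l : nat) != (b - t)%N by rewrite -val_eqE /= in lne.
  have lo := ltn_ord l.
  have -> : (l : nat) = (b - (b - l))%N by lia.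
  by apply: IH; lia.
move=> l; have [lb|lb] := ltnP l b.+1.
  have -> : l = (b - (b - l))%N by lia.
  by apply: key; lia.
by rewrite nth_default ?(leq_trans sr) //; apply: ideal0.
Qed.

(* The main hypothesis says that, modulo J and up to degree T in 1/x, E is the
   expansion of x^(R.+1 - N) F/G in powers of 1/x. *)
Lemma Res_series J (F G E : {poly A}) N R T t : is_ideal J -> G \is monic ->
  size G = R.+2 -> (size F <= N.+1)%N -> (R < N)%N ->
  (forall j, (j <= T)%N -> J ((E * revpoly R.+1 G)`_j - F`_(N - j))) ->
  (T <= N)%N -> (N - R + t <= T)%N ->
  J (E`_(N - R + t) - Res ('X^t * F) G).
Proof.
move=> iJ Gm sG sF RN HE TN tT.
set p := 'X^t * F; set r := rmodp p G; set q := rdivp p G.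
pose d := (N - R + t).-1.
have dE : (N - R + t = d.+1)%N by rewrite prednK //; lia.
have dR : (d + R.+1 = t + N)%N by lia.
have sr : (size r <= R.+1)%N by have := size_rmodp_monic p Gm; rewrite sG ltnS.
have G0 : (revpoly R.+1 G)`_0 = 1.
  by rewrite coef_rev subn0; have /monicP := Gm; rewrite lead_coefE sG.
have sp : (size p <= (t + N).+1)%N.
  by rewrite (leq_trans (size_polyMleq _ _)) // size_polyXn; lia.
have sq : (size q <= d.+1)%N.
  have : (size (q * G)%R <= (t + N).+1)%N.
    have -> : q * G = p - r by rewrite {1}(rdivp_eq Gm p) addrK.
    rewrite (leq_trans (size_polyD _ _)) // geq_max sp size_polyN.
    by rewrite (leq_trans sr) //; lia.
  have [->|q0] := eqVneq q 0; first by rewrite size_poly0.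
  by rewrite size_Mmonic // sG; lia.
(* The division x^t F = q G + r in reversed form: q fills the degrees up to d, and the residue is
   the first coefficient after it, in degree d + 1. *)
have key : revpoly N F = revpoly d q * revpoly R.+1 G + revpoly R r * 'X^(d.+1).
  have -> : revpoly N F = revpoly (t + N) p.
    by rewrite /p revM ?size_polyXn // revXn // subnn mul1r.
  rewrite {1}(rdivp_eq Gm p) revD -dR revM ?sG // -/r; congr (_ + _).
  by rewrite -rev_widen //; congr (revpoly _ _); lia.
have low j : (j <= T)%N ->
    J (((E - revpoly d q) * revpoly R.+1 G)`_j - (revpoly R r * 'X^(d.+1))`_j).
  move=> jT; have := HE j jT.
  have -> : F`_(N - j) = (revpoly N F)`_j by rewrite coef_rev (leq_trans jT).
  by rewrite key mulrBl coefB coefD opprD addrA.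
have lowE j : (j < d.+1)%N -> J (E - revpoly d q)`_j.
  apply: (series_ideal_div iJ G0) => i id; have := low i.
  rewrite coefMXn id subr0; apply; rewrite -dE in id.
  by apply: leq_trans tT; apply: ltnW.
have := low d.+1; rewrite -dE => /(_ tT); rewrite dE coefMXn ltnn subnn.
rewrite coef_rev subn0 /= => H.
have -> : Res p G = r`_R by rewrite /Res sG.
have eE : E`_d.+1 = (E - revpoly d q)`_d.+1.
  by rewrite coefB coef_rev ltnn subr0.
rewrite eE; move: H; rewrite coefM big_ord_recr /= subnn G0 mulr1 => H.
apply: (ideal_trans iJ
  (y := - \sum_(i < d.+1) (E - revpoly d q)`_i * (revpoly R.+1 G)`_(d.+1 - i))).
  by rewrite opprK addrC addrA.
apply: (idealN iJ); apply: ideal_sum => // i _.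
by rewrite mulrC; apply: idealM => //; apply: lowE.
Qed.

(** Divide the base G expansion of F by G^(s+1): what is left above the digit s is a polynomial and
    has no residue, the digits before s are in the ideal, and the digit s stands over a single G. *)
Lemma Res_rem F G R s t : G \is monic -> size G = R.+2 ->
  idl (rems F G R.+1 s) (Res ('X^t * F) (G ^+ s.+1) - Res ('X^t * digit F G s) G).
Proof.
move=> Gm sG; have Gsm i : G ^+ i \is monic by rewrite rpredX.
have iJ : is_ideal (idl (rems F G R.+1 s)) by apply: idl_ideal.
have sGi i : (1 < size (G ^+ i.+1))%N.
  elim: i => [|i IH]; first by rewrite expr1 sG.
  by rewrite exprS size_Mmonic ?monic_neq0 ?Gsm // sG; lia.
rewrite [X in Res ('X^t * X) (G ^+ _)](quo_digits F s.+1 Gm) mulrDr mulrA ResD // Res_mull // add0r.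
rewrite big_ord_recr /= mulrDr ResD // mulrA [G ^+ s.+1]exprS Res_cancel ?sG // addrK.
rewrite mulr_sumr (big_morph (Res^~ (G * G ^+ s)) (id1 := 0) (op1 := +%R)); first last.
- have [_ lZ] := Res_linear (Gsm s.+1).
  by rewrite -exprS -(scale0r 0) lZ mul0r.
- by move=> u v; rewrite ResD // -exprS.
apply: ideal_sum => // i _.
have -> : G * G ^+ s = G ^+ (s - i).+1 * G ^+ i.
  by rewrite -exprS -exprD addSn subnK // ltnW.
rewrite mulrA Res_cancel //.
have ll : linear_functional (fun u => Res ('X^t * u) (G ^+ (s - i).+1)).
  have [lD lZ] := Res_linear (Gsm (s - i).+1).
  by split=> [u v|a u]; [rewrite mulrDr lD | rewrite -scalerAr lZ].
apply: (functional_ideal iJ ll) => l.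
have [lR|lR] := ltnP l R.+1; last first.
  rewrite nth_default; first exact: ideal0.
  by rewrite (leq_trans _ lR) // -ltnS -sG size_rmodp_monic.
by apply: idl_gen; exists i, l.
Qed.

End Residues.

(** * Polynomials in the shift matrix as truncated power series *)

Section Toeplitz.
Variables (A : comUnitRingType) (m : nat).
Implicit Types (p q : {poly A}).

(** The ring morphism that sends x to the shift matrix L. As L^(m+1) = 0, it sees exactly the
    coefficients up to degree m ([toep_inj], [eq_toep]). *)
Definition toep p : 'M[A]_m.+1 := horner_mx (lshift_mx A m.+1) p.

Lemma toepXn k : toep 'X^k = lshift_mx A m.+1 ^+ k.
Proof. by rewrite /toep rmorphXn /= horner_mx_X. Qed.

Lemma toepE p : toep p = \sum_(k < size p) p`_k *: lshift_mx A m.+1 ^+ k.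
Proof.
rewrite -{1}(coefK p) poly_def /toep rmorph_sum; apply: eq_bigr => k _ /=.
by rewrite horner_mxZ -/(toep _) toepXn.
Qed.

Lemma toep_coef p (i j : 'I_m.+1) :
  toep p i j = if (j <= i)%N then p`_(i - j) else 0.
Proof.
rewrite toepE summxE; under eq_bigr => k _ do rewrite mxE lshift_mxXE.
case: leqP => [ji|ij]; last first.
  rewrite big1 // => k _; case: eqP => [e|_]; last by rewrite mulr0.
  by move: ij; rewrite e ltnNge leq_addr.
have [lt|le] := ltnP (i - j) (size p); last first.
  rewrite nth_default // big1 // => k _; case: eqP => [e|_]; last by rewrite mulr0.
  by have := ltn_ord k; rewrite ltnNge (leq_trans le) // e addKn.
rewrite (bigD1 (Ordinal lt)) //= subnKC // eqxx mulr1 big1 ?addr0 // => k nk.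
case: eqP => [e|_]; last by rewrite mulr0.
by case/eqP: nk; apply: val_inj; rewrite /= e addKn.
Qed.

Lemma lcoef_toep p k : (k < m.+1)%N -> lcoef (toep p) k = p`_k.
Proof. by move=> km; rewrite /lcoef toep_coef inordK // subn0. Qed.

Lemma toep_inj p q : toep p = toep q -> forall k, (k < m.+1)%N -> p`_k = q`_k.
Proof. by move=> e k km; rewrite -!lcoef_toep // e. Qed.

Lemma eq_toep p q : (forall k, (k < m.+1)%N -> p`_k = q`_k) -> toep p = toep q.
Proof.
move=> e; apply/matrixP => i j; rewrite !toep_coef; case: ifP => // _.
by rewrite e // (leq_ltn_trans (leq_subr _ _)).
Qed.

Lemma lunip_toep (M : 'M[A]_m.+1) : lunip M -> exists p, M = toep p.
Proof.
move=> [cM _]; exists (\poly_(k < m.+1) lcoef M k).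
rewrite [LHS](lshift_expansion cM) poly_def /toep rmorph_sum; apply: eq_bigr => k _ /=.
by rewrite horner_mxZ -/(toep _) toepXn.
Qed.

Lemma toep_lunip1 (c : nat -> A) l p :
  (forall k, (k < m.+1)%N -> p`_k = if k == 0%N then 1 else if (k < l)%N then c k else 0) ->
  1%:M + \sum_(1 <= k < l) c k *: lshift_mx A m.+1 ^+ k = toep p.
Proof.
move=> Hp; transitivity (toep (1 + \sum_(1 <= k < l) c k *: 'X^k)).
  rewrite /toep rmorphD rmorph_sum (rmorph1 (horner_mx (lshift_mx A m.+1))).
  congr (_ + _); apply: eq_bigr => k _ /=.
  by rewrite horner_mxZ -/(toep _) toepXn.
apply: eq_toep => k km; rewrite Hp // coefD coef1 coef_sum.
under eq_bigr => j _ do rewrite coefZ coefXn.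
case: eqP => [->|/eqP k0] /=.
  rewrite big1_seq ?addr0 // => j; rewrite mem_index_iota => /andP[_ /andP[j0 _]].
  by rewrite eq_sym gtn_eqF // mulr0.
rewrite add0r; case: ltnP => kl.
  rewrite (bigD1_seq k) ?iota_uniq ?mem_index_iota ?kl ?lt0n ?k0 //=.
  rewrite eqxx mulr1 big1 ?addr0 // => j; rewrite eq_sym => /negPf ->.
  by rewrite mulr0.
rewrite big1_seq // => j; rewrite mem_index_iota => /andP[_ /andP[_ jl]].
by rewrite gtn_eqF ?mulr0 // (leq_trans jl).
Qed.

Lemma toepM p q : toep (p * q) = toep p *m toep q.
Proof. by rewrite /toep rmorphM. Qed.

Lemma toep_exp p k : toep (p ^+ k) = toep p ^+ k.
Proof. by rewrite /toep rmorphXn. Qed.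

End Toeplitz.

Section MonicFromCoefficients.
Variable A : nzRingType.

Definition monic_of (n : nat) (c : nat -> A) : {poly A} := 'X^n + \poly_(i < n) c i.

Lemma coef_monic_of n c i :
  (monic_of n c)`_i = if (i < n)%N then c i else (i == n)%:R.
Proof.
rewrite coefD coefXn coef_poly; case: ltnP => ni; last by rewrite addr0.
by rewrite ltn_eqF // add0r.
Qed.

Lemma size_monic_of n c : size (monic_of n c) = n.+1.
Proof.
by rewrite size_polyDl size_polyXn // ltnS size_poly.
Qed.

Lemma monic_of_monic n c : monic_of n c \is monic.
Proof. by rewrite monicE lead_coefE size_monic_of /= coef_monic_of ltnn eqxx. Qed.

End MonicFromCoefficients.

Lemma map_monic_of (A B : nzRingType) (f : {rmorphism A -> B}) n c :
  map_poly f (monic_of n c) = monic_of n (f \o c).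
Proof.
apply/polyP => i; rewrite coef_map !coef_monic_of /=.
by case: ifP => //; rewrite rmorph_nat.
Qed.

(** * Division by monic polynomials under ring morphisms *)

Section RingMorphisms.
Import Pdiv.CommonRing Pdiv.RingMonic.
Variables (A B : comNzRingType) (f : {rmorphism A -> B}).
Implicit Types (p d : {poly A}).

Lemma map_rdivp_monic p d : d \is monic ->
  map_poly f (rdivp p d) = rdivp (map_poly f p) (map_poly f d) /\
  map_poly f (rmodp p d) = rmodp (map_poly f p) (map_poly f d).
Proof.
move=> dm; have fdm : map_poly f d \is monic by apply: monic_map.
have [|//|-> ->//] := @rdivp_uniq _ (map_poly f d) (map_poly f p)
  (map_poly f (rdivp p d)) (map_poly f (rmodp p d)) fdm.
  by rewrite -rmorphM -rmorphD /= -(rdivp_eq dm).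
rewrite (leq_ltn_trans (size_poly _ _)) // size_map_poly_id0; first exact: size_rmodp_monic.
by move/monicP: dm => ->; rewrite rmorph1 oner_eq0.
Qed.

Lemma map_quo p d i : d \is monic ->
  map_poly f (quo p d i) = quo (map_poly f p) (map_poly f d) i.
Proof. by move=> dm; elim: i => //= i <-; have [-> _] := map_rdivp_monic (quo p d i) dm. Qed.

Lemma map_digit p d i : d \is monic ->
  map_poly f (digit p d i) = digit (map_poly f p) (map_poly f d) i.
Proof.
by move=> dm; rewrite /digit -map_quo //; have [_ ->] := map_rdivp_monic (quo p d i) dm.
Qed.

Lemma rems_map p d b s x : d \is monic ->
  rems p d b s x -> rems (map_poly f p) (map_poly f d) b s (f x).
Proof.
move=> dm [i [l [si lb ->]]]; exists i, l; split=> //.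
by rewrite -map_digit // coef_map.
Qed.

Lemma idl_map (G : A -> Prop) (G' : B -> Prop) :
  (forall x, G x -> idl G' (f x)) -> forall x, idl G x -> idl G' (f x).
Proof.
move=> GG' x [k [h [g [Gg ->]]]]; rewrite rmorph_sum; apply: ideal_sum => [|i _].
  exact: idl_ideal.
by rewrite rmorphM; apply: (idealM (idl_ideal G')); apply: GG'.
Qed.

Lemma idl_image (G1 G2 : A -> Prop) : idl G1 = idl G2 ->
  idl (fun y => exists2 x, G1 x & y = f x) = idl (fun y => exists2 x, G2 x & y = f x).
Proof.
move=> e; have key (G G' : A -> Prop) : idl G = idl G' ->
    forall y, (exists2 x, G x & y = f x) -> idl (fun y => exists2 x, G' x & y = f x) y.
  move=> e' _ [x Gx ->]; have : idl G x by apply: idl_gen.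
  by rewrite e'; apply: idl_map => x' G'x'; apply: idl_gen; exists x'.
by apply: idl_eq; apply: key.
Qed.

Lemma image_rems p d b s : d \is monic ->
  (fun y => exists2 x, rems p d b s x & y = f x) = rems (map_poly f p) (map_poly f d) b s.
Proof.
move=> dm; apply/funext => y; apply/propext; split=> [[x rx ->]|[i [l [si lb ->]]]].
  exact: rems_map.
exists (digit p d i)`_l; first by exists i, l.
by rewrite -map_digit // coef_map.
Qed.

Lemma image_coefs p b :
  (fun y => exists2 x, x \in coefs b p & y = f x) = (fun y => y \in coefs b (map_poly f p)).
Proof.
have -> : coefs b (map_poly f p) = map f (coefs b p).
  by rewrite /coefs /mkseq -map_comp; apply: eq_map => i /=; rewrite coef_map.
by apply/funext => y; apply/propext; split=> [[x xc ->]|/mapP[x]];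
  [apply: map_f | exists x].
Qed.

Lemma image_or (G1 G2 : A -> Prop) :
  (fun y => exists2 x, G1 x \/ G2 x & y = f x) =
  (fun y => (exists2 x, G1 x & y = f x) \/ (exists2 x, G2 x & y = f x)).
Proof.
apply/funext => y; apply/propext; split=> [[x [h|h] ->]|[[x h ->]|[x h ->]]].
- by left; exists x.
- by right; exists x.
- by exists x => //; left.
- by exists x => //; right.
Qed.

End RingMorphisms.

Section QuotientSizes.
Import Pdiv.CommonRing Pdiv.RingMonic.
Variable A : comNzRingType.

Lemma quo_monic (F G : {poly A}) N R s : F \is monic -> G \is monic ->
  size F = N.+1 -> size G = R.+1 -> (s * R <= N)%N ->
  quo F G s \is monic /\ size (quo F G s) = (N - s * R).+1.
Proof.
move=> Fm Gm sF sG; elim: s => [|s IH] sRN; first by rewrite subn0.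
have [|qm sq] := IH; first by apply: leq_trans sRN; rewrite leq_mul2r leqnSn orbT.
have sR : (R <= N - s * R)%N by move: sRN; rewrite mulSn; lia.
have [-> ->] := size_rdivp_monic Gm qm sq sG sR; split=> //.
by rewrite mulSn addnC subnDA.
Qed.

Lemma rev_quo (F G : {poly A}) N R s (J : A -> Prop) : is_ideal J ->
  F \is monic -> G \is monic -> size F = N.+1 -> size G = R.+1 -> (s * R <= N)%N ->
  (forall x, rems F G R s x -> J x) ->
  inJ J (revpoly N F - revpoly (N - s * R) (quo F G s) * revpoly R G ^+ s).
Proof.
move=> iJ Fm Gm sF sG sRN HJ; have [qm sq] := quo_monic Fm Gm sF sG sRN.
have Nd : (N = (N - s * R) + s * R)%N by rewrite subnK.
have sGs : (size (G ^+ s) <= (s * R).+1)%N.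
  rewrite (leq_trans (size_poly_exp_leq _ _)) // sG /= mulnC //.
rewrite {1}(quo_digits F s Gm) revD {1}Nd revM ?sq // -(rev_exp s (eq_leq sG)).
rewrite addrAC subrr add0r => i; rewrite coef_rev; case: ifP => _; last exact: ideal0.
move: (N - i)%N => {}i.
suff : inJ J (\sum_(i < s) digit F G i * G ^+ i) by apply.
elim/big_ind: _ => [|u v|j _]; [exact: inJ0 | exact: inJD |].
apply: (inJMr _ iJ) => l.
have [lR|lR] := ltnP l R; first by apply: HJ; exists j, l.
rewrite nth_default; first exact: ideal0.
by rewrite (leq_trans _ lR) // -ltnS -sG size_rmodp_monic.
Qed.

(** The digits contribute to F only in degrees below s R, that is, beyond degree N - s R after
    reversal. Up to that degree the identity is exact, whereas [rev_quo] needs the ideal of the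
    digits. *)
Lemma rev_quo_low (F G : {poly A}) N R s k : F \is monic -> G \is monic ->
  size F = N.+1 -> size G = R.+1 -> (s * R <= N)%N -> (k <= N - s * R)%N ->
  (revpoly N F)`_k = (revpoly (N - s * R) (quo F G s) * revpoly R G ^+ s)`_k.
Proof.
move=> Fm Gm sF sG sRN kN; have [qm sq] := quo_monic Fm Gm sF sG sRN.
have Nd : (N = (N - s * R) + s * R)%N by rewrite subnK.
have sGs : (size (G ^+ s) <= (s * R).+1)%N.
  rewrite (leq_trans (size_poly_exp_leq _ _)) // sG /= mulnC //.
rewrite {1}(quo_digits F s Gm) revD {1}Nd revM ?sq // -(rev_exp s (eq_leq sG)).
rewrite coefD [X in _ + X]coef_rev (leq_trans kN (leq_subr _ _)).
rewrite [X in _ + X]nth_default ?addr0 //.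
apply: (@leq_trans (s * R)%N); last by lia.
have szG i : (size (G ^+ i) <= (i * R).+1)%N.
  by rewrite (leq_trans (size_poly_exp_leq _ _)) // sG /= mulnC.
elim: (s) => [|t IH]; first by rewrite big_ord0 size_poly0.
rewrite big_ord_recr /= (leq_trans (size_polyD _ _)) // geq_max; apply/andP; split.
  by apply: leq_trans IH _; rewrite leq_mul2r leqnSn orbT.
rewrite (leq_trans (size_polyMleq _ _)) //.
have := size_rmodp_monic (quo F G t) Gm; rewrite -/(digit F G t) sG ltnS => h1.
have := szG t => h2; rewrite mulSn.
by apply: (@leq_trans (R + (t * R).+1).-1); [rewrite -!subn1 leq_sub2r // leq_add | rewrite addnS].
Qed.

End QuotientSizes.

(** * The polynomials Psi *)

Module PsiTheory.
Import mpoly.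

Section PsiResidues.
Import Pdiv.CommonRing Pdiv.RingMonic.
Variables (K : numFieldType) (N R : nat).
Hypotheses (R0 : (0 < R)%N) (RN : (R <= N)%N).
Local Notation P := {mpoly K[N + R]}.
Local Notation u := (MPsi.uvar K N R).
Local Notation v := (MPsi.vvar K N R).
Local Notation delta := (MPsi.delta K N R).
Local Notation dv := (@MPsi.dv K N R).
Local Notation Psi := (MPsi.Psi K N R).
Local Notation Q := (N %/ R)%N.
Local Notation R1 := (N %% R)%N.

Definition Fpoly : {poly P} := monic_of N u.
Definition Gpoly : {poly P} := monic_of R v.
Local Notation F := Fpoly.
Local Notation G := Gpoly.

Let Fm : F \is monic. Proof. exact: monic_of_monic. Qed.
Let Gm : G \is monic. Proof. exact: monic_of_monic. Qed.
Let sF : size F = N.+1. Proof. exact: size_monic_of. Qed.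
Let sG : size G = R.+1. Proof. exact: size_monic_of. Qed.

(** The recursion for delta is long division: this is x^(R-N) F/G expanded in powers of 1/x up to
    order N. *)
Definition delta_series : {poly P} := \poly_(j < N.+1) delta (N - j).

Lemma delta_series_mul j : (j <= N)%N ->
  (delta_series * revpoly R G)`_j = (revpoly N F)`_j.
Proof.
move=> jN; rewrite [RHS]coef_rev jN coef_monic_of.
have e_coef i : (i <= N)%N -> delta_series`_i = delta (N - i).
  by move=> iN; rewrite coef_poly ltnS iN.
have G0 : (revpoly R G)`_0 = 1 by rewrite coef_rev subn0 coef_monic_of ltnn eqxx.
case: j jN => [|j] jN.
  by rewrite coef0M G0 mulr1 e_coef // subn0 MPsi.deltaN ltnn eqxx.
have -> : (N - j.+1 < N)%N by lia.
have := @MPsi.delta_rec K N R j.+1 jN; set S := \sum_(1 <= k < _) _ => Dj.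
have -> : u (N - j.+1) = delta (N - j.+1) + S by rewrite Dj subrK.
rewrite mulrC coefM big_ord_recl G0 mul1r e_coef //; congr (_ + _).
rewrite /S {S Dj}; apply/esym.
rewrite big_add1 /= big_mkord.
rewrite (big_ord_widen j.+1 (fun k => v (R - k.+1) * delta (N - j.+1 + k.+1))) ?geq_minl //.
rewrite [LHS]big_mkcond; apply: eq_bigr => k _ /=.
rewrite coef_rev /bump add1n leq_min ltn_ord /=; case: ltnP => kR; last by rewrite mul0r.
rewrite coef_monic_of; have -> : (R - k.+1 < R)%N by lia.
rewrite e_coef; last by have := ltn_ord k; lia.
by congr (_ * delta _); have := ltn_ord k; lia.
Qed.

(** In x^t F/G = x^(t+N-R) sum_j delta_(N-j) x^(-j), the term in 1/x has j = N - R + 1 + t. The zero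
    ideal is used for J to get an equality out of [Res_series]. *)
Lemma delta_Res t : (t < R)%N -> delta (R - 1 - t) = Res ('X^t * F) G.
Proof.
move=> tR; pose J (x : P) := x = 0.
have iJ : is_ideal J.
  by split=> [//|x y -> ->|a x ->]; rewrite /J ?addr0 ?mulr0.
have RE : R = R.-1.+1 by rewrite prednK.
have sG' : size G = R.-1.+2 by rewrite sG prednK.
have := @Res_series _ J F G delta_series N R.-1 N t iJ Gm sG'.
rewrite prednK // sF coef_poly => H.
have -> : delta (R - 1 - t) = if (N - R.-1 + t < N.+1)%N then delta (N - (N - R.-1 + t)) else 0.
  by case: ifP; [move=> _; congr delta | ]; lia.
apply/eqP; rewrite -subr_eq0; apply/eqP; apply: H => //; try lia.
move=> j jN; rewrite /J delta_series_mul // coef_rev jN subrr //.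
Qed.

Lemma dv_der i : (i < R)%N -> is_der (dv i).
Proof.
by move=> iR; rewrite /MPsi.dv insubT; split=> x y; rewrite ?mderivD ?mderivM.
Qed.

Lemma dv_mulC i (k : K) (p : P) : (i < R)%N -> dv i (k%:MP * p) = k%:MP * dv i p.
Proof. by move=> iR; rewrite /MPsi.dv insubT mderiv_mulC. Qed.

Lemma mderiv_var (i j : 'I_(N + R)) : mderiv i ('X_j : P) = (i == j)%:R.
Proof.
rewrite mderivX mnm1E eq_sym; case: eqP => [->|_]; last by rewrite scale0r.
rewrite scale1r -(mpolyX0 _ K); congr mpolyX; apply/mnmP => l; rewrite mnmBE subnn mnm0E. done.
Qed.

Lemma dv_uvar i k : (i < R)%N -> dv i (u k) = 0.
Proof.
move=> iR; have d0 := der0 (dv_der iR); rewrite /MPsi.uvar /vnth.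
case: insubP => // k' _ _; rewrite mxE /MPsi.dv insubT mderiv_var.
by rewrite -val_eqE /= gtn_eqF // ltn_addr.
Qed.

Lemma dv_vvar i k : (i < R)%N -> (k < R)%N -> dv i (v k) = (k == i)%:R.
Proof.
move=> iR kR; rewrite /MPsi.vvar /vnth insubT mxE /MPsi.dv insubT mderiv_var.
by rewrite -val_eqE /= eqn_add2l eq_sym.
Qed.

Lemma dpoly_dv_F i t : (i < R)%N -> dpoly (dv i) ('X^t * F) = 0.
Proof.
move=> iR; have dd := dv_der iR.
rewrite (dpolyM dd) (dpolyXn dd) mul0r add0r (_ : dpoly _ F = 0) ?mulr0 //.
apply/polyP => k; rewrite (coef_dpoly dd) coef0 coef_monic_of.
case: ifP => _; first exact: dv_uvar.
by case: eqP => _; rewrite ?(der0 dd) ?(der1 dd).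
Qed.

Lemma dpoly_dv_G i : (i < R)%N -> dpoly (dv i) G = 'X^i.
Proof.
move=> iR; have dd := dv_der iR.
apply/polyP => k; rewrite (coef_dpoly dd) coefXn coef_monic_of.
case: ltnP => kR; first exact: dv_vvar.
rewrite [in RHS]gtn_eqF; last exact: leq_trans kR.
by case: eqP => _; rewrite ?(der0 dd) ?(der1 dd).
Qed.

Lemma size_Gexp k : (1 < size (G ^+ k.+1))%N.
Proof.
have Gsm i : G ^+ i \is monic by rewrite rpredX.
elim: k => [|k IH]; first by rewrite expr1 sG.
by rewrite exprS size_Mmonic ?monic_neq0 ?Gsm // sG; lia.
Qed.

(** F does not contain the v's and G has derivative x^i in v_i, so deriving F/G^(s+1) gives -(s+1)
    x^i F/G^(s+2). *)
Lemma dv_Res i t s : (i < R)%N ->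
  dv i (Res ('X^t * F) (G ^+ s.+1)) = - s.+1%:R * Res ('X^(i + t) * F) (G ^+ s.+2).
Proof.
move=> iR; have dd := dv_der iR; have Gsm k : G ^+ k \is monic by rewrite rpredX.
have [b sb] : exists b, size (G ^+ s.+1) = b.+2.
  by exists (size (G ^+ s.+1)).-2; have := size_Gexp s; lia.
rewrite (Res_der _ dd (Gsm _) sb) dpoly_dv_F // {1}/Res rmod0p coef0 sub0r.
rewrite (dpolyX dd) dpoly_dv_G // mulNr; congr (- _).
have -> : 'X^t * F * (s.+1%:R * G ^+ s * 'X^i)
    = s.+1%:R *: ('X^(i + t) * F) * G ^+ s.
  by rewrite -mul_polyC polyC_natr exprD; ring.
have -> : G ^+ s.+1 * G ^+ s.+1 = G ^+ s.+2 * G ^+ s by rewrite -!exprD; congr (_ ^+ _); lia.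
rewrite Res_cancel //; last exact: size_Gexp.
by have [_ ->] := Res_linear (Gsm s.+2).
Qed.

Lemma iter_dv_Res t s : exists2 k : K, k != 0 &
  iter s (dv 0) (Res ('X^t * F) (G ^+ 2)) = k%:MP * Res ('X^t * F) (G ^+ s.+2).
Proof.
elim: s => [|s [k k0 E]].
  by exists 1; rewrite ?oner_eq0 // mpolyC1 mul1r.
exists (k * - s.+2%:R); first by rewrite mulf_neq0 // oppr_eq0 pnatr_eq0.
by rewrite iterS E dv_mulC // dv_Res // mpolyCM mpolyCN mpolyC_nat mulrA add0n.
Qed.

(** Deriving in v_0 only raises the power of G; the one derivative in v_(R-1-i) also brings the
    factor x^(R-1-i). The constant is (-1)^s s!. *)
Lemma Psi_Res s i : (s < Q)%N -> (i < R)%N -> exists2 k : K, k != 0 &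
  Psi (s * R + i) = k%:MP * Res ('X^(R - 1 - i) * F) (G ^+ s.+1).
Proof.
move=> sQ iR; rewrite /MPsi.Psi divnMDl // modnMDl !(divn_small iR, modn_small iR) addn0.
case: s sQ => [|s] sQ /=.
  exists 1; first exact: oner_neq0.
  rewrite mpolyC1 mul1r expr1 -delta_Res; last by lia.
  by congr delta; lia.
rewrite sQ; have -> : delta (R - 1) = Res ('X^0 * F) (G ^+ 1).
  by rewrite expr1 -delta_Res // subn0.
have iR' : (R - 1 - i < R)%N by lia.
rewrite dv_Res // addn0.
have [k k0 E] := iter_dv_Res (R - 1 - i) s.
exists (- k); first by rewrite oppr_eq0.
rewrite mulN1r.
have -> (x : P) : iter s (dv 0) (- x) = - iter s (dv 0) x.
  by elim: (s) => //= s' ->; rewrite (derN (dv_der R0)).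
by rewrite E mpolyCN mulNr.
Qed.

Lemma scale_ideal (J : P -> Prop) (k : K) x : is_ideal J -> k != 0 ->
  J (k%:MP * x) -> J x.
Proof.
move=> iJ k0 Jx; rewrite -[x]mul1r -(mpolyC1 _ K) -(mulVf k0) mpolyCM -mulrA.
exact: idealM.
Qed.

Definition Psis (s : nat) (x : P) : Prop := exists2 j, (j < s)%N & x = Psi j.

(** Triangular in the block number: modulo the earlier digits, [Res_rem] turns a block of R values
    of Psi into residues of a single digit, and [Res_coefs] trades these for its coefficients. *)
Theorem idl_Psis s : (s <= Q)%N -> idl (Psis (s * R)) = idl (rems F G R s).
Proof.
move=> sQ; have RE : R = R.-1.+1 by rewrite prednK.
have sG' : size G = R.-1.+2 by rewrite sG prednK.
have rem_sub s1 s2 x : (s1 <= s2)%N -> rems F G R s1 x -> rems F G R s2 x.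
  by move=> ss [i [l [si lb ->]]]; exists i, l; split=> //; apply: leq_trans ss.
have ResE s' t : idl (rems F G R s')
    (Res ('X^t * F) (G ^+ s'.+1) - Res ('X^t * digit F G s') G).
  by have := Res_rem F s' t Gm sG'; rewrite prednK.
apply: idl_eq => x.
  case=> j js ->; rewrite (divn_eq j R).
  have jR : (j %% R < R)%N by rewrite ltn_mod.
  have js' : (j %/ R < s)%N by rewrite ltn_divLR.
  have [k _ ->] := Psi_Res (leq_trans js' sQ) jR.
  have iJ := idl_ideal (rems F G R s); apply: (idealM iJ).
  apply: (ideal_trans iJ (y := Res ('X^(R - 1 - j %% R) * digit F G (j %/ R)) G)).
    by apply: idl_min (ResE _ _) => // y /(rem_sub _ _ _ (ltnW js'))/idl_gen.
  apply: (proj2 (Res_coefs (digit F G (j %/ R)) iJ Gm sG)); last by lia.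
  have dm : rmodp (digit F G (j %/ R)) G = digit F G (j %/ R) by rewrite rmodp_id.
  rewrite dm => l; have [lR|lR] := ltnP l R; first by apply: idl_gen; exists (j %/ R)%N, l.
  rewrite nth_default; first exact: ideal0.
  by rewrite (leq_trans _ lR) // -ltnS -sG size_rmodp_monic.
move=> [i [l [si lR ->]]]; move: l lR.
suff : inJ (idl (Psis (s * R))) (digit F G i) by [].
have iJ := idl_ideal (Psis (s * R)).
elim/ltn_ind: i si => i IH si.
rewrite -[digit F G i](rmodp_id Gm); apply/(Res_coefs _ iJ Gm sG) => t tR.
apply: (ideal_trans iJ (y := Res ('X^t * F) (G ^+ i.+1))).
  rewrite -opprB; apply: (idealN iJ).
  apply: idl_min (ResE i t) => // y [i' [l [ii' lR ->]]].
  by apply: IH => //; apply: ltn_trans si.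
have tR' : (R - 1 - t < R)%N by lia.
have [k k0 E] := Psi_Res (leq_trans si sQ) tR'.
have tE : (R - 1 - (R - 1 - t) = t)%N by lia.
rewrite tE in E; apply: (scale_ideal iJ k0); rewrite -E; apply: idl_gen.
exists (i * R + (R - 1 - t))%N => //.
by rewrite (@leq_trans (i.+1 * R)) ?leq_mul2r ?si ?orbT // mulSn addnC ltn_add2r.
Qed.

End PsiResidues.

(** As truncated series, V is the reversed G and E is the quotient of the reversed F by it; so the
    inverse of V^(-Q) E is G^(Q+1)/F, reversed. *)
Lemma beta_series (K : numFieldType) (N' R : nat) : (0 < R)%N -> (R <= N'.+1)%N ->
  exists x : {poly {mpoly K[N'.+1 + R]}},
    (forall k, (k < N'.+1)%N -> x`_k = lcoef (invmx (invmx (MPsi.Vmx K N'.+1 R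
       ^+ (N'.+1 %/ R)) *m MPsi.Emx K N'.+1 R)) k) /\
    (forall k, (k < N'.+1)%N -> (x * revpoly N'.+1 (Fpoly K N'.+1 R))`_k
       = (revpoly R (Gpoly K N'.+1 R) ^+ (N'.+1 %/ R).+1)`_k).
Proof.
move=> R0 RN; set N := N'.+1; set F := Fpoly _ _ _; set G := Gpoly _ _ _.
set V := MPsi.Vmx K N R; set E := MPsi.Emx K N R; set Q := (N %/ R)%N.
have VE : V = toep N' (revpoly R G).
  apply: toep_lunip1 => k _; rewrite coef_rev coef_monic_of.
  case: (k =P 0%N) => [->|k0]; first by rewrite subn0 ltnn eqxx.
  by rewrite ltnS; case: (leqP k R) => // kR; have -> : (R - k < R)%N by lia.
have EE : E = toep N' (delta_series K N R).
  apply: toep_lunip1 => k kN; rewrite coef_poly ltnW //.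
  by case: (k =P 0%N) => [->|_]; [rewrite subn0 MPsi.deltaN | rewrite kN].
have uV : lunip (V ^+ Q) by apply/lunip_exp/lunip1.
have uX : lunip (invmx (V ^+ Q) *m E).
  by apply: lunip_mul; [exact: lunip_inv | exact: lunip1].
have [x Ex] := lunip_toep (lunip_inv uX).
exists x; split=> k kN; first by rewrite Ex lcoef_toep.
rewrite -(lcoef_toep (m := N')) // -[RHS](lcoef_toep (m := N')) //; congr lcoef.
have -> : toep N' (x * revpoly N F) = toep N' (x * (delta_series K N R * revpoly R G)).
  apply: eq_toep => l lN; rewrite !coefM; apply: eq_bigr => j _; congr (_ * _).
  by rewrite delta_series_mul // (leq_trans (leq_subr _ _)) // ltnW.
rewrite mulrC -mulrA [revpoly R G * x]mulrC !toepM toep_exp -VE -EE -Ex exprS.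
rewrite mulmxA; have : E *m invmx (invmx (V ^+ Q) *m E) = V ^+ Q.
  set Y := invmx (V ^+ Q) *m E in uX *.
  have EY : E = V ^+ Q *m Y by rewrite mulKVmx // lunip_unit.
  by rewrite {1}EY -mulmxA mulmxV ?mulmx1 // lunip_unit.
by move=> ->; rewrite -exprS exprSr.
Qed.

Section PsiBeta.
Import Pdiv.CommonRing Pdiv.RingMonic.
Variables (K : numFieldType) (N' R : nat).
Local Notation N := N'.+1.
Hypotheses (R0 : (0 < R)%N) (RN : (R < N)%N).
Local Notation P := {mpoly K[N + R]}.
Local Notation Q := (N %/ R)%N.
Local Notation R1 := (N %% R)%N.
Local Notation F := (Fpoly K N R).
Local Notation G := (Gpoly K N R).
Local Notation h := (quo F G Q).

(** The beta's are coefficients of G^(Q+1)/F at infinity. Modulo the digits F is h G^Q, so that this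
    fraction becomes G/h. *)
Lemma Psi_beta i : (i < R1)%N ->
  idl (rems F G R Q) (MPsi.Psi K N R (Q * R + i) - Res ('X^(R1 - 1 - i) * G) h).
Proof.
move=> iR1; set J := idl _; have iJ : is_ideal J by apply: idl_ideal.
have iR : (i < R)%N by apply: ltn_trans iR1 _; rewrite ltn_mod.
have Q0 : (0 < Q)%N by rewrite divn_gt0 // ltnW.
have NE := divn_eq N R.
have Fm : F \is monic by apply: monic_of_monic.
have Gm : G \is monic by apply: monic_of_monic.
have sF : size F = N.+1 by apply: size_monic_of.
have sG : size G = R.+1 by apply: size_monic_of.
have QRN : (Q * R <= N)%N by rewrite leq_divM.
have QRE : (N - Q * R = R1)%N by rewrite {1}NE addKn.
have [hm sh] := quo_monic Fm Gm sF sG QRN; rewrite QRE in sh.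
have [x [Hx Ex]] := beta_series K R0 (ltnW RN).
(* beta_j is the coefficient of L^(N-j), and N - ((Q-1) R + R1 + i) = R - i. *)
have -> : MPsi.Psi K N R (Q * R + i) = x`_(R - i).
  rewrite /MPsi.Psi divnMDl // modnMDl !(divn_small iR, modn_small iR) addn0.
  rewrite gtn_eqF // ltnn /MPsi.beta -Hx; last by lia.
  have RQ : (R <= Q * R)%N by rewrite leq_pmull.
  by congr nth; rewrite mulnBl mul1n; move: NE RQ; set QR := (Q * R)%N; set r1 := R1; lia.
have R1E : R1 = R1.-1.+1 by rewrite prednK // (leq_ltn_trans _ iR1).
have sh' : size h = R1.-1.+2 by rewrite sh -R1E.
have R1R : (R1 < R)%N by rewrite ltn_mod.
have tE : (R - R1.-1 + (R1 - 1 - i) = R - i)%N.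
  by move: iR1 R1R; set r1 := R1; lia.
rewrite -{1}tE; apply: (@Res_series _ J G h x R R1.-1 R) => //.
- by rewrite sG.
- exact: leq_ltn_trans (leq_pred _) R1R.
- rewrite -R1E => j jR.
  have -> : G`_(R - j) = (revpoly R G)`_j by rewrite coef_rev jR.
  rewrite -coefB; pose g := revpoly R G.
  have g0 : (g ^+ Q)`_0 = 1.
    rewrite -horner_coef0 horner_exp horner_coef0 coef_rev subn0 coef_monic_of.
    by rewrite ltnn eqxx expr1n.
  (* The factor G^Q missing between h and F is restored: reversed, it is a unit series. The identity
     for x is needed up to degree R, which is below the matrix size N. *)
  apply: (@series_ideal_div _ J _ (g ^+ Q) R.+1 iJ g0) => // l lR.
  have lN : (l < N)%N by apply: leq_trans RN.
  rewrite mulrBl coefB -exprS -(Ex l lN) -coefB.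
  have -> : x * revpoly R1 h * g ^+ Q - x * revpoly N F
    = - x * (revpoly N F - revpoly R1 h * g ^+ Q) by ring.
  have RQ := @rev_quo _ F G N R Q J iJ Fm Gm sF sG QRN (fun z => @idl_gen _ _ z).
  by rewrite QRE in RQ; apply: (inJM _ iJ).
by rewrite tE leq_subr.
Qed.

Theorem idl_Psis_betaS :
  idl (fun x => rems F G R Q x \/ exists2 i, (i < R1)%N & x = MPsi.Psi K N R (Q * R + i))
  = idl (fun x => rems F G R Q x \/ x \in coefs R1 (rmodp G h)).
Proof.
have Fm : F \is monic by apply: monic_of_monic.
have Gm : G \is monic by apply: monic_of_monic.
have sF : size F = N.+1 by apply: size_monic_of.
have sG : size G = R.+1 by apply: size_monic_of.
have QRN : (Q * R <= N)%N by rewrite leq_divM.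
have [hm sh] := quo_monic Fm Gm sF sG QRN.
have QRE : (N - Q * R = R1)%N by rewrite {1}(divn_eq N R) addKn.
rewrite QRE in sh.
apply: idl_eq => x.
  set J := idl _; have iJ : is_ideal J by apply: idl_ideal.
  case=> [rx|[i iR1 ->]]; first by apply: idl_gen; left.
  apply: (ideal_trans iJ (y := Res ('X^(R1 - 1 - i) * G) h)).
    by apply: idl_min (Psi_beta iR1) => // y ry; apply: idl_gen; left.
  apply: (proj2 (Res_coefs _ iJ hm sh)); last by lia.
  move=> l; have [lR|lR] := ltnP l R1.
    by apply: idl_gen; right; apply/(nthP 0); exists l; rewrite ?size_mkseq // nth_mkseq.
  rewrite nth_default; first exact: ideal0.
  by rewrite (leq_trans _ lR) // -ltnS -sh size_rmodp_monic.
set J := idl _; have iJ : is_ideal J by apply: idl_ideal.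
case=> [rx|/(nthP 0)[l]]; first by apply: idl_gen; left.
rewrite size_mkseq => lR1 <-; rewrite nth_mkseq //.
apply: (proj1 (Res_coefs G iJ hm sh)) => t tR1.
have tR1' : (R1 - 1 - t < R1)%N by lia.
have := Psi_beta tR1'; have -> : (R1 - 1 - (R1 - 1 - t) = t)%N by lia.
move=> H; apply: (ideal_trans iJ (y := MPsi.Psi K N R (Q * R + (R1 - 1 - t)))).
  rewrite -opprB; apply: (idealN iJ).
  by apply: idl_min H => // y ry; apply: idl_gen; left.
by apply: idl_gen; right; exists (R1 - 1 - t)%N.
Qed.

End PsiBeta.

Lemma idl_Psis_beta (K : numFieldType) (N R : nat) : (0 < R)%N -> (R < N)%N ->
  idl (fun x => rems (Fpoly K N R) (Gpoly K N R) R (N %/ R) x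
    \/ exists2 i, (i < N %% R)%N & x = MPsi.Psi K N R (N %/ R * R + i))
  = idl (fun x => rems (Fpoly K N R) (Gpoly K N R) R (N %/ R) x
    \/ x \in coefs (N %% R) (Pdiv.CommonRing.rmodp (Gpoly K N R)
         (quo (Fpoly K N R) (Gpoly K N R) (N %/ R)))).
Proof. by case: N => // N'; apply: idl_Psis_betaS. Qed.

(** * Substitution into the polynomials Psi *)

Section Specialization.
Import Pdiv.CommonRing Pdiv.RingMonic.
Variables (K : numFieldType) (B : comNzRingType) (c : {rmorphism K -> B}).
Variables (N R : nat) (W : 'I_(N + R) -> B).
Local Notation P := {mpoly K[N + R]}.

Definition fB : {poly B} := monic_of N (vnth (\row_(j < N) W (lshift R j))).
Definition gB : {poly B} := monic_of R (vnth (\row_(j < R) W (rshift N j))).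

Local Notation theta := (mmap c W : P -> B).

(** The substitution comes after the derivatives contained in [Psi]; being a ring morphism, it
    transports the ideal equalities proved for independent variables. *)
Definition PsiB (j : nat) : B := theta (MPsi.Psi K N R j).

Lemma PsiB_at (ev : {rmorphism B -> K}) j : (forall k, ev (c k) = k) ->
  ev (PsiB j) = MPsi.Psi_at (\row_i ev (W i)) j.
Proof.
move=> evc; rewrite /PsiB /MPsi.Psi_at /meval /mmap rmorph_sum; apply: eq_bigr => u _.
rewrite rmorphM evc /mmap1 rmorph_prod; congr (_ * _); apply: eq_bigr => i _.
by rewrite rmorphXn mxE.
Qed.

Lemma theta_Fpoly : map_poly theta (Fpoly K N R) = fB.
Proof.
rewrite map_monic_of; congr (_ + _); apply: eq_poly => i iN /=.
by rewrite /MPsi.uvar /vnth insubT !mxE mmapX mmap1U.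
Qed.

Lemma theta_Gpoly : map_poly theta (Gpoly K N R) = gB.
Proof.
rewrite map_monic_of; congr (_ + _); apply: eq_poly => i iR /=.
by rewrite /MPsi.vvar /vnth insubT !mxE mmapX mmap1U.
Qed.

Theorem idl_PsiB s : (0 < R)%N -> (R <= N)%N -> (s <= N %/ R)%N ->
  idl (fun x => exists2 j, (j < s * R)%N & x = PsiB j) = idl (rems fB gB R s).
Proof.
move=> R0 RN sQ; have := idl_image theta (idl_Psis K R0 RN sQ).
rewrite image_rems ?monic_of_monic // theta_Fpoly theta_Gpoly => <-.
congr idl; apply/funext => y; apply/propext; split=> [[j js ->]|[x [j js ->] ->]].
  by exists (MPsi.Psi K N R j) => //; exists j.
by exists j.
Qed.

Theorem idl_PsiB_beta : (0 < R)%N -> (R < N)%N ->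
  idl (fun x => exists2 j, (j < N %/ R * R + N %% R)%N & x = PsiB j)
  = idl (fun x => rems fB gB R (N %/ R) x
      \/ x \in coefs (N %% R) (rmodp gB (quo fB gB (N %/ R)))).
Proof.
move=> R0 RN; have e1 := idl_Psis K R0 (ltnW RN) (leqnn _).
have Gm : Gpoly K N R \is monic by apply: monic_of_monic.
have hm : quo (Fpoly K N R) (Gpoly K N R) (N %/ R) \is monic.
  by have [] := quo_monic (monic_of_monic N (MPsi.uvar K N R)) Gm (size_monic_of _ _)
    (size_monic_of _ _) (leq_divM N R).
set Q := (N %/ R)%N in e1 hm *; set R1 := (N %% R)%N.
pose G1 x := exists2 i, (i < R1)%N & x = MPsi.Psi K N R (Q * R + i).
have -> : (fun x => exists2 j, (j < Q * R + R1)%N & x = PsiB j)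
   = (fun y => exists2 x, @Psis K N R (Q * R) x \/ G1 x & y = theta x).
  apply/funext => y; apply/propext; split=> [[j js ->]|[x [[j js]|[j js]] -> ->]].
  - exists (MPsi.Psi K N R j) => //.
    have [jQ|Qj] := ltnP j (Q * R); [by left; exists j | right].
    by exists (j - Q * R)%N; rewrite ?subnKC // ltn_subLR.
  - by exists j => //; apply: ltn_addr.
  - by exists (Q * R + j)%N; rewrite // ltn_add2l.
have := idl_Psis_beta K R0 RN; rewrite -/Q -/R1 -/G1 => e2.
have e3 : idl (fun x => @Psis K N R (Q * R) x \/ G1 x) =
    idl (fun x => rems (Fpoly K N R) (Gpoly K N R) R Q x \/
      x \in coefs R1 (rmodp (Gpoly K N R) (quo (Fpoly K N R) (Gpoly K N R) Q))).
  by rewrite -e2 -idlU_idl e1 idlU_idl.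
rewrite (idl_image theta e3) image_or; congr idl; apply/funext => y.
congr or; first by rewrite (congr1 (@^~ y) (image_rems theta _ _ _ Gm)) theta_Fpoly theta_Gpoly.
rewrite (congr1 (@^~ y) (image_coefs theta _ _)) /=.
have [_ ->] := map_rdivp_monic theta (Gpoly K N R) hm.
by rewrite map_quo // theta_Fpoly theta_Gpoly.
Qed.

End Specialization.

End PsiTheory.

(** * The coefficients gamma and the quotient h *)

Section Gamma.
Variables (K : numFieldType) (n' r : nat).
Local Notation n := n'.+1.
Implicit Types z : 'rV[K]_(n + r).

(** The matrix stands for the reversed f divided by the q1-th power of the reversed g. By
    [rev_quo_low] this series begins like the reversed h. The coefficient a_0, absent from [Amx],
    sits in degree n, where size n truncates. *)
Lemma gamma_quoS z i : (0 < r)%N -> (r <= n)%N -> (i < n %% r)%N ->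
  gamma z (n - n %% r + i) = (quo (fpoly z) (gpoly z) (n %/ r))`_i.
Proof.
move=> r0 rn; set r1 := (n %% r)%N; set q1 := (n %/ r)%N => ir1.
set f := fpoly z; set g := gpoly z.
have nE : (n = q1 * r + r1)%N := divn_eq n r.
have r1r : (r1 < r)%N by rewrite ltn_mod.
have fm : f \is monic by apply: monic_of_monic.
have gm : g \is monic by apply: monic_of_monic.
have sf : size f = n.+1 by apply: size_monic_of.
have sg : size g = r.+1 by apply: size_monic_of.
have BE : Bmx z = toep n' (revpoly r g).
  apply: toep_lunip1 => k _; rewrite coef_rev [g`_ _]coef_monic_of.
  case: (k =P 0%N) => [->|k0]; first by rewrite subn0 ltnn eqxx.
  by rewrite ltnS; case: (leqP k r) => // kr; have -> : (r - k < r)%N by lia.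
have AE : Amx z = toep n' (revpoly n f).
  apply: toep_lunip1 => k kn; rewrite coef_rev [f`_ _]coef_monic_of (ltnW kn) kn.
  case: (k =P 0%N) => [->|k0]; first by rewrite subn0 ltnn eqxx.
  by have -> : (n - k < n)%N by lia.
have uB : lunip (Bmx z ^+ q1) by apply/lunip_exp/lunip1.
have uX : lunip (invmx (Bmx z ^+ q1) *m Amx z).
  by apply: lunip_mul; [exact: lunip_inv | exact: lunip1].
have [x Ex] := lunip_toep uX.
have key k : (k < n)%N -> (x * revpoly r g ^+ q1)`_k = (revpoly n f)`_k.
  move=> kn; rewrite mulrC; apply: (@toep_inj _ n') => //.
  by rewrite toepM toep_exp -BE -Ex -AE mulKVmx // lunip_unit.
have QN : (q1 * r <= n)%N by rewrite nE leq_addr.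
have r1E : (n - q1 * r = r1)%N by rewrite nE addKn.
set h := quo f g q1.
have g0 : (revpoly r g ^+ q1)`_0 = 1.
  rewrite -horner_coef0 horner_exp horner_coef0 coef_rev subn0 coef_monic_of.
  by rewrite ltnn eqxx expr1n.
pose J (y : K) := y = 0.
have iJ : is_ideal J.
  by split=> [//|a b -> ->|a b ->]; rewrite /J ?addr0 ?mulr0.
have xh k : (k < r1.+1)%N -> x`_k = (revpoly r1 h)`_k.
  move=> kr1; apply/eqP; rewrite -subr_eq0 -coefB; apply/eqP.
  apply: (series_ideal_div (J := J) iJ g0 _ kr1) => l lr1.
  rewrite mulrBl coefB key; last by lia.
  have lr : (l <= n - q1 * r)%N by rewrite r1E.
  by rewrite (rev_quo_low fm gm sf sg QN lr) r1E subrr.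
rewrite /gamma Ex lcoef_toep; last by lia.
have -> : (n - (n - r1 + i) = r1 - i)%N by lia.
rewrite xh ?ltnS ?leq_subr // coef_rev leq_subr.
by congr nth; lia.
Qed.

End Gamma.

From mathcomp Require Import all_classical all_reals all_analysis.
Import numFieldNormedType.Exports.
Local Open Scope classical_set_scope.

Section ComplexAnalysis.
Local Open Scope complex_scope.

(** * Derivatives of holomorphic functions *)

Section ComplexModulus.
Variable R : realType.
Local Notation C := R[i].
Implicit Types x y z : C.
Local Notation Re := complex.Re.
Local Notation Im := complex.Im.

(** The norm of R[i] takes its values in R[i]; a modulus in R makes the estimates accessible to real
    arithmetic. *)
Definition cmod (z : C) : R := Normc.normc z.

Lemma normC_cmod z : `|z| = (cmod z)%:C. Proof. by []. Qed.

Lemma cmod_ge0 z : 0 <= cmod z.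
Proof. by rewrite -ler0c -normC_cmod. Qed.

Lemma cmod0 : cmod 0 = 0. Proof. exact: Normc.normc0. Qed.

Lemma cmod_eq0 z : cmod z = 0 -> z = 0. Proof. exact: Normc.eq0_normc. Qed.

Lemma cmod_gt0 z : z != 0 -> 0 < cmod z.
Proof.
move=> z0; rewrite lt_neqAle cmod_ge0 andbT eq_sym.
by apply: contra_neq z0; apply: cmod_eq0.
Qed.

Lemma cmodM x y : cmod (x * y) = cmod x * cmod y.
Proof. exact: Normc.normcM. Qed.

Lemma cmodD x y : cmod (x + y) <= cmod x + cmod y.
Proof. exact: le_normcD. Qed.

Lemma cmodN x : cmod (- x) = cmod x. Proof. exact: normcN. Qed.

Lemma cmodBC x y : cmod (x - y) = cmod (y - x).
Proof. by rewrite -cmodN opprB. Qed.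

Lemma cmodB x y : cmod (x - y) <= cmod x + cmod y.
Proof. by rewrite -(cmodN y) cmodD. Qed.

Lemma cmodV x : cmod x^-1 = (cmod x)^-1. Proof. exact: Normc.normcV. Qed.

Lemma cmod_real (t : R) : cmod t%:C = `|t|.
Proof. by rewrite /cmod /= expr0n addr0 sqrtr_sqr. Qed.

Lemma cmod_sqr z : cmod z ^+ 2 = Re z ^+ 2 + Im z ^+ 2.
Proof. by case: z => a b; rewrite /cmod /= sqr_sqrtr // addr_ge0 ?sqr_ge0. Qed.

Lemma Re_le_cmod z : `|Re z| <= cmod z.
Proof.
by rewrite -(ler_sqr (x := `|Re z|)) ?nnegrE ?cmod_ge0 // cmod_sqr real_normK
  ?num_real // lerDl sqr_ge0.
Qed.

Lemma Im_le_cmod z : `|Im z| <= cmod z.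
Proof.
by rewrite -(ler_sqr (x := `|Im z|)) ?nnegrE ?cmod_ge0 // cmod_sqr real_normK
  ?num_real // lerDr sqr_ge0.
Qed.

Lemma cmod_le z : cmod z <= `|Re z| + `|Im z|.
Proof.
rewrite -(ler_sqr (x := cmod z)) ?nnegrE ?cmod_ge0 ?addr_ge0 // cmod_sqr.
rewrite sqrrD !real_normK ?num_real // [leRHS]addrAC lerDl.
by rewrite mulrn_wge0 // mulr_ge0.
Qed.

Lemma ReD x y : Re (x + y) = Re x + Re y. Proof. by case: x y => ? ? []. Qed.
Lemma ImD x y : Im (x + y) = Im x + Im y. Proof. by case: x y => ? ? []. Qed.
Lemma ReB x y : Re (x - y) = Re x - Re y. Proof. by case: x y => ? ? []. Qed.
Lemma ImB x y : Im (x - y) = Im x - Im y. Proof. by case: x y => ? ? []. Qed.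
Lemma ReZ (t : R) z : Re (t%:C * z) = t * Re z.
Proof. by case: z => a b /=; rewrite mul0r subr0. Qed.
End ComplexModulus.

(** * Goursat's lemma for trapezoidal sums *)

Section Goursat.
Variable R : realType.
Local Notation C := R[i].
Implicit Types (phi psi : C -> C) (z a b : C).
Local Notation Re := complex.Re.
Local Notation Im := complex.Im.

Definition cdiff phi z (d : C) := forall e : R, 0 < e ->
  exists2 r : R, 0 < r & forall h, cmod h < r ->
    cmod (phi (z + h) - phi z - d * h) <= e * cmod h.

(* The average of phi over the segment [z, z + b], by the trapezoidal rule with
   2 ^ n subintervals. *)
Fixpoint avg (n : nat) phi z b : C :=
  if n is n'.+1 then (avg n' phi z (b / 2) + avg n' phi (z + b / 2) (b / 2)) / 2
  else (phi z + phi (z + b)) / 2.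

Lemma avgB n phi psi z b :
  avg n (fun w => phi w - psi w) z b = avg n phi z b - avg n psi z b.
Proof. by elim: n z b => [|n IH] z b /=; rewrite ?IH; field. Qed.

Lemma avg_affine n z b (c d : C) :
  avg n (fun w => c + d * w) z b = c + d * (z + b / 2).
Proof. by elim: n z b => [|n IH] z b /=; rewrite ?IH; field. Qed.

Lemma avg_periodic n phi z b p : (forall w, phi (w + p) = phi w) ->
  avg n phi (z + p) b = avg n phi z b.
Proof.
move=> pp; elim: n z b => [|n IH] z b /=; first by rewrite addrAC !pp.
by rewrite addrAC !IH.
Qed.

Lemma segment_halves (P : C -> Prop) z b :
  (forall t : R, 0 <= t <= 1 -> P (z + t%:C * b)) ->
  (forall t : R, 0 <= t <= 1 -> P (z + t%:C * (b / 2))) /\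
  (forall t : R, 0 <= t <= 1 -> P (z + b / 2 + t%:C * (b / 2))).
Proof.
move=> Pz; split=> t t01.
  have -> : z + t%:C * (b / 2) = z + (t / 2)%:C * b.
    by rewrite rmorphM fmorphV rmorph_nat; field.
  by apply: Pz; lra.
have -> : z + b / 2 + t%:C * (b / 2) = z + ((t + 1) / 2)%:C * b.
  by rewrite rmorphM fmorphV rmorph_nat rmorphD rmorph1; field.
by apply: Pz; lra.
Qed.

Lemma avg_cmod_le n phi z b (m : R) :
  (forall t : R, 0 <= t <= 1 -> cmod (phi (z + t%:C * b)) <= m) ->
  cmod (avg n phi z b) <= m.
Proof.
have half x y : cmod x <= m -> cmod y <= m -> cmod ((x + y) / 2) <= m.
  move=> xm ym; rewrite cmodM cmodV.
  have -> : cmod (2 : C) = 2 by rewrite -(rmorph_nat (real_complex R)) cmod_real normr_nat.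
  by have := cmodD x y; lra.
elim: n z b => [|n IH] z b ub /=.
  apply: half; first by have := ub 0; rewrite mul0r addr0; apply; lra.
  by have := ub 1; rewrite mul1r; apply; lra.
have [u1 u2] := segment_halves (P := fun w => cmod (phi w) <= m) ub.
by apply: half; apply: IH.
Qed.

Lemma avg_Re_le n phi z b (m : R) :
  (forall t : R, 0 <= t <= 1 -> Re (phi (z + t%:C * b)) <= m) ->
  Re (avg n phi z b) <= m.
Proof.
have half x y : Re x <= m -> Re y <= m -> Re ((x + y) / 2) <= m.
  move=> xm ym.
  have -> : (x + y) / 2 = (2^-1)%:C * (x + y).
    by rewrite fmorphV rmorph_nat mulrC.
  by rewrite ReZ ReD; lra.
elim: n z b => [|n IH] z b ub /=.
  apply: half; first by have := ub 0; rewrite mul0r addr0; apply; lra.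
  by have := ub 1; rewrite mul1r; apply; lra.
have [u1 u2] := segment_halves (P := fun w => Re (phi w) <= m) ub.
by apply: half; apply: IH.
Qed.

(* The trapezoidal approximation of the integral of phi along the boundary of
   the parallelogram with sides a and b based at z. *)
Definition bdry (n : nat) phi z a b : C :=
  a * avg n phi z a + b * avg n phi (z + a) b
    - a * avg n phi (z + b) a - b * avg n phi z b.

(** The inner edges cancel exactly, since n + 1 dyadic levels on an edge are n levels on each half.
    This lets the sums replace integrals in a quartering argument. *)
Lemma bdryS n phi z a b :
  bdry n.+1 phi z a b =
    bdry n phi z (a / 2) (b / 2) + bdry n phi (z + a / 2) (a / 2) (b / 2)
    + bdry n phi (z + b / 2) (a / 2) (b / 2)
    + bdry n phi (z + a / 2 + b / 2) (a / 2) (b / 2).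
Proof.
rewrite /bdry /=.
have ha (w : C) : w / 2 + w / 2 = w by field.
rewrite -!(addrA z) ha !addrA [z + b / 2 + a / 2]addrAC -(addrA z (b / 2)) ha.
rewrite [z + b + a / 2]addrAC -[z + a / 2 + b / 2 + b / 2]addrA ha.
have -> : z + a / 2 + b / 2 + a / 2 = z + a + b / 2.
  by rewrite -addrA [b / 2 + _]addrC addrA -[z + a / 2 + _]addrA ha.
by field.
Qed.

(** The trapezoidal rule is exact on affine functions, and these have primitives. *)
Lemma bdry_affine n z a b (c d : C) : bdry n (fun w => c + d * w) z a b = 0.
Proof. by rewrite /bdry !avg_affine; field. Qed.

Lemma bdryB n phi psi z a b :
  bdry n (fun w => phi w - psi w) z a b = bdry n phi z a b - bdry n psi z a b.
Proof. by rewrite /bdry !avgB; ring. Qed.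

Lemma bdry_le n phi z a b (m : R) :
  (forall s t : R, 0 <= s <= 1 -> 0 <= t <= 1 ->
     cmod (phi (z + s%:C * a + t%:C * b)) <= m) ->
  cmod (bdry n phi z a b) <= 2 * (cmod a + cmod b) * m.
Proof.
move=> ub.
have i0 : 0 <= (0 : R) <= 1 by lra.
have i1 : 0 <= (1 : R) <= 1 by lra.
have /(avg_cmod_le n) e1 t : 0 <= t <= 1 -> cmod (phi (z + t%:C * a)) <= m.
  by move=> t01; have := ub _ _ t01 i0; rewrite mul0r addr0.
have /(avg_cmod_le n) e2 t : 0 <= t <= 1 -> cmod (phi (z + a + t%:C * b)) <= m.
  by move=> t01; have := ub _ _ i1 t01; rewrite mul1r.
have /(avg_cmod_le n) e3 t : 0 <= t <= 1 -> cmod (phi (z + b + t%:C * a)) <= m.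
  by move=> t01; have := ub _ _ t01 i1; rewrite mul1r addrAC.
have /(avg_cmod_le n) e4 t : 0 <= t <= 1 -> cmod (phi (z + t%:C * b)) <= m.
  by move=> t01; have := ub _ _ i0 t01; rewrite mul0r addr0.
rewrite /bdry.
have := cmodB (a * avg n phi z a + b * avg n phi (z + a) b
    - a * avg n phi (z + b) a) (b * avg n phi z b).
have := cmodB (a * avg n phi z a + b * avg n phi (z + a) b)
  (a * avg n phi (z + b) a).
have := cmodD (a * avg n phi z a) (b * avg n phi (z + a) b).
rewrite !cmodM; have := cmod_ge0 a; have := cmod_ge0 b; nra.
Qed.

(** The intervals [u k, u k + 2^(-k)] are nested. *)
Lemma dyadic_limit (u : nat -> R) :
  (forall k, u k <= u k.+1 <= u k + 2^-1 ^+ k.+1) ->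
  exists s : R, forall k, u k <= s <= u k + 2^-1 ^+ k.
Proof.
move=> us.
have mono j k : (j <= k)%N -> u j <= u k /\ u k + 2^-1 ^+ k <= u j + 2^-1 ^+ j.
  move=> /subnK <-; elim: (k - j)%N => [|d [IH1 IH2]]; first by rewrite add0n.
  have /andP[h1 h2] := us (d + j)%N; rewrite addSn; split; first exact: le_trans h1.
  apply: le_trans IH2; move: h2; rewrite !exprS; lra.
have ub j k : u k <= u j + 2^-1 ^+ j.
  have p2 i : 0 <= (2^-1 : R) ^+ i by apply: exprn_ge0; lra.
  case/orP: (leq_total j k) => /mono[h1 h2]; have := p2 k; have := p2 j; lra.
have hs : has_sup (range u).
  split; first by exists (u 0%N), 0%N.
  by exists (u 0%N + 2^-1 ^+ 0) => _ [k _ <-].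
exists (sup (range u)) => k; apply/andP; split.
  by apply: sup_upper_bound => //; exists k.
by apply: ge_sup => [|_ [j _ <-]//]; exists (u 0%N), 0%N.
Qed.

Lemma half_expr_lt (e c : R) : 0 < e -> 0 <= c -> exists k, c * 2^-1 ^+ k < e.
Proof.
move=> e0 c0; have : (0 : R) < e / (c + 1) by rewrite divr_gt0 //; lra.
have : (fun k => (2^-1 : R) ^+ k) @ \oo --> (0 : R).
  by apply: cvg_expr; rewrite ger0_norm; lra.
move=> /cvgrPdist_lt h /h [k _ /(_ k (leqnn k))] /=.
rewrite sub0r normrN ger0_norm ?exprn_ge0 ?ltr_pdivlMr; try lra.
have : 0 < (2^-1 : R) ^+ k by apply: exprn_gt0; lra.
by exists k; nra.
Qed.

Theorem goursat phi z a b :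
  (forall s t : R, 0 <= s <= 1 -> 0 <= t <= 1 ->
     exists d, cdiff phi (z + s%:C * a + t%:C * b) d) ->
  forall e : R, 0 < e ->
  exists n0, forall n, (n0 <= n)%N -> cmod (bdry n phi z a b) <= e.
Proof.
move=> dphi e e0; apply: contrapT => nb.
pose h k : R := 2^-1 ^+ k.
have h0 k : 0 < h k by apply: exprn_gt0; lra.
have hS k : h k.+1 = h k / 2 by rewrite /h exprSr.
pose corner (st : R * R) : C := z + st.1%:C * a + st.2%:C * b.
(* The bound is asked for all large n, since [bdryS] lowers n at each quartering; its negation
   passes to one of the four quarters. *)
pose small k st := exists n0, forall n, (n0 <= n)%N ->
  cmod (bdry n phi (corner st) ((h k)%:C * a) ((h k)%:C * b)) <= e * h k ^+ 2.
have sub k st : ~ small k st -> exists st' : R * R, ~ small k.+1 st' /\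
    (st.1 <= st'.1 <= st.1 + h k.+1) /\ (st.2 <= st'.2 <= st.2 + h k.+1).
  move=> ns; apply: contrapT => nex; apply: ns.
  have all4 st' : st.1 <= st'.1 <= st.1 + h k.+1 ->
      st.2 <= st'.2 <= st.2 + h k.+1 -> small k.+1 st'.
    by move=> i1 i2; apply: contrapT => ns; apply: nex; exists st'.
  have h0' := h0 k.+1.
  have [//||n1 H1] := all4 (st.1, st.2); rewrite /=; try lra.
  have [||n2 H2] := all4 (st.1 + h k.+1, st.2); rewrite /=; try lra.
  have [||n3 H3] := all4 (st.1, st.2 + h k.+1); rewrite /=; try lra.
  have [||n4 H4] := all4 (st.1 + h k.+1, st.2 + h k.+1); rewrite /=; try lra.
  exists (maxn (maxn n1 n2) (maxn n3 n4)).+1 => -[//|n]; rewrite ltnS !geq_max.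
  move=> /andP[/andP[/H1 {}H1 /H2 {}H2] /andP[/H3 {}H3 /H4 {}H4]].
  have hv (w : C) : (h k)%:C * w / 2 = (h k.+1)%:C * w.
    by rewrite hS rmorphM fmorphV rmorph_nat; field.
  rewrite bdryS !hv; move: H1 H2 H3 H4; rewrite /corner /=.
  have -> : z + (st.1 + h k.+1)%:C * a + st.2%:C * b
      = z + st.1%:C * a + st.2%:C * b + (h k.+1)%:C * a by rewrite rmorphD; ring.
  have -> : z + st.1%:C * a + (st.2 + h k.+1)%:C * b
      = z + st.1%:C * a + st.2%:C * b + (h k.+1)%:C * b by rewrite rmorphD; ring.
  have -> : z + (st.1 + h k.+1)%:C * a + (st.2 + h k.+1)%:C * b
      = z + st.1%:C * a + st.2%:C * b + (h k.+1)%:C * a + (h k.+1)%:C * b.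
    by rewrite !rmorphD; ring.
  set w := z + _ + _; set t1 := bdry _ _ w _ _; set t2 := bdry _ _ (w + _) _ _.
  set t3 := bdry _ _ (w + _) _ _; set t4 := bdry _ _ (w + _ + _) _ _.
  move=> b1 b2 b3 b4; have := cmodD (t1 + t2 + t3) t4.
  have := cmodD (t1 + t2) t3; have := cmodD t1 t2; rewrite hS in b1 b2 b3 b4; nra.
have /choice[f Hf] : forall p : nat * (R * R), exists st' : R * R,
    ~ small p.1 p.2 -> ~ small p.1.+1 st' /\ (p.2.1 <= st'.1 <= p.2.1 + h p.1.+1)
      /\ (p.2.2 <= st'.2 <= p.2.2 + h p.1.+1).
  move=> [k st] /=.
  by case: (pselect (small k st)) => [sm|/sub[st' ?]]; [exists st | exists st'].
pose u := fix u k := if k is k'.+1 then f (k', u k') else (0, 0).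
have nsu k : ~ small k (u k).
  elim: k => [|k IH] /=; last by have [] := Hf (k, u k) IH.
  move=> [n0 H]; apply: nb; exists n0 => n /H.
  by rewrite /corner /h /= !mul0r !addr0 expr0 expr1n !mul1r mulr1.
have [s hs] := @dyadic_limit (fun k => (u k).1) (fun k => (Hf (k, u k) (nsu k)).2.1).
have [t ht] := @dyadic_limit (fun k => (u k).2) (fun k => (Hf (k, u k) (nsu k)).2.2).
have [||d dd] := dphi s t; [have := hs 0%N | have := ht 0%N |]; rewrite ?expr0 /=; try lra.
set p := z + _ + _ in dd; pose L := cmod a + cmod b.
have L0 : 0 <= L by rewrite addr_ge0 ?cmod_ge0.
(* On a cell of scale h the error of the affine approximation is at most e' L h, so [bdry_le] gives
   2 L^2 e' h^2 <= e h^2. The summand 1 covers L = 0. *)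
have e'0 : 0 < e / (2 * L ^+ 2 + 1) by rewrite divr_gt0 //; nra.
have [r r0 Hr] := dd _ e'0.
have [k kr] := half_expr_lt r0 L0.
apply: (nsu k); exists 0%N => n _; rewrite -/(h k) in kr.
pose aff (w : C) := (phi p - d * p) + d * w.
rewrite -[bdry _ _ _ _ _]subr0 -(bdry_affine n (corner (u k)) ((h k)%:C * a)
  ((h k)%:C * b) (phi p - d * p) d) -bdryB.
apply: (@le_trans _ _ (2 * (cmod ((h k)%:C * a) + cmod ((h k)%:C * b))
  * (e / (2 * L ^+ 2 + 1) * (L * h k)))).
  apply: bdry_le => s' t' s01 t01; set w := corner _ + _ + _.
  have e1 : w - p = ((u k).1 + s' * h k - s)%:C * a + ((u k).2 + t' * h k - t)%:C * b.
    by rewrite /w /p /corner !rmorphB !rmorphD !rmorphM /=; ring.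
  have wp : cmod (w - p) <= L * h k.
    rewrite e1; apply: le_trans (cmodD _ _) _; rewrite !cmodM !cmod_real mulrDl.
    have hk := h0 k.
    apply: lerD; rewrite mulrC ler_wpM2l ?cmod_ge0 // ler_norml.
      by have := hs k; rewrite -/(h k) => ?; apply/andP; split; nra.
    by have := ht k; rewrite -/(h k) => ?; apply/andP; split; nra.
  have := Hr (w - p) (le_lt_trans wp kr); rewrite [p + _]addrC subrK => H.
  have -> : phi w - (phi p - d * p + d * w) = phi w - phi p - d * (w - p) by ring.
  by apply: le_trans H _; rewrite ler_wpM2l // ltW.
rewrite !cmodM !cmod_real !gtr0_norm // -mulrDr -/L.
have -> : 2 * (h k * L) * (e / (2 * L ^+ 2 + 1) * (L * h k))
  = (2 * L ^+ 2 / (2 * L ^+ 2 + 1)) * (e * h k ^+ 2) by field; nra.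
rewrite ler_piMl //; first by rewrite mulr_ge0 ?sqr_ge0 // ltW.
by rewrite ler_pdivrMr; nra.
Qed.

End Goursat.

Lemma differentiable_approx (K : numFieldType) (V W : normedModType K)
    (f : V -> W) (x : V) : differentiable f x ->
  forall e : K, 0 < e -> exists2 r : K, 0 < r &
    forall h, `|h| < r -> `|f (h + x) - f x - 'd f x h| <= e * `|h|.
Proof.
move=> /diff_locally /eqaddoP H e e0.
have /nbhs_normP[r /= r0 Hr] := H _ e0.
exists r => // h hr; have /= := Hr h; rewrite sub0r normrN => /(_ hr).
by rewrite opprD addrA.
Qed.

Section ComplexFunctions.
Variable R : realType.
Local Notation C := R[i].
Implicit Types (phi psi : C -> C) (z a b : C).
Local Notation Re := (@complex.Re R).
Local Notation Im := (@complex.Im R).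

Definition ccont phi z := forall e : R, 0 < e ->
  exists2 r : R, 0 < r & forall h, cmod h < r -> cmod (phi (z + h) - phi z) <= e.

Lemma cdiff_ccont phi z d : cdiff phi z d -> ccont phi z.
Proof.
move=> dphi e e0; have [r r0 Hr] := dphi 1 ltr01.
have dd0 : 0 < 1 + cmod d by have := cmod_ge0 d; lra.
exists (Num.min r (e / (1 + cmod d))) => [|h].
  by rewrite lt_min r0 divr_gt0.
rewrite lt_min => /andP[/Hr hr]; rewrite ltr_pdivlMr // => hd.
have -> : phi (z + h) - phi z = (phi (z + h) - phi z - d * h) + d * h by ring.
by have := cmodD (phi (z + h) - phi z - d * h) (d * h); rewrite cmodM; lra.
Qed.

Lemma cdiffB phi psi z d e : cdiff phi z d -> cdiff psi z e ->
  cdiff (fun w => phi w - psi w) z (d - e).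
Proof.
move=> dphi dpsi eps eps0; have e2 : 0 < eps / 2 by lra.
have [r1 r10 H1] := dphi _ e2; have [r2 r20 H2] := dpsi _ e2.
exists (Num.min r1 r2) => [|h]; first by rewrite lt_min r10.
rewrite lt_min => /andP[/H1 h1 /H2 h2].
have -> : phi (z + h) - psi (z + h) - (phi z - psi z) - (d - e) * h =
  (phi (z + h) - phi z - d * h) - (psi (z + h) - psi z - e * h) by ring.
have := cmodB (phi (z + h) - phi z - d * h) (psi (z + h) - psi z - e * h).
by lra.
Qed.

Lemma ccontB phi psi z : ccont phi z -> ccont psi z ->
  ccont (fun w => phi w - psi w) z.
Proof.
move=> dphi dpsi eps eps0; have e2 : 0 < eps / 2 by lra.
have [r1 r10 H1] := dphi _ e2; have [r2 r20 H2] := dpsi _ e2.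
exists (Num.min r1 r2) => [|h]; first by rewrite lt_min r10.
rewrite lt_min => /andP[/H1 h1 /H2 h2].
have -> : phi (z + h) - psi (z + h) - (phi z - psi z) =
  (phi (z + h) - phi z) - (psi (z + h) - psi z) by ring.
by have := cmodB (phi (z + h) - phi z) (psi (z + h) - psi z); lra.
Qed.

Lemma cdiff_affine_comb phi z d (k l m : C) : cdiff phi z d ->
  cdiff (fun w => k * phi w + (l * w + m)) z (k * d + l).
Proof.
move=> dphi e e0; have k0 : 0 < 1 + cmod k by have := cmod_ge0 k; lra.
have [r r0 Hr] := dphi (e / (1 + cmod k)) (divr_gt0 e0 k0).
exists r => // h /Hr; have -> : k * phi (z + h) + (l * (z + h) + m)
  - (k * phi z + (l * z + m)) - (k * d + l) * h
  = k * (phi (z + h) - phi z - d * h) by ring.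
rewrite cmodM => H; apply: (@le_trans _ _ ((1 + cmod k) * (e / (1 + cmod k) * cmod h))).
  apply: ler_pM; rewrite ?cmod_ge0 //; lra.
by rewrite mulrA [(1 + _) * _]mulrC divfK // gt_eqF.
Qed.

Lemma ccont_affine_comb phi z (k l m : C) : ccont phi z ->
  ccont (fun w => k * phi w + (l * w + m)) z.
Proof.
move=> cphi e e0; have k0 : 0 < 1 + cmod k by have := cmod_ge0 k; lra.
have l0 : 0 < 1 + cmod l by have := cmod_ge0 l; lra.
have e2 : 0 < e / 2 by lra.
have [r r0 Hr] := cphi (e / 2 / (1 + cmod k)) (divr_gt0 e2 k0).
exists (Num.min r (e / 2 / (1 + cmod l))) => [|h].
  by rewrite lt_min r0 divr_gt0.
rewrite lt_min => /andP[/Hr + hl].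
have -> : k * phi (z + h) + (l * (z + h) + m) - (k * phi z + (l * z + m))
  = k * (phi (z + h) - phi z) + l * h by ring.
move: hl; rewrite ltr_pdivlMr // ler_pdivlMr // => hl hk.
have := cmodD (k * (phi (z + h) - phi z)) (l * h); rewrite !cmodM.
have := cmod_ge0 h; have := cmod_ge0 (phi (z + h) - phi z); lra.
Qed.

Lemma cdiff_comp phi psi z d e : cdiff psi z e -> cdiff phi (psi z) d ->
  cdiff (fun w => phi (psi w)) z (d * e).
Proof.
move=> dpsi dphi eps eps0.
have e10 : 0 < 1 + cmod e by have := cmod_ge0 e; lra.
have d10 : 0 < 1 + cmod d by have := cmod_ge0 d; lra.
have e20 : 0 < eps / 2 by lra.
have [r r0 Hr] := dphi _ (divr_gt0 e20 e10).
have [r1 r10 H1] := dpsi 1 ltr01.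
have [r2 r20 H2] := dpsi _ (divr_gt0 e20 d10).
exists (Num.min (Num.min r1 r2) (r / (1 + cmod e))) => [|h].
  by rewrite !lt_min r10 r20 divr_gt0.
rewrite !lt_min ltr_pdivlMr // => /andP[/andP[/H1 h1 /H2 h2] h3].
set k := psi (z + h) - psi z in h1 h2.
have ke : cmod k <= (1 + cmod e) * cmod h.
  by rewrite -[k](subrK (e * h)); have := cmodD (k - e * h) (e * h); rewrite cmodM; lra.
have kr : cmod k < r by apply: le_lt_trans ke _; rewrite mulrC.
have := Hr k kr; rewrite [psi z + k]addrC subrK => H.
have -> : phi (psi (z + h)) - phi (psi z) - d * e * h =
  (phi (psi (z + h)) - phi (psi z) - d * k) + d * (k - e * h) by ring.
have := cmodD (phi (psi (z + h)) - phi (psi z) - d * k) (d * (k - e * h)).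
rewrite cmodM => H'; apply: le_trans H' _.
have -> : eps * cmod h = eps / 2 / (1 + cmod e) * ((1 + cmod e) * cmod h)
   + (1 + cmod d) * (eps / 2 / (1 + cmod d) * cmod h) by field; rewrite !gt_eqF.
apply: lerD.
  by apply: le_trans H _; rewrite ler_wpM2l // divr_ge0 // ltW.
by apply: ler_pM; rewrite ?cmod_ge0 //; lra.
Qed.

Definition cexp (w : C) : C := (expR (Re w))%:C * (cos (Im w) +i* sin (Im w)).

Lemma cexpD x y : cexp (x + y) = cexp x * cexp y.
Proof.
case: x y => [x x'] [y y']; rewrite /cexp /= expRD cosD sinD.
by apply/eqP; rewrite eq_complex /=; apply/andP; split; apply/eqP; ring.
Qed.

Lemma cmod_cexp w : cmod (cexp w) = expR (Re w).
Proof.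
rewrite /cexp cmodM cmod_real ger0_norm ?expR_ge0 // /cmod /= cos2Dsin2.
by rewrite sqrtr1 mulr1.
Qed.

Lemma cexp_periodic w : cexp (w + (0 +i* (2 * pi))) = cexp w.
Proof.
case: w => x y; rewrite /cexp /= addr0 mulr_natl.
by rewrite cosD2pi sinD2pi.
Qed.

Lemma real_approx (f : R -> R) (x l : R) : is_derive x 1 f l ->
  forall e : R, 0 < e -> exists2 r : R, 0 < r &
    forall h, `|h| < r -> `|f (h + x) - f x - l * h| <= e * `|h|.
Proof.
move=> [df Df] e e0; have df' : differentiable f x by apply/derivable1_diffP.
have [r r0 Hr] := differentiable_approx df' e0; exists r => // h /Hr.
have -> : h = h *: (1 : R) by rewrite /GRing.scale /= mulr1.
by rewrite linearZ /= -deriveE // Df /GRing.scale /= !mulr1 [h * l]mulrC.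
Qed.

Lemma cexp_cdiff0 : cdiff cexp 0 1.
Proof.
(* The four error terms below add up to at most 9 [e1] times cmod h. *)
move=> e e0; pose e1 := Num.min (e / 16) 1.
have e10 : 0 < e1 by rewrite lt_min ltr01 andbT; lra.
have e1e : e1 <= e / 16 by rewrite ge_min lexx.
have e11 : e1 <= 1 by rewrite ge_min lexx orbT.
clearbody e1.
have [r1 r10 H1] := real_approx (is_derive_expR 0) e10.
have [r2 r20 H2] := real_approx (is_derive_sin 0) e10.
have [r3 r30 H3] := real_approx (is_derive_cos 0) e10.
exists (Num.min (Num.min r1 r2) (Num.min r3 e1)) => [|h].
  by rewrite !lt_min r10 r20 r30 e10.
rewrite !lt_min => /andP[/andP[h1 h2] /andP[h3 h4]].
have hx := Re_le_cmod h; have hy := Im_le_cmod h.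
have := H1 (Re h) (le_lt_trans hx h1); have := H2 (Im h) (le_lt_trans hy h2).
have := H3 (Im h) (le_lt_trans hy h3).
rewrite !addr0 cos0 sin0 expR0 !mul1r oppr0 mul0r !subr0 ?add0r ?addr0.
move=> b3 b2 b1; apply: le_trans (cmod_le _) _.
have -> : cexp 0 = 1.
  rewrite /cexp /= expR0 cos0 sin0; apply/eqP.
  by rewrite eq_complex /= !mul1r !mul0r !subr0 addr0 !eqxx.
rewrite ?add0r.
have er : `|expR (Re h) - 1| <= 2 * cmod h.
  rewrite -[_ - 1](subrK (Re h)); apply: le_trans (ler_normD _ _) _.
  by have := normr_ge0 (Re h); nra.
have er2 : `|expR (Re h)| <= 3.
  rewrite -[expR _](subrK 1); apply: le_trans (ler_normD _ _) _.
  by rewrite normr1; lra.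
have -> : Re (cexp h - 1 - h) = (expR (Re h) - 1 - Re h) + expR (Re h) * (cos (Im h) - 1).
  by case: (h) => x y; rewrite /cexp /=; ring.
have -> : Im (cexp h - 1 - h) = expR (Re h) * (sin (Im h) - Im h) + (expR (Re h) - 1) * Im h.
  by case: (h) => x y; rewrite /cexp /=; ring.
have n1 := ler_normD (expR (Re h) - 1 - Re h) (expR (Re h) * (cos (Im h) - 1)).
have n2 := ler_normD (expR (Re h) * (sin (Im h) - Im h)) ((expR (Re h) - 1) * Im h).
rewrite !normrM in n1 n2.
have := normr_ge0 (Re h); have := normr_ge0 (Im h) => p1 p2.
have q1 : `|expR (Re h)| * `|cos (Im h) - 1| <= 3 * (e1 * cmod h).
  by apply: ler_pM => //; apply: le_trans b3 _; rewrite ler_wpM2l // ltW.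
have q2 : `|expR (Re h)| * `|sin (Im h) - Im h| <= 3 * (e1 * cmod h).
  by apply: ler_pM => //; apply: le_trans b2 _; rewrite ler_wpM2l // ltW.
have q3 : `|expR (Re h) - 1| * `|Im h| <= (2 * cmod h) * e1.
  by apply: ler_pM => //; lra.
have q4 : e1 * `|Re h| <= e1 * cmod h by rewrite ler_wpM2l // ltW.
have q5 : e1 * cmod h <= e / 16 * cmod h by rewrite ler_wpM2r ?cmod_ge0.
have q6 : 0 <= e * cmod h by rewrite mulr_ge0 ?cmod_ge0 // ltW.
lra.
Qed.

Lemma cexp_cdiff w : cdiff cexp w (cexp w).
Proof.
move=> e e0; have c0 : 0 < cmod (cexp w) by rewrite cmod_cexp expR_gt0.
have [r r0 Hr] := cexp_cdiff0 (divr_gt0 e0 c0); exists r => // h /Hr.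
have -> : cexp 0 = 1.
  rewrite /cexp /= expR0 cos0 sin0; apply/eqP.
  by rewrite eq_complex /= !mul1r !mul0r !subr0 addr0 !eqxx.
rewrite add0r cexpD => H.
have -> : cexp w * cexp h - cexp w - cexp w * h = cexp w * (cexp h - 1 - 1 * h) by ring.
by rewrite cmodM mulrC -ler_pdivlMr // mulrAC.
Qed.

(** Goursat's lemma is applied to phi(z0 + exp w) on a rectangle of width ln rho - ln r1 and height
    2 pi. Its horizontal sides cancel by periodicity, so the means over the circles of radii r1 and
    rho nearly agree, and continuity settles the small one. At z0 only continuity is asked, as the
    divided differences offer no more there. *)
Theorem circle_mean phi z0 (rho : R) : 0 < rho -> ccont phi z0 ->
  (forall z, 0 < cmod (z - z0) <= rho -> exists d, cdiff phi z d) ->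
  forall e : R, 0 < e -> exists n,
    cmod (avg n (fun w => phi (z0 + cexp w)) (ln rho)%:C (0 +i* (2 * pi)) - phi z0)
      <= e.
Proof.
move=> rho0 cphi dphi e e0; have e2 : 0 < e / 2 by lra.
have [r r0 Hr] := cphi _ e2.
pose r1 := Num.min (r / 2) rho.
have r10 : 0 < r1 by rewrite lt_min rho0 andbT; lra.
have r1r : r1 < r by rewrite gt_min; apply/orP; left; lra.
pose b : C := 0 +i* (2 * pi); pose x0 : C := (ln r1)%:C.
pose a : C := (ln rho - ln r1)%:C; pose psi w := phi (z0 + cexp w).
have a0 : 0 <= ln rho - ln r1.
  by rewrite subr_ge0 ler_ln // ?posrE // ge_min lexx orbT.
have pi0 : 0 < pi :> R := pi_gt0 R.
have cb : cmod b = 2 * pi.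
  by rewrite /cmod /b /= expr0n add0r sqrtr_sqr ger0_norm //; lra.
have dpsi s t : 0 <= s <= 1 -> 0 <= t <= 1 ->
    exists d, cdiff psi (x0 + s%:C * a + t%:C * b) d.
  move=> s01 t01; set w := _ + _.
  have dadd : cdiff (fun w => z0 + cexp w) w (cexp w).
    move=> e' e'0; have [r' r'0 H'] := cexp_cdiff w e'0.
    exists r' => // h /H'; congr (cmod _ <= _); ring.
  have [|d dd] := dphi (z0 + cexp w); last by exists (d * cexp w); apply: cdiff_comp.
  rewrite addrC addKr cmod_cexp expR_gt0 andTb -[leRHS]lnK ?posrE // ler_expR.
  have -> : Re w = ln r1 + s * (ln rho - ln r1).
    by rewrite /w /x0 /a /b /=; ring.
  by nra.
(* The vertical sides have length 2 pi, by which [bdry] exceeds a difference of means. *)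
have e3 : 0 < e / 2 * (2 * pi) by rewrite mulr_gt0 //; lra.
have [n Hn] := goursat dpsi e3; exists n; have {Hn} := Hn n (leqnn n).
have psip w : psi (w + b) = psi w by rewrite /psi cexp_periodic.
rewrite /bdry (avg_periodic _ _ _ psip).
have -> : x0 + a = (ln rho)%:C by rewrite /x0 /a -rmorphD /= addrC subrK.
rewrite -/b -/psi; set A1 := avg n psi (ln rho)%:C b; set A0 := avg n psi x0 b.
have -> : a * avg n psi x0 a + b * A1 - a * avg n psi x0 a - b * A0
  = b * (A1 - A0) by ring.
rewrite cmodM cb mulrC ler_pM2r; last by lra.
move=> H.
have H0 : cmod (A0 - phi z0) <= e / 2.
  have -> : phi z0 = avg n (fun w => phi z0 + 0 * w) x0 b by rewrite avg_affine mul0r addr0.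
  rewrite -avgB; apply: avg_cmod_le => t t01; rewrite mul0r addr0.
  apply: Hr; rewrite cmod_cexp.
  have -> : Re (x0 + t%:C * b) = ln r1 by rewrite /x0 /b /=; ring.
  by rewrite lnK ?posrE.
have -> : A1 - phi z0 = (A1 - A0) + (A0 - phi z0) by ring.
by have := cmodD (A1 - A0) (A0 - phi z0); lra.
Qed.

End ComplexFunctions.

(** * Maximum principle and quadratic Taylor remainder *)

Section MaximumPrinciple.
Variable R : realType.
Local Notation C := R[i].
Implicit Types (phi psi : C -> C) (z a b : C).
Local Notation Re := (@complex.Re R).
Local Notation Im := (@complex.Im R).

Lemma cmod_conj z : cmod z^* = cmod z.
Proof. by case: z => x y; rewrite /cmod /= sqrrN. Qed.

Lemma square_argmax (u : C -> R) (r : R) : 0 < r ->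
  (forall z, `|Re z| <= r -> `|Im z| <= r -> forall e, 0 < e ->
     exists2 d : R, 0 < d & forall h, cmod h < d -> `|u (z + h) - u z| <= e) ->
  exists z0, [/\ `|Re z0| <= r, `|Im z0| <= r &
    forall z, `|Re z| <= r -> `|Im z| <= r -> u z <= u z0].
Proof.
move=> r0 cu; pose g (p : R * R) := u (p.1 +i* p.2).
pose A := `[- r, r]%classic `*` `[- r, r]%classic : set (R * R).
have inA p : A p <-> `|p.1| <= r /\ `|p.2| <= r.
  by rewrite /A /= !in_itv /= !ler_norml.
have cA : compact A by apply: compact_setX; exact: segment_compact.
have A0 : A !=set0 by exists (0, 0); apply/inA; rewrite /= normr0; lra.
have cg : {within A, continuous g}.
  apply: continuous_in_subspaceT => p; rewrite inE => /inA[p1 p2].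
  apply/cvgrPdist_le => e e0; have [d d0 Hd] := cu (p.1 +i* p.2) p1 p2 e e0.
  have d2 : 0 < d / 2 by lra.
  near=> q; rewrite distrC /g.
  have -> : q.1 +i* q.2 = p.1 +i* p.2 + ((q.1 - p.1) +i* (q.2 - p.2)).
    by apply/eqP; rewrite eq_complex /=; apply/andP; split; apply/eqP; ring.
  apply: Hd; apply: le_lt_trans (cmod_le _) _ => /=.
  have [h1 h2] : ball p (d / 2) q.
    by near: q; apply: (@nbhsx_ballx R (R * R)%type p (d / 2) d2).
  move: h1 h2; rewrite /ball /= ![`|_ - q.1|]distrC ![`|_ - q.2|]distrC; lra.
have [p0] := compact_EVT_max A0 cA cg; rewrite inE => /inA[p1 p2] pmax.
exists (p0.1 +i* p0.2); split => // z z1 z2.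
have := pmax (Re z, Im z); rewrite inE => /(_ ((inA (Re z, Im z)).2 (conj z1 z2))).
by rewrite /g /=; case: (z).
Unshelve. all: by end_near. Qed.

(** If |phi(z1)| = M > m, then u = Re(conj(phi(z1)) phi) + eps |z|^2 has its maximum over the square
    at an interior point, and the circle mean there contradicts the strict subharmonicity due to eps
    |z|^2. *)
Theorem max_principle phi (r m : R) : 0 < r ->
  (forall z, `|Re z| <= r -> `|Im z| <= r -> ccont phi z) ->
  (forall z, `|Re z| < r -> `|Im z| < r -> exists2 rho : R, 0 < rho &
     forall w, 0 < cmod (w - z) <= rho -> exists d, cdiff phi w d) ->
  (forall z, `|Re z| <= r -> `|Im z| <= r -> `|Re z| = r \/ `|Im z| = r ->
     cmod (phi z) <= m) ->
  forall z, `|Re z| <= r -> `|Im z| <= r -> cmod (phi z) <= m.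
Proof.
move=> r0 cphi dphi bphi z1 z1r z1i; rewrite leNgt; apply/negP => mlt.
set M := cmod (phi z1) in mlt; pose k := (phi z1)^*.
have ck : cmod k = M by rewrite cmod_conj.
have m0 : 0 <= m.
  apply: le_trans (cmod_ge0 (phi (r%:C))) _.
  by apply: bphi => /=; rewrite ?normr0 ?(gtr0_norm r0) //; [lra|left].
(* On the square |z|^2 <= 2 r^2, so with this eps the boundary values of u stay below M^2 <= u
   z1. *)
pose eps := (M ^+ 2 - M * m) / (4 * r ^+ 2 + 1).
have MM : 0 < M ^+ 2 - M * m by rewrite expr2 -mulrBr mulr_gt0; lra.
have r2 : 0 < r ^+ 2 by rewrite exprn_gt0.
have eps0 : 0 < eps by rewrite divr_gt0 //; lra.
have epsE : eps * (2 * r ^+ 2) < M ^+ 2 - M * m.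
  by rewrite /eps mulrAC ltr_pdivrMr; nra.
pose u z := Re (k * phi z) + eps * cmod z ^+ 2.
have [|z0 [z0r z0i zmax]] := @square_argmax u r r0.
  move=> z zr zi e e0; have e2 : 0 < e / 2 by lra.
  have [d1 d10 H1] := @ccont_affine_comb _ phi z k 0 0 (cphi z zr zi) _ e2.
  have n1 := cmod_ge0 z.
  have e3 : 0 < e / 2 / (eps * (2 * cmod z + 1)).
    by rewrite divr_gt0 // mulr_gt0 //; lra.
  exists (Num.min d1 (Num.min 1 (e / 2 / (eps * (2 * cmod z + 1))))) => [|h].
    by rewrite !lt_min d10 ltr01.
  rewrite !lt_min => /and3P[/H1 h1 h2 h3]; rewrite /u.
  rewrite mul0r !addr0 !mul0r !addr0 in h1.
  have := le_trans (Re_le_cmod _) h1; rewrite ReB => h1'.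
  rewrite ltr_pdivlMr in h3; last first.
    by rewrite mulr_gt0 //; lra.
  have t1 := cmodD z h; have t2 := cmodB (z + h) h; rewrite addrK in t2.
  have n2 := cmod_ge0 h; have n3 := cmod_ge0 (z + h).
  have sq : `|cmod (z + h) ^+ 2 - cmod z ^+ 2| <= cmod h * (2 * cmod z + 1).
    by rewrite ler_norml; apply/andP; split; nra.
  rewrite opprD addrACA -mulrBr; apply: le_trans (ler_normD _ _) _.
  rewrite normrM (gtr0_norm eps0); nra.
have u1 : u z1 <= u z0 by apply: zmax.
have uz1 : M ^+ 2 <= u z1.
  rewrite /u; have -> : Re (k * phi z1) = M ^+ 2.
    by rewrite /k /M cmod_sqr; case: (phi z1) => x y /=; ring.
  by rewrite lerDl mulr_ge0 ?sqr_ge0 // ltW.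
have nb : ~ (`|Re z0| = r \/ `|Im z0| = r).
  move=> /(bphi _ z0r z0i) b0.
  have := Re_le_cmod (k * phi z0); rewrite cmodM ck => h1.
  have h2 := ler_norm (Re (k * phi z0)).
  have h3 : M * cmod (phi z0) <= M * m by rewrite ler_wpM2l // cmod_ge0.
  have h4 : eps * cmod z0 ^+ 2 <= eps * (2 * r ^+ 2).
    rewrite ler_wpM2l ?(ltW eps0) // cmod_sqr -(real_normK (num_real (Re z0))).
    rewrite -(real_normK (num_real (Im z0))).
    by have := normr_ge0 (Re z0); have := normr_ge0 (Im z0); nra.
  move: u1; rewrite {2}/u; lra.
have z0r' : `|Re z0| < r by rewrite lt_neqAle z0r andbT; apply/eqP => ?; apply: nb; left.
have z0i' : `|Im z0| < r by rewrite lt_neqAle z0i andbT; apply/eqP => ?; apply: nb; right.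
have [rho1 rho10 H1] := dphi _ z0r' z0i'.
pose rho := Num.min rho1 (Num.min (r - `|Re z0|) (r - `|Im z0|)).
have rho0 : 0 < rho by rewrite !lt_min rho10 /=; apply/andP; split; lra.
have rhoL : rho <= rho1 by rewrite ge_min lexx.
have rhoR : rho <= r - `|Re z0| by rewrite !ge_min lexx orbT.
have rhoI : rho <= r - `|Im z0| by rewrite !ge_min lexx !orbT.
clearbody rho.
(* On the circle, |z0 + w|^2 = |z0|^2 + 2 Re(conj(z0) w) + rho^2. The middle term is moved into the
   holomorphic [Phi], so that Re Phi(z0 + w) <= Re Phi(z0) - eps rho^2. *)
pose l := (2 * eps)%:C * z0^*.
pose Phi z := k * phi z + (l * z + - (l * z0)).
have e3 : 0 < eps * rho ^+ 2 / 2 by rewrite divr_gt0 // mulr_gt0 // exprn_gt0.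
have [|z /andP[h1 h2]|n] := @circle_mean _ Phi z0 rho rho0 _ _ _ e3.
- by apply: ccont_affine_comb; apply: cphi.
- have [|d dd] := H1 z; first by rewrite h1 (le_trans h2).
  by exists (k * d + l); apply: cdiff_affine_comb.
move=> /(le_trans (Re_le_cmod _)); rewrite ReB.
set av := avg _ _ _ _.
suff : Re av <= Re (Phi z0) - eps * rho ^+ 2.
  move=> h1; rewrite ler_norml => /andP[h2 _]; nra.
apply: avg_Re_le => t t01; set w := cexp _.
have cw : cmod w = rho.
  by rewrite /w cmod_cexp /= !(mulr0, mul0r) subr0 addr0 lnK ?posrE.
have := zmax (z0 + w); rewrite ReD ImD => umax.
have /umax {}umax : `|Re z0 + Re w| <= r.
  by have := ler_normD (Re z0) (Re w); have := Re_le_cmod w; lra.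
have /umax {umax} : `|Im z0 + Im w| <= r.
  by have := ler_normD (Im z0) (Im w); have := Im_le_cmod w; lra.
have cwE := cmod_sqr w; rewrite cw in cwE.
rewrite /u /Phi !ReD !cmod_sqr ReD ImD cwE.
have -> : Re (l * (z0 + w)) + Re (- (l * z0)) =
    2 * eps * (Re z0 * Re w + Im z0 * Im w).
  by rewrite /l; case: (z0) (w) => x y [x' y'] /=; ring.
have -> : Re (l * z0) + Re (- (l * z0)) = 0.
  by rewrite -ReD subrr.
by rewrite addr0; lra.
Qed.

Lemma cdiff_quot phi t s c d : cdiff phi t d -> t != s ->
  exists d', cdiff (fun w => (phi w - c) / (w - s)) t d'.
Proof.
move=> dphi ts; set a := t - s; set p := phi t - c.
have a0 : a != 0 by rewrite subr_eq0.
have ca := cmod_gt0 a0.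
exists ((d * a - p) / a ^+ 2) => e e0.
have e1 : 0 < e * cmod a / 4 by rewrite divr_gt0 // mulr_gt0.
have [r r0 Hr] := dphi _ e1.
(* Bounds |p - d a| / (|a|^2 |a + h|), the coefficient of the second order term, once |a + h| >= |a|
   / 2. *)
pose D := 2 * cmod (p - d * a) / cmod a ^+ 3.
have D0 : 0 <= D by rewrite /D divr_ge0 ?mulr_ge0 ?cmod_ge0 // exprn_ge0 // ltW.
have e2 : 0 < e / 2 / (D + 1) by rewrite divr_gt0; lra.
exists (Num.min (Num.min r (cmod a / 2)) (e / 2 / (D + 1))) => [|h].
  by rewrite !lt_min r0 e2 andbT divr_gt0.
rewrite !lt_min => /andP[/andP[/Hr]]; set eta := phi (t + h) - _ - _ => hr ha.
rewrite ltr_pdivlMr; last by lra.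
move=> hD; have ah : cmod a / 2 <= cmod (a + h).
  by have := cmodB (a + h) h; rewrite addrK; lra.
have ah0 : a + h != 0.
  by apply/eqP => z; move: ah; rewrite z cmod0; lra.
have -> : (phi (t + h) - c) / (t + h - s) - (phi t - c) / (t - s)
    - (d * a - p) / a ^+ 2 * h
    = eta / (a + h) + h ^+ 2 * (p - d * a) / (a ^+ 2 * (a + h)).
  have -> : t + h - s = a + h by rewrite /a; ring.
  have -> : phi (t + h) - c = eta + p + d * h by rewrite /eta /p; ring.
  by rewrite -/a -/p; field; rewrite a0 ah0.
apply: le_trans (cmodD _ _) _; rewrite !cmodM !cmodV !cmodM.
have V : (cmod (a + h))^-1 <= 2 / cmod a.
  by rewrite -[2 / _]invrK lef_pV2 ?posrE ?invr_gt0 ?divr_gt0 ?invf_div //; lra.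
have V0 : 0 <= (cmod (a + h))^-1 by rewrite invr_ge0 cmod_ge0.
have T1 : cmod eta / cmod (a + h) <= e / 2 * cmod h.
  have -> : e / 2 * cmod h = (e * cmod a / 4 * cmod h) * (2 / cmod a).
    by field; rewrite gt_eqF.
  by apply: ler_pM; rewrite ?cmod_ge0.
have T2 : cmod h * cmod h * cmod (p - d * a) / (cmod a * cmod a * cmod (a + h))
    <= cmod h * (cmod h * D).
  rewrite invfM -!mulrA ler_wpM2l ?cmod_ge0 // ler_wpM2l ?cmod_ge0 //.
  have -> : D = cmod (p - d * a) * ((cmod a * cmod a)^-1 * (2 / cmod a)).
    by rewrite /D; field; rewrite gt_eqF.
  by rewrite ler_wpM2l ?cmod_ge0 // ler_wpM2l // invr_ge0 mulr_ge0 // ltW.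
have ch := cmod_ge0 h.
have T3 : cmod h * (cmod h * D) <= cmod h * (e / 2).
  by rewrite ler_wpM2l //; nra.
by lra.
Qed.

(* The maximum principle is applied to the divided difference of phi at s and 0,
   and then to the difference of the divided differences at s and at 0. *)
Theorem quadratic_remainder phi (rho M : R) (d s : C) : 0 < rho ->
  (forall z, cmod z <= 3 * rho -> exists d, cdiff phi z d) ->
  (forall z, cmod z <= 3 * rho -> cmod (phi z) <= M) ->
  cdiff phi 0 d -> cmod s <= rho ->
  cmod (phi s - phi 0 - d * s) <= 3 * M / rho ^+ 2 * cmod s ^+ 2.
Proof.
move=> rho0 dphi bphi d0 srho.
have [->|sn0] := eqVneq s 0.
  by rewrite subrr mulr0 subr0 !cmod0 expr0n mulr0.
(* The value d fills the removable singularity; q is continuous there when d is the derivative. *)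
pose q (s d t : C) := if t == s then d else (phi t - phi s) / (t - s).
(* The square of half-side 2 rho lies in the disc of radius 3 rho because 8 <= 9, and its boundary
   keeps distance rho from all points of modulus at most rho. *)
have sq z : `|Re z| <= 2 * rho -> `|Im z| <= 2 * rho -> cmod z <= 3 * rho.
  move=> z1 z2; rewrite -(ler_sqr (x := cmod z)) ?nnegrE ?cmod_ge0 //; last by lra.
  rewrite cmod_sqr -(real_normK (num_real (Re z))) -(real_normK (num_real (Im z))).
  by have := normr_ge0 (Re z); have := normr_ge0 (Im z); nra.
have qE s' d' z : z != s' -> exists2 r, 0 < r & forall h, cmod h < r ->
    q s' d' (z + h) = (phi (z + h) - phi s') / (z + h - s').
  move=> zs; exists (cmod (z - s')) => [|h hr]; first by rewrite cmod_gt0 // subr_eq0.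
  rewrite /q ifN //; apply: contraTneq hr => e.
  by rewrite -leNgt -e opprD addNKr cmodN.
have qdiff s' d' z : cmod z <= 3 * rho -> z != s' -> exists d, cdiff (q s' d') z d.
  move=> /dphi[dz ddz] zs; have [d2 dd2] := cdiff_quot (phi s') ddz zs.
  exists d2 => e e0; have [r r0 Hr] := dd2 e e0; have [r1 r10 H1] := qE s' d' z zs.
  exists (Num.min r r1) => [|h]; first by rewrite lt_min r0.
  rewrite lt_min => /andP[/Hr + /H1 ->].
  by have := H1 0; rewrite cmod0 addr0 => /(_ r10) ->.
have qcont s' d' z : cdiff phi s' d' -> cmod z <= 3 * rho -> ccont (q s' d') z.
  move=> ds zr; have [->|zs] := eqVneq z s'; last first.
    by have [dz] := qdiff s' d' z zr zs; apply: cdiff_ccont.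
  move=> e e0; have [r r0 Hr] := ds e e0; exists r => // h /Hr.
  have sh : s' + h - s' = h by ring.
  rewrite /q eqxx sh; case: eqVneq => [_|hn]; first by rewrite subrr cmod0 (ltW e0).
  have h0 : h != 0 by apply: contra_neq hn => ->; rewrite addr0.
  have -> : (phi (s' + h) - phi s') / h - d' = (phi (s' + h) - phi s' - d' * h) / h.
    by field.
  by rewrite cmodM cmodV ler_pdivrMr // cmod_gt0.
have r13 : rho <= 3 * rho by lra.
have [ds dds] := dphi s (le_trans srho r13).
have bd z s' : `|Re z| = 2 * rho \/ `|Im z| = 2 * rho -> cmod s' <= rho ->
    rho <= cmod (z - s').
  have := Re_le_cmod s'; have := Im_le_cmod s'.
  have := Re_le_cmod (z - s'); have := Im_le_cmod (z - s'); rewrite ReB ImB.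
  have := ler_normD (Re z - Re s') (Re s'); have := ler_normD (Im z - Im s') (Im s').
  by rewrite !subrK => ? ? ? ? ? ? [|]; lra.
have bd0 z : `|Re z| = 2 * rho \/ `|Im z| = 2 * rho -> 2 * rho <= cmod z.
  have := Re_le_cmod z; have := Im_le_cmod z.
  by move=> ? ? [<-|<-].
have M0 : 0 <= M by apply: le_trans (cmod_ge0 _) (bphi 0 _); rewrite cmod0; lra.
have c0 : `|Re (0 : C)| <= 2 * rho by rewrite normr0; lra.
have c0' : `|Im (0 : C)| <= 2 * rho by rewrite normr0; lra.
have r20 : 0 < 2 * rho by lra.
have lip : cmod (phi s - phi 0) <= 2 * M / rho * cmod s.
  have : cmod (q s ds 0) <= 2 * M / rho.
    apply: (@max_principle (q s ds) (2 * rho)) => //.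
    - by move=> z zr zi; apply: qcont => //; apply: sq.
    - move=> z zr zi; have [->|zs] := eqVneq z s.
        exists rho => // w /andP[h1 h2]; apply: qdiff.
          by have := cmodD (w - s) s; rewrite subrK; lra.
        by apply: contraTneq h1 => ->; rewrite subrr cmod0 ltxx.
      have zs0 : 0 < cmod (z - s) by rewrite cmod_gt0 // subr_eq0.
      exists (Num.min (cmod (z - s) / 2) (Num.min (2 * rho - `|Re z|) (2 * rho - `|Im z|))).
        by rewrite !lt_min !subr_gt0 zr zi !andbT; lra.
      move=> w /andP[h1]; rewrite !le_min => /and3P[h2 h3 h4]; apply: qdiff.
        apply: sq.
          have := Re_le_cmod (w - z).
          by have := ler_normD (Re (w - z)) (Re z); rewrite ReB subrK; lra.
        have := Im_le_cmod (w - z).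
        by have := ler_normD (Im (w - z)) (Im z); rewrite ImB subrK; lra.
      by apply: contraTneq h2 => ->; rewrite [cmod (s - z)]cmodBC -ltNge; lra.
    move=> z zr zi zb; have zd := bd z s zb srho.
    rewrite /q ifN; last by apply: contraTneq zd => ->; rewrite subrr cmod0 -ltNge.
    rewrite cmodM cmodV ler_pdivrMr; last by lra.
    have b1 := bphi z (sq z zr zi); have b2 := bphi s (le_trans srho r13).
    have := cmodB (phi z) (phi s) => b3.
    apply: (@le_trans _ _ (2 * M / rho * rho)); first by rewrite divfK ?gt_eqF //; lra.
    by rewrite ler_wpM2l // divr_ge0 // ?mulr_ge0 // ltW.
  rewrite /q ifN 1?eq_sym // sub0r cmodM cmodV cmodN cmodBC ler_pdivrMr //.
  by rewrite cmod_gt0.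
have : cmod (q s ds 0 - q 0 d 0) <= 3 * M / rho ^+ 2 * cmod s.
  apply: (@max_principle (fun t => q s ds t - q 0 d t) (2 * rho)) => //.
  - by move=> z zr zi; apply: ccontB; apply: qcont => //; apply: sq.
  - move=> z zr zi.
    suff [r r0 Hr] : exists2 r, 0 < r & forall w, 0 < cmod (w - z) <= r -> w != 0 /\ w != s.
      exists (Num.min r (Num.min (2 * rho - `|Re z|) (2 * rho - `|Im z|))).
        by rewrite !lt_min r0 !subr_gt0 zr zi.
      move=> w /andP[h1]; rewrite !le_min => /and3P[h2 h3 h4].
      have w3 : cmod w <= 3 * rho.
        apply: sq.
          have := Re_le_cmod (w - z).
          by have := ler_normD (Re (w - z)) (Re z); rewrite ReB subrK; lra.
        have := Im_le_cmod (w - z).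
        by have := ler_normD (Im (w - z)) (Im z); rewrite ImB subrK; lra.
      have [|w0 ws] := Hr w; first by rewrite h1.
      have [d1 D1] := qdiff s ds w w3 ws; have [d2 D2] := qdiff 0 d w w3 w0.
      by exists (d1 - d2); apply: cdiffB.
    have s0 := cmod_gt0 sn0.
    have sep p : exists2 r, 0 < r & forall w, 0 < cmod (w - z) <= r -> w != p.
      have [->|zp] := eqVneq z p.
        exists 1 => // w /andP[h _]; apply: contraTneq h => ->.
        by rewrite subrr cmod0 ltxx.
      have zp0 : 0 < cmod (z - p) by rewrite cmod_gt0 // subr_eq0.
      exists (cmod (z - p) / 2); first by lra.
      by move=> w /andP[_ h]; apply: contraTneq h => ->; rewrite [cmod (p - z)]cmodBC -ltNge; lra.
    have [ra ra0 Ha] := sep 0; have [rb rb0 Hb] := sep s.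
    exists (Num.min ra rb) => [|w /andP[h]]; first by rewrite lt_min ra0.
    by rewrite le_min => /andP[h1 h2]; split; [apply: Ha | apply: Hb]; rewrite h.
  move=> z zr zi zb; have zd := bd z s zb srho; have zd0 := bd0 z zb.
  have z0 : z != 0 by apply: contraTneq zd0 => ->; rewrite cmod0 -ltNge.
  have zs : z != s by apply: contraTneq zd => ->; rewrite subrr cmod0 -ltNge.
  rewrite /q !ifN // subr0.
  (* Both terms of this numerator carry a factor |s|: with |z| >= 2 rho and [lip] they are at most M
     |s| / rho and 2 M |s| / rho. As |z - s| >= rho, the constant is 3 M / rho^2. *)
  have -> : (phi z - phi s) / (z - s) - (phi z - phi 0) / z =
      (s / z * (phi z - phi 0) - (phi s - phi 0)) / (z - s).
    by field; rewrite z0 subr_eq0 zs.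
  rewrite cmodM cmodV ler_pdivrMr; last by lra.
  apply: le_trans (cmodB _ _) _; rewrite !cmodM cmodV.
  have b1 := bphi z (sq z zr zi).
  have b2 : cmod (phi 0) <= M by apply: bphi; rewrite cmod0; lra.
  have b3 := cmodB (phi z) (phi 0).
  have b4 : cmod s / cmod z * cmod (phi z - phi 0) <= cmod s / (2 * rho) * (2 * M).
    apply: ler_pM; rewrite ?divr_ge0 ?cmod_ge0 //; last by lra.
    by rewrite ler_wpM2l ?cmod_ge0 // lef_pV2 // posrE; lra.
  apply: (@le_trans _ _ (3 * M / rho ^+ 2 * cmod s * rho)); last first.
    have MR : 0 <= 3 * M / rho ^+ 2 by rewrite divr_ge0 ?sqr_ge0 //; lra.
    by rewrite ler_wpM2l // mulr_ge0 ?cmod_ge0.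
  have -> : 3 * M / rho ^+ 2 * cmod s * rho =
    cmod s / (2 * rho) * (2 * M) + 2 * M / rho * cmod s by field; rewrite gt_eqF.
  by lra.
rewrite /q eqxx ifN 1?eq_sym // sub0r.
have -> : (phi 0 - phi s) / - s - d = (phi s - phi 0 - d * s) / s by field.
by rewrite cmodM cmodV ler_pdivrMr ?cmod_gt0 // expr2 mulrA.
Qed.

End MaximumPrinciple.

(** * From one variable to several *)

Section SeveralVariables.
Variables (R : realType) (m : nat).
Local Notation K := (complex_complex__canonical__Num_NumField R).
Local Notation C := (Num.NumField.sort K).
Local Notation V := 'rV[C]_m.
Implicit Types (f g : V -> C) (v w z h : V).

Lemma posC_real (r : C) : 0 < r -> r = (complex.Re r)%:C.
Proof. by move=> /gtr0_real/RRe_real. Qed.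

Definition vnorm (v : V) : R := complex.Re `|v|.

Lemma vnormE v : `|v| = (vnorm v)%:C.
Proof.
have := normr_ge0 v; rewrite lecE /vnorm /= => /andP[/eqP i0 _].
by apply/eqP; rewrite eq_complex /= eqxx i0 eqxx.
Qed.

Lemma vnorm_ge0 v : 0 <= vnorm v.
Proof. by rewrite -ler0c -vnormE. Qed.

Lemma vnorm_le0 v : vnorm v <= 0 -> v = 0.
Proof. by rewrite -lecR -vnormE normr_le0 => /eqP. Qed.

Lemma vnormD v w : vnorm (v + w) <= vnorm v + vnorm w.
Proof. by rewrite -lecR rmorphD /= -!vnormE ler_normD. Qed.

Lemma vnormZ (t : C) v : vnorm (t *: v) = cmod t * vnorm v.
Proof. by apply: complexI; rewrite rmorphM /= -!vnormE -normC_cmod normrZ. Qed.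

Lemma vnorm0 : vnorm 0 = 0.
Proof. by apply: complexI; rewrite -vnormE normr0. Qed.

Lemma cmod_coord v j : cmod (v 0 j) <= vnorm v.
Proof.
rewrite -lecR -vnormE -normC_cmod [leRHS]/Num.norm /= mx_normE.
by rewrite -[leLHS]nngE num_le; exact: (le_bigmax _ _ (0, j)).
Qed.

Lemma differentiable_vapprox f z : differentiable f z ->
  forall e : R, 0 < e -> exists2 r : R, 0 < r &
    forall h, vnorm h < r -> cmod (f (z + h) - f z - 'd f z h) <= e * vnorm h.
Proof.
move=> df e e0; have eC : 0 < e%:C by rewrite ltcR.
have [r r0 Hr] := differentiable_approx df eC.
have rE := posC_real r0.
exists (complex.Re r) => [|h hr]; first by rewrite -ltcR -rE.
rewrite [z + h]addrC -lecR rmorphM /= -normC_cmod -vnormE; apply: Hr.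
by rewrite rE vnormE ltcR.
Qed.

Lemma vapprox_differentiable f z (l : 'I_m -> C) :
  (forall e : R, 0 < e -> exists2 r : R, 0 < r &
    forall h, vnorm h < r ->
      cmod (f (z + h) - f z - (\sum_j l j * h 0 j : C)) <= e * vnorm h) ->
  differentiable f z.
Proof.
move=> H; pose lf := fun h : V => \sum_j l j * h 0 j.
have Llin : linear lf.
  move=> a u v; rewrite /lf scaler_sumr -big_split; apply: eq_bigr => j _ /=.
  by rewrite !mxE /GRing.scale /=; ring.
have Lcont : continuous lf.
  move=> x; apply: differentiable_continuous.
  have -> : lf = \sum_(j < m) (l j *: (fun h : V => h 0 j : C)).
    by rewrite funeqE => h; rewrite fct_sumE; apply: eq_bigr.
  apply: differentiable_sum => j; apply: differentiableZ.
  exact: differentiable_coord.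
pose L : {linear V -> C} := HB.pack lf (GRing.isLinear.Build _ _ _ _ lf Llin).
have fo : f \o shift z = cst (f z) + L +o_ (0 : V) id.
  apply/eqaddoP => e e0.
  have eE := posC_real e0.
  have e0' : 0 < complex.Re e by rewrite -ltcR -eE.
  have [r r0 Hr] := H _ e0'; apply/(@nbhs_normP _ _ (0 : V)).
  exists r%:C; first by rewrite /= ltcR.
  move=> h /=; rewrite sub0r normrN vnormE ltcR => /Hr.
  rewrite eE -rmorphM normC_cmod lecR [z + h]addrC.
  by congr (_ <= _); congr cmod; rewrite !fctE opprD addrA.
have dL := diff_unique (df := L) Lcont fo.
by apply/diff_locallyP; rewrite dL.
Qed.

(** The one-variable bound for t -> f(w + t h) at t = 1, with rho chosen so that rho |h| = r/4; 48
    is 3 times 4^2. The derivative enters through directional derivatives [L], so differences of two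
    functions are covered as well. *)
Lemma quadratic_remainder_line f w (L : V -> C) (r M : R) : 0 < r ->
  (forall h k, vnorm h < r -> exists d, cdiff (fun t => f (w + h + t *: k)) 0 d) ->
  (forall k, cdiff (fun t => f (w + t *: k)) 0 (L k)) ->
  (forall h, vnorm h < r -> cmod (f (w + h)) <= M) ->
  forall h, vnorm h <= r / 4 ->
    cmod (f (w + h) - f w - L h) <= 48 * M / r ^+ 2 * vnorm h ^+ 2.
Proof.
move=> r0 df dL bf h hr.
have [h0|h0] := leP (vnorm h) 0.
  (* No rescaling is possible for h = 0. As [L] is not assumed linear, L 0 = 0 has to be proved: it
     is the derivative of a constant. *)
  rewrite (vnorm_le0 h0) vnorm0 addr0 subrr sub0r cmodN expr0n mulr0.
  rewrite leNgt; apply/negP => L0.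
  have L2 : 0 < cmod (L 0) / 2 by lra.
  have [e e0 He] := dL 0 _ L2; have := He (e / 2)%:C.
  rewrite !scaler0 !addr0 subrr sub0r cmodN cmodM cmod_real ger0_norm; last by lra.
  have : 0 < cmod (L 0) * (e / 2) by rewrite mulr_gt0 //; lra.
  by move=> h1 h2; have := h2 (ltac:(lra)); lra.
pose rho := r / (4 * vnorm h).
have rho0 : 0 < rho by rewrite divr_gt0 //; lra.
have rho1 : 1 <= rho by rewrite ler_pdivlMr; lra.
have rhoh : rho * vnorm h = r / 4 by rewrite /rho; field; rewrite gt_eqF.
have in_r (t : C) : cmod t <= 3 * rho -> vnorm (t *: h) < r.
  move=> tr; rewrite vnormZ; apply: (@le_lt_trans _ _ (3 * (rho * vnorm h))); last by lra.
  by rewrite mulrA ler_wpM2r // ltW.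
pose phi (t : R[i]) : R[i] := f (w + t *: h).
have dphi (t : R[i]) : cmod t <= 3 * rho -> exists d, cdiff phi t d.
  move=> /in_r/(df _ h)[d dd]; exists d => e e0.
  have [r1 r10 H1] := dd e e0; exists r1 => // k /H1.
  by rewrite /phi scale0r addr0 add0r -(addrA w) -scalerDl.
have c1 : cmod (1 : R[i]) = 1 by rewrite (_ : 1 = 1%:C) // cmod_real normr1.
have c1r : cmod (1 : R[i]) <= rho by rewrite c1.
have bphi (z : R[i]) : cmod z <= 3 * rho -> cmod (phi z) <= M by move=> /in_r/bf.
have := quadratic_remainder rho0 dphi bphi (dL h) c1r.
rewrite c1 expr1n mulr1 mulr1 /phi scale1r scale0r addr0 => H; apply: le_trans H _.
rewrite /rho le_eqVlt; apply/orP; left; apply/eqP.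
by field; rewrite !gt_eqF.
Qed.

Lemma differentiable_cdiff f w k : differentiable f w ->
  cdiff (fun t => f (w + t *: k)) 0 ('d f w k).
Proof.
move=> dw e e0; have k0 : 0 < vnorm k + 1 by have := vnorm_ge0 k; lra.
have [r r0 Hr] := differentiable_vapprox dw (divr_gt0 e0 k0).
exists (r / (vnorm k + 1)) => [|h]; first by rewrite divr_gt0.
rewrite ltr_pdivlMr // => hr.
have hk : vnorm (h *: k) <= cmod h * (vnorm k + 1).
  by rewrite vnormZ ler_wpM2l ?cmod_ge0 //; lra.
have := Hr (h *: k) (le_lt_trans hk hr).
rewrite linearZ scale0r addr0 add0r [X in cmod (_ - X)]mulrC => H.
apply: le_trans H _; rewrite mulrAC ler_pdivrMr // -mulrA ler_wpM2l //.
exact: ltW.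
Qed.

Lemma quadratic_remainder_vec f w (r M : R) : 0 < r ->
  (forall h, vnorm h < r -> differentiable f (w + h)) ->
  (forall h, vnorm h < r -> cmod (f (w + h)) <= M) ->
  forall h, vnorm h <= r / 4 ->
    cmod (f (w + h) - f w - 'd f w h) <= 48 * M / r ^+ 2 * vnorm h ^+ 2.
Proof.
move=> r0 df bf; apply: quadratic_remainder_line => //.
  by move=> h k /df dfh; exists ('d f (w + h) k); apply: differentiable_cdiff.
move=> k; apply: differentiable_cdiff.
by rewrite -[w]addr0; apply: df; rewrite vnorm0.
Qed.

Lemma quadratic_remainder_vecB f g w (r M : R) : 0 < r ->
  (forall h, vnorm h < r -> differentiable f (w + h)) ->
  (forall h, vnorm h < r -> differentiable g (w + h)) ->
  (forall h, vnorm h < r -> cmod (f (w + h) - g (w + h)) <= M) ->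
  forall h, vnorm h <= r / 4 ->
    cmod (f (w + h) - g (w + h) - (f w - g w) - ('d f w h - 'd g w h))
      <= 48 * M / r ^+ 2 * vnorm h ^+ 2.
Proof.
move=> r0 df dg bfg.
apply: (@quadratic_remainder_line (fun z => f z - g z : R[i]) w
  (fun h => 'd f w h - 'd g w h : R[i])) => //.
  move=> h k hr; exists ('d f (w + h) k - 'd g (w + h) k).
  by apply: cdiffB; apply: differentiable_cdiff; [apply: df | apply: dg].
have z0 : vnorm 0 < r by rewrite vnorm0.
move=> k; apply: cdiffB; apply: differentiable_cdiff.
  by rewrite -[w]addr0; apply: df.
by rewrite -[w]addr0; apply: dg.
Qed.

Lemma geometric_cauchy (u : nat -> R) (c : R) :
  (forall k l, (k <= l)%N -> `|u k - u l| <= c * 2^-1 ^+ k) ->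
  exists s, forall k, `|u k - s| <= c * 2^-1 ^+ k.
Proof.
move=> uc; have c0 : 0 <= c.
  by have := uc 0%N 0%N (leqnn _); rewrite subrr normr0 expr0 mulr1.
pose e k := c * 2^-1 ^+ k.
have e0 k : 0 <= e k by rewrite mulr_ge0 // exprn_ge0.
have lu k l : u k - e k <= u l + e l.
  have [/uc|/ltnW/uc] := leqP k l; rewrite -/(e _) ler_norml => /andP[h1 h2];
  have := e0 k; have := e0 l; lra.
have hs : has_sup (range (fun k => u k - e k)).
  split; first by exists (u 0%N - e 0%N), 0%N.
  by exists (u 0%N + e 0%N) => _ [k _ <-].
exists (sup (range (fun k => u k - e k))) => k; rewrite -/(e k).
have h1 : u k - e k <= sup (range (fun k => u k - e k)).
  by apply: sup_upper_bound => //; exists k.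
have h2 : sup (range (fun k => u k - e k)) <= u k + e k.
  by apply: ge_sup => [|_ [j _ <-]//]; exists (u 0%N - e 0%N), 0%N.
by rewrite ler_norml; apply/andP; split; lra.
Qed.

Lemma geometric_cauchyC (u : nat -> C) (c : R) :
  (forall k l, (k <= l)%N -> cmod (u k - u l) <= c * 2^-1 ^+ k) ->
  exists s, forall k, cmod (u k - s) <= 2 * c * 2^-1 ^+ k.
Proof.
move=> uc.
have [k l kl|s1 H1] := @geometric_cauchy (fun k => complex.Re (u k)) c.
  by rewrite -ReB; apply: le_trans (Re_le_cmod _) (uc k l kl).
have [k l kl|s2 H2] := @geometric_cauchy (fun k => complex.Im (u k)) c.
  by rewrite -ImB; apply: le_trans (Im_le_cmod _) (uc k l kl).
exists (s1 +i* s2) => k; apply: le_trans (cmod_le _) _; rewrite ReB ImB /=.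
by have := H1 k; have := H2 k; lra.
Qed.

(** The quadratic remainder bounds are uniform in k, so they pass to the limit. Applied to [gs k] -
    [gs l] they also show that the differentials converge geometrically. *)
Lemma uniform_limit_differentiable (g : V -> C) (gs : nat -> V -> C) w (r M c : R) :
  0 < r -> 0 <= c ->
  (forall k h, vnorm h < r -> differentiable (gs k) (w + h)) ->
  (forall h, vnorm h < r -> cmod (g (w + h)) <= M) ->
  (forall k h, vnorm h < r -> cmod (gs k (w + h) - g (w + h)) <= c * 2^-1 ^+ k) ->
  differentiable g w.
Proof.
move=> r0 c0 dgs bg gsg; pose e k : R := c * 2^-1 ^+ k.
have e0 k : 0 <= e k by rewrite mulr_ge0 // exprn_ge0.
have emono k l : (k <= l)%N -> e l <= e k.
  move=> kl; rewrite ler_wpM2l // ler_wiXn2l //; lra.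
have dw k : differentiable (gs k) w.
  by rewrite -[w]addr0; apply: dgs; rewrite vnorm0.
have zr : vnorm 0 < r by rewrite vnorm0.
have M0 : 0 <= M by apply: le_trans (cmod_ge0 _) (bg 0 zr).
have small h : vnorm h <= r / 4 -> vnorm h < r by move=> ?; lra.
have [L [LZ LE Lq Ldiff]] : exists L : nat -> V -> C, [/\
    forall k a h, L k (a *: h) = a * L k h,
    forall k h, L k h = \sum_j L k (delta_mx 0 j) * h 0 j,
    forall k h M', (forall h, vnorm h < r -> cmod (gs k (w + h)) <= M') ->
      vnorm h <= r / 4 ->
      cmod (gs k (w + h) - gs k w - L k h) <= 48 * M' / r ^+ 2 * vnorm h ^+ 2 &
    forall k l h M', (forall h, vnorm h < r -> cmod (gs k (w + h) - gs l (w + h)) <= M') ->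
      vnorm h <= r / 4 ->
      cmod (gs k (w + h) - gs l (w + h) - (gs k w - gs l w) - (L k h - L l h))
        <= 48 * M' / r ^+ 2 * vnorm h ^+ 2].
  exists (fun k h => 'd (gs k) w h); split.
  - by move=> k a h; rewrite linearZ.
  - move=> k h; rewrite {1}[h]row_sum_delta linear_sum; apply: eq_bigr => j _.
    by rewrite linearZ /= mulrC.
  - by move=> k h M' bs; exact: (@quadratic_remainder_vec (gs k) w r M' r0 (dgs k) bs).
  move=> k l h M' bs hr.
  exact: (@quadratic_remainder_vecB (gs k) (gs l) w r M' r0 (dgs k) (dgs l) bs).
(* The increment of [gs k] - [gs l] is at most 4 [e k], and its remainder at most 48 (2 [e k]) / r^2
   (r/4)^2 = 6 [e k]. *)
have {}Ldiff k l h : (k <= l)%N -> vnorm h <= r / 4 -> cmod (L k h - L l h) <= 10 * e k.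
  move=> kl hr; have ekl := emono _ _ kl.
  have tri (q x : C) (A B : R) : cmod (q - x) <= A -> cmod q <= B -> cmod x <= A + B.
    by move=> hA hB; rewrite -(subKr q x); have := cmodB q (q - x); lra.
  have bs i : vnorm i < r -> cmod (gs k (w + i) - gs l (w + i)) <= 2 * e k.
    move=> ir; have h1 := gsg k i ir; have h2 := gsg l i ir.
    rewrite -(subrKA (g (w + i))) -[X in _ + X]opprB.
    by apply: le_trans (cmodB _ _) _; rewrite -!/(e _) in h1 h2; lra.
  have b1 : cmod (gs k (w + h) - gs l (w + h) - (gs k w - gs l w)) <= 4 * e k.
    have h1 := bs _ (small _ hr); have h2 := bs 0 zr; rewrite addr0 in h2.
    by apply: le_trans (cmodB _ _) _; lra.
  apply: le_trans (tri _ _ _ _ (Ldiff k l h _ bs hr) b1) _.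
  have b2 : 48 * (2 * e k) / r ^+ 2 * vnorm h ^+ 2 <= 6 * e k.
    have -> : 6 * e k = 48 * (2 * e k) / r ^+ 2 * (r / 4) ^+ 2 by field; rewrite gt_eqF.
    rewrite ler_wpM2l ?divr_ge0 ?sqr_ge0 ?mulr_ge0 //.
    by rewrite lerXn2r // nnegrE ?vnorm_ge0 //; lra.
  by lra.
(* Basis vectors rescaled into the ball where [Ldiff] applies; the summand 1 avoids division by a
   norm not known to be nonzero. *)
pose d j : V := ((r / 4 / (vnorm (delta_mx 0 j) + 1))%:C) *: delta_mx 0 j.
pose t j : R := r / 4 / (vnorm (delta_mx 0 j) + 1).
have t0 j : 0 < t j.
  have n0 := vnorm_ge0 (delta_mx 0 j); rewrite /t !divr_gt0 //; lra.
have dr j : vnorm (d j) <= r / 4.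
  have n0 := vnorm_ge0 (delta_mx 0 j).
  rewrite vnormZ cmod_real ger0_norm; last by apply/ltW/t0.
  by rewrite mulrAC ler_pdivrMr; nra.
have /choice[l Hl] j : exists s, forall k,
    cmod (L k (delta_mx 0 j) - s) <= 2 * (10 * c / t j) * 2^-1 ^+ k.
  apply: geometric_cauchyC => k i ki.
  have := Ldiff k i (d j) ki (dr j); rewrite /d !LZ -mulrBr.
  rewrite cmodM cmod_real -/(t j) gtr0_norm //.
  by rewrite mulrC -ler_pdivlMr // /e mulrA mulrAC.
pose Lim h := \sum_j l j * h 0 j.
pose T := \sum_j 2 * (10 * c / t j).
have T0 : 0 <= T.
  by apply: sumr_ge0 => j _; rewrite mulr_ge0 // divr_ge0 ?(ltW (t0 j)) ?mulr_ge0.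
have Llim k h : cmod (L k h - Lim h) <= T * vnorm h * 2^-1 ^+ k.
  rewrite LE /Lim -sumrB.
  have cs (I : seq 'I_m) (F : 'I_m -> C) : cmod (\sum_(j <- I) F j) <= \sum_(j <- I) cmod (F j).
    elim/big_rec2: _ => [|j x y _ xy]; first by rewrite cmod0.
    by apply: le_trans (cmodD _ _) _; rewrite lerD2l.
  apply: le_trans (cs _ _) _; rewrite /T -mulrA mulr_suml; apply: ler_sum => j _.
  rewrite -mulrBl cmodM mulrCA mulrC; apply: ler_pM; rewrite ?cmod_ge0 ?cmod_coord //.
pose B := 48 * (M + c) / r ^+ 2.
have B0 : 0 <= B by rewrite divr_ge0 ?sqr_ge0 // mulr_ge0 // addr_ge0.
have main h : vnorm h <= r / 4 -> cmod (g (w + h) - g w - Lim h) <= B * vnorm h ^+ 2.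
  move=> hr; apply/ler_addgt0Pr => eps eps0.
  have A0 : 0 <= 2 * c + T * vnorm h by rewrite addr_ge0 ?mulr_ge0 ?vnorm_ge0.
  have [k Hk] := half_expr_lt eps0 A0.
  have bs i : vnorm i < r -> cmod (gs k (w + i)) <= M + c.
    move=> ir; have := gsg k i ir; rewrite -/(e k) => h1.
    have := emono 0%N k (leq0n k); rewrite {2}/e expr0 mulr1 => h2.
    have -> : gs k (w + i) = g (w + i) + (gs k (w + i) - g (w + i)) by ring.
    by have := bg i ir; have := cmodD (g (w + i)) (gs k (w + i) - g (w + i)); lra.
  have H := Lq k h _ bs hr; rewrite -/B in H.
  have h1 := gsg k h (small h hr); have h2 := gsg k 0 zr; rewrite addr0 in h2.
  have h3 := Llim k h.
  have -> : g (w + h) - g w - Lim h = (gs k (w + h) - gs k w - L k h)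
    + (- (gs k (w + h) - g (w + h)) + ((gs k w - g w) + (L k h - Lim h))) by ring.
  set x1 := gs k (w + h) - gs k w - L k h in H *.
  set x2 := gs k (w + h) - g (w + h) in h1 *.
  set x3 := gs k w - g w in h2 *; set x4 := L k h - Lim h in h3 *.
  have := cmodD x1 (- x2 + (x3 + x4)); have := cmodD (- x2) (x3 + x4).
  have := cmodD x3 x4; rewrite cmodN; lra.
apply: (@vapprox_differentiable g w l) => eps eps0.
exists (Num.min (r / 4) (eps / (B + 1))) => [|h].
  by rewrite lt_min !divr_gt0 //; lra.
rewrite lt_min [_ < eps / _]ltr_pdivlMr; last by lra.
move=> /andP[/ltW h1 h2]; apply: le_trans (main h h1) _.
by rewrite expr2 mulrA ler_wpM2r ?vnorm_ge0 //; have := vnorm_ge0 h; nra.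
Qed.

End SeveralVariables.

Definition diff_quotient (K : numFieldType) (V : normedModType K) (f : V -> K)
  (a : V) (s : K) (z : V) : K := (f (z + a) - f z) / s.

Lemma differentiable_diff_quotient (K : numFieldType) (V : normedModType K)
    (f : V -> K) (a : V) (s : K) (z : V) :
  differentiable f z -> differentiable f (z + a) ->
  differentiable (diff_quotient f a s) z.
Proof.
move=> df dfa.
have -> : diff_quotient f a s = s^-1 *: ((f \o shift a) - f).
  by rewrite funeqE => w; rewrite /diff_quotient mulrC.
apply: differentiableZ; apply: differentiableB => //.
by apply: differentiable_comp => //; apply: differentiableD.
Qed.

Section SeveralVariables.
Variables (R : realType) (m : nat).
Local Notation K := (complex_complex__canonical__Num_NumField R).
Local Notation C := (Num.NumField.sort K).
Local Notation V := 'rV[C]_m.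
Implicit Types (f g : V -> C) (v w z h : V).

Lemma cmod_split2 (x y : R[i]) : cmod y <= cmod x + cmod (x - y).
Proof. by rewrite -{1}(subKr x y) cmodB. Qed.

Lemma cmod_split3 (x y z : R[i]) :
  cmod x <= cmod (x - y - z) + (cmod y + cmod z).
Proof.
have -> : x = (x - y - z) + (y + z) by ring.
apply: le_trans (cmodD _ _) _.
have -> : x - y - z + (y + z) - y - z = x - y - z by ring.
by rewrite lerD2l cmodD.
Qed.

Lemma cmod_quotient (x y d s : R[i]) : s != 0 ->
  cmod ((x - y) / s - d) = cmod (x - y - s * d) / cmod s.
Proof. by move=> s0; rewrite -cmodV -cmodM; congr cmod; field. Qed.

(** The difference quotients along s_i a, with s_i halved at each step, are differentiable near 0
    and converge there uniformly to the derivative, by the quadratic remainder. *)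
Theorem holo_germ_derive f (j : 'I_m) :
  holo_germ f -> holo_germ (fun z => 'D_(delta_mx 0 j) f z).
Proof.
move=> hf; set a : V := delta_mx 0 j.
have near_r (P : V -> Prop) : (\forall z \near (0 : V), P z) ->
    exists2 r : R, 0 < r & forall z, vnorm z < r -> P z.
  move=> /nbhs_normP[r r0 Hr].
  have rE := posC_real r0.
  exists (complex.Re r) => [|z zr]; first by rewrite -ltcR -rE.
  by apply: Hr; rewrite /= sub0r normrN vnormE rE ltcR.
have [r1 r10 df] := near_r _ hf.
have f0 : differentiable f 0 by apply: df; rewrite vnorm0.
have [r2 r20 bf] := differentiable_vapprox f0 (ltr01 : 0 < (1 : R)).
have [kc K0 HK] := linear_lipschitz (f := 'd f 0) (diff_continuous f0).
pose k := complex.Re kc.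
have KE : kc = k%:C := posC_real K0.
have k0 : 0 < k by rewrite -ltcR -KE.
pose r := Num.min (Num.min r1 r2) 1 / 2.
have [r0 [rr1 rr2 rr3]] : 0 < r /\ [/\ 2 * r <= r1, 2 * r <= r2 & 2 * r <= 1].
  have h1 : Num.min (Num.min r1 r2) 1 <= r1 by rewrite !ge_min lexx.
  have h2 : Num.min (Num.min r1 r2) 1 <= r2 by rewrite !ge_min lexx orbT.
  have h3 : Num.min (Num.min r1 r2) 1 <= 1 by rewrite !ge_min lexx orbT.
  split; last by split; rewrite /r; lra.
  by rewrite divr_gt0 // !lt_min r10 r20 ltr01.
clearbody r.
(* Differentiability at 0 bounds f on a ball of radius at most 1: k is a Lipschitz constant of the
   differential and 1 the error constant. *)
pose M := cmod (f 0) + k + 1.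
have M0 : 0 <= M by rewrite /M; have := cmod_ge0 (f 0); lra.
have bM z : vnorm z < 2 * r -> cmod (f z) <= M.
  move=> zr; have := bf z (lt_le_trans zr rr2); rewrite add0r mul1r => h1.
  have h2 : cmod ('d f 0 z) <= k * vnorm z.
    by rewrite -lecR rmorphM /= -KE -vnormE -normC_cmod.
  have h3 := cmod_split3 (f z) (f 0) ('d f 0 z).
  have h4 := lerD h1 (lerD (lexx (cmod (f 0))) h2).
  apply: le_trans h3 (le_trans h4 _).
  by have := vnorm_ge0 z; rewrite /M; nra.
have quad z h : vnorm z < r -> vnorm h <= r / 4 ->
    cmod (f (z + h) - f z - 'd f z h) <= 48 * M / r ^+ 2 * vnorm h ^+ 2.
  move=> zr; apply: (@quadratic_remainder_vec _ _ f z r M r0) => i ir.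
    by apply: df; have := vnormD z i; lra.
  by apply: bM; have := vnormD z i; lra.
pose s k : C := (r / 4 / (vnorm a + 1) * 2^-1 ^+ k)%:C.
have a0 := vnorm_ge0 a.
have p0 : 0 < r / 4 / (vnorm a + 1) by rewrite !divr_gt0 //; lra.
have cs i : cmod (s i) = r / 4 / (vnorm a + 1) * 2^-1 ^+ i.
  by rewrite cmod_real ger0_norm // mulr_ge0 ?exprn_ge0 // ltW.
have s0 i : 0 < cmod (s i) by rewrite cs mulr_gt0 // exprn_gt0.
have sn0 i : s i != 0 by apply: contraTneq (s0 i) => ->; rewrite cmod0 ltxx.
have i1 i : (2^-1 : R) ^+ i <= 1 by rewrite exprn_ile1 //; lra.
have sa i : vnorm (s i *: a) <= r / 4.
  rewrite vnormZ cs mulrAC.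
  apply: (@le_trans _ _ (r / 4 / (vnorm a + 1) * vnorm a)).
    by rewrite ler_piMr // mulr_ge0 // ltW.
  by rewrite mulrAC ler_pdivrMr; nra.
pose gs i : V -> C := diff_quotient f (s i *: a) (s i).
have gE z : vnorm z < 2 * r -> 'D_a f z = 'd f z a.
  move=> zr; have dz : differentiable f z by apply: df; lra.
  exact: (deriveE a dz).
(* The remainder divided by |s_i| is 48 M / r^2 |s_i| |a|^2, and |a|^2 / (|a| + 1) <= |a|. *)
pose c0 := 48 * M / r ^+ 2 * (r / 4 * (vnorm a)).
have c00 : 0 <= c0.
  by rewrite mulr_ge0 ?divr_ge0 ?sqr_ge0 ?mulr_ge0 //; lra.
have close i z : vnorm z < r -> cmod (gs i z - 'D_a f z) <= c0 * 2^-1 ^+ i.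
  move=> zr; rewrite gE; last by lra.
  have := quad z _ zr (sa i); rewrite linearZ => H.
  rewrite (cmod_quotient _ _ _ (sn0 i)) ler_pdivrMr //; apply: le_trans H _.
  rewrite /c0 -!mulrA ler_wpM2l // ler_wpM2l // ler_wpM2l ?invr_ge0 ?sqr_ge0 //.
  rewrite vnormZ exprMn cs; set x := 2^-1 ^+ i; set n := vnorm a.
  set y := (X in _ <= X).
  have n1 : n + 1 != 0 by rewrite gt_eqF // /n; lra.
  have -> : (r / 4 / (n + 1) * x) ^+ 2 * n ^+ 2 = y * (n / (n + 1)).
    by rewrite /y; field.
  rewrite ler_piMr //; last by rewrite ler_pdivrMr /n; lra.
  by rewrite /y /x !mulr_ge0 ?exprn_ge0 ?invr_ge0 // ?/n; lra.
have dgs i z : vnorm z < r -> differentiable (gs i) z.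
  move=> zr; apply: differentiable_diff_quotient; first by apply: df; lra.
  by apply: df; have := vnormD z (s i *: a); have := sa i; lra.
have bg z : vnorm z < r -> cmod ('D_a f z) <= 2 * M / cmod (s 0%N) + c0.
  move=> zr; have := close 0%N z zr; rewrite expr0 mulr1 => h1.
  have h2 : cmod (gs 0%N z) <= 2 * M / cmod (s 0%N).
    rewrite cmodM cmodV ler_wpM2r ?invr_ge0 ?cmod_ge0 //.
    have b1 : cmod (f z) <= M by apply: bM; lra.
    have b2 : cmod (f (z + s 0%N *: a)) <= M.
      by apply: bM; have := vnormD z (s 0%N *: a); have := sa 0%N; lra.
    by have := cmodB (f (z + s 0%N *: a)) (f z); lra.
  by apply: le_trans (cmod_split2 (gs 0%N z) _) (lerD h2 h1).
apply/nbhs_normP; exists ((r / 2)%:C); first by rewrite /= ltcR; lra.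
move=> z /=; rewrite sub0r normrN vnormE ltcR => zr.
have in_r h : vnorm h < r / 2 -> vnorm (z + h) < r.
  by move=> hr; have := vnormD z h; lra.
have r20' : 0 < r / 2 by lra.
have H1 i h (hr : vnorm h < r / 2) := dgs i (z + h) (in_r h hr).
have H2 h (hr : vnorm h < r / 2) := bg (z + h) (in_r h hr).
have H3 i h (hr : vnorm h < r / 2) := close i (z + h) (in_r h hr).
exact: (uniform_limit_differentiable r20' c00 H1 H2 H3).
Qed.

End SeveralVariables.

End ComplexAnalysis.

(** * The ring of germs *)

Section HolomorphicFunctions.
Variables (K : numFieldType) (m : nat).
Local Notation V := 'rV[K]_m.
Implicit Types f g : V -> K.

Lemma holo_cst (c : K) : holo_germ (fun _ : V => c).
Proof. by near=> z; apply: differentiable_cst. Unshelve. all: by end_near. Qed.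

Lemma holo_coord (j : 'I_m) : holo_germ (fun z : V => z 0 j).
Proof. by near=> z; apply: differentiable_coord. Unshelve. all: by end_near. Qed.

Lemma holoD f g : holo_germ f -> holo_germ g -> holo_germ (fun z => f z + g z).
Proof.
by move=> hf hg; near=> z; apply: differentiableD; near: z.
Unshelve. all: by end_near. Qed.

Lemma holoM f g : holo_germ f -> holo_germ g -> holo_germ (fun z => f z * g z).
Proof.
by move=> hf hg; near=> z; apply: differentiableM; near: z.
Unshelve. all: by end_near. Qed.

Definition holo : {pred V -> K} := fun f => `[< holo_germ f >].

Lemma holo_subring : subring_closed holo.
Proof.
split=> [|f g /asboolP hf /asboolP hg|f g /asboolP hf /asboolP hg]; apply/asboolP.
- exact: holo_cst.
- apply: holoD => //; have -> : - g = (fun z => -1 * g z).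
    by apply/funext => z; rewrite mulN1r.
  by apply: holoM => //; apply: holo_cst.
- exact: holoM.
Qed.

HB.instance Definition _ := GRing.isSubringClosed.Build (V -> K) holo holo_subring.

(** An intermediate ring before germs: on it evaluation at every point is a ring morphism ([hev]),
    and germs get their ring structure as a quotient. *)
Record holo_fun := HoloFun { hfun :> V -> K; hfunP : hfun \in holo }.
HB.instance Definition _ := [isSub for hfun].
HB.instance Definition _ := [Choice of holo_fun by <:].
HB.instance Definition _ := [SubChoice_isSubComNzRing of holo_fun by <:].

Definition vanishing : {pred holo_fun} :=
  fun F => `[< \forall z \near (0 : V), hfun F z = 0 >].

Lemma vanishing_idealr : idealr_closed vanishing.
Proof.
split=> [||a u v /asboolP hu /asboolP hv].
- by apply/asboolP; near=> z.
- apply/asboolP => /nbhs_singleton /= /eqP.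
  by rewrite oner_eq0.
- apply/asboolP; near=> z.
  have -> : hfun (a * u + v) z = hfun a z * hfun u z + hfun v z by [].
  have -> : hfun u z = 0 by near: z.
  have -> : hfun v z = 0 by near: z.
  by rewrite mulr0 addr0.
Unshelve. all: by end_near. Qed.

HB.instance Definition _ := isIdealr.Build holo_fun vanishing vanishing_idealr.

Definition germ := {ideal_quot vanishing}.

End HolomorphicFunctions.

Section GermRing.
Variables (K : numFieldType) (m : nat).
Local Notation V := 'rV[K]_m.
Local Notation H := (holo_fun K m).
Local Notation A := (germ K m).
Implicit Types (F G : H) (f g : V -> K).

Definition hev (z : V) (F : H) : K := hfun F z.
Lemma hev_zmod z : zmod_morphism (hev z). Proof. by []. Qed.
Lemma hev_monoid z : monoid_morphism (hev z). Proof. by []. Qed.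
HB.instance Definition _ z := GRing.isZmodMorphism.Build H K (hev z) (hev_zmod z).
HB.instance Definition _ z := GRing.isMonoidMorphism.Build H K (hev z) (hev_monoid z).

Definition hcst (c : K) : H := HoloFun (asboolT (@holo_cst K m c)).
Lemma hcst_zmod : zmod_morphism hcst. Proof. by move=> x y; apply: val_inj. Qed.
Lemma hcst_monoid : monoid_morphism hcst.
Proof. by split=> [|x y]; apply: val_inj. Qed.
HB.instance Definition _ := GRing.isZmodMorphism.Build K H hcst hcst_zmod.
HB.instance Definition _ := GRing.isMonoidMorphism.Build K H hcst hcst_monoid.

Definition hcoord (j : 'I_m) : H := HoloFun (asboolT (@holo_coord K m j)).

Definition cls (F : H) : A := (\pi_A F)%qT.
Lemma cls_zmod : zmod_morphism cls. Proof. exact: rmorphB. Qed.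
Lemma cls_monoid : monoid_morphism cls.
Proof. by split; [exact: rmorph1 | exact: rmorphM]. Qed.
HB.instance Definition _ := GRing.isZmodMorphism.Build H A cls cls_zmod.
HB.instance Definition _ := GRing.isMonoidMorphism.Build H A cls cls_monoid.

Definition rep (x : A) : H := repr x.
Lemma repK x : cls (rep x) = x. Proof. exact: reprK. Qed.

Lemma cls_eq F G : cls F = cls G <-> \forall z \near (0 : V), hfun F z = hfun G z.
Proof.
have -> : (cls F = cls G) <-> F - G \in @vanishing K m.
  by split=> [/eqP|h]; [|apply/eqP]; rewrite -Quotient.idealrBE.
split=> [/asboolP|] h; last apply/asboolP; near=> z.
  by apply/eqP; rewrite -subr_eq0; apply/eqP; near: z.
by apply/eqP; rewrite subr_eq0; apply/eqP; near: z.
Unshelve. all: by end_near. Qed.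

(** The dictionary from ideals of the ring of germs to the sets of functions used in the
    statement. *)
Definition reps (J : A -> Prop) : set (V -> K) :=
  [set f | exists2 F : H, J (cls F) & \forall z \near (0 : V), f z = F z].

Lemma ideal_gen_near (G : set (V -> K)) f g : (\forall z \near (0 : V), f z = g z) ->
  ideal_gen G g -> ideal_gen G f.
Proof.
move=> fg [p [h [k [hh Gk e]]]]; exists p, h, k; split=> //.
by near=> z; transitivity (g z); near: z.
Unshelve. all: by end_near. Qed.

Lemma ideal_gen_incl (G : set (V -> K)) f : G f -> ideal_gen G f.
Proof.
move=> Gf; exists 1%N, (fun _ _ => 1), (fun=> f); split=> // [_|].
  exact: holo_cst.
by near=> z; rewrite big_ord1 mul1r.
Unshelve. all: by end_near. Qed.

Lemma ideal_gen_is_ideal (G : set (V -> K)) :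
  is_ideal (fun x : A => ideal_gen G (rep x)).
Proof.
split.
- exists 0%N, (fun _ _ => 0), (fun _ _ => 0); split=> [i|i|]; [exact: holo_cst|by case: i|].
  have /cls_eq : cls (rep 0) = cls 0 by rewrite repK rmorph0.
  by apply: filterS => z ->; rewrite big_ord0.
- move=> x y [p [h [k [hh Gk e]]]] [p' [h' [k' [hh' Gk' e']]]].
  exists (p + p')%N, (fun i => match fintype.split i with inl i => h i | inr i => h' i end),
    (fun i => match fintype.split i with inl i => k i | inr i => k' i end).
  split=> [i|i|]; [case: (fintype.split i); [exact: hh|exact: hh'] |
    case: (fintype.split i); [exact: Gk|exact: Gk'] |].
  have /cls_eq xy : cls (rep (x + y)) = cls (rep x + rep y) by rewrite rmorphD /= !repK.
  near=> z; transitivity (hfun (rep x) z + hfun (rep y) z); first by near: z.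
  rewrite big_split_ord /=; congr (_ + _).
    transitivity (\sum_(i < p) h i z * k i z); first by near: z.
    by apply: eq_bigr => i _; rewrite (unsplitK (inl i : 'I_p + 'I_p')).
  transitivity (\sum_(i < p') h' i z * k' i z); first by near: z.
  by apply: eq_bigr => i _; rewrite (unsplitK (inr i : 'I_p + 'I_p')).
- move=> a x [p [h [k [hh Gk e]]]].
  exists p, (fun i z => hfun (rep a) z * h i z), k; split=> // [i|].
    by apply: holoM => //; apply/asboolP/hfunP.
  have /cls_eq ax : cls (rep (a * x)) = cls (rep a * rep x) by rewrite rmorphM /= !repK.
  near=> z; transitivity (hfun (rep a) z * hfun (rep x) z); first by near: z.
  transitivity (hfun (rep a) z * (\sum_(i < p) h i z * k i z)).
    by congr (_ * _); near: z.
  by rewrite mulr_sumr; apply: eq_bigr => i _; rewrite mulrA.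
Unshelve. all: by end_near. Qed.

Lemma ideal_gen_reps (G : set (V -> K)) (GA : A -> Prop) :
  (forall f, G f -> reps (idl GA) f) ->
  (forall F, GA (cls F) -> ideal_gen G F) ->
  ideal_gen G = reps (idl GA).
Proof.
move=> G1 G2; apply/seteqP; split=> [f [p [h [k [hh Gk e]]]]|f [F JF e]].
  have /choice[kF kFP] : forall i, exists F : H, idl GA (cls F) /\
      \forall z \near (0 : V), k i z = F z.
    by move=> i; have [F ? ?] := G1 _ (Gk i); exists F.
  pose hF i := HoloFun (asboolT (hh i)).
  exists (\sum_i hF i * kF i).
    rewrite rmorph_sum; apply: ideal_sum => [|i _]; first exact: idl_ideal.
    by rewrite rmorphM /=; apply: (idealM (idl_ideal GA)); have [] := kFP i.
  have ek : \forall z \near (0 : V), forall i, k i z = kF i z.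
    apply: (@filter_forall V 'I_p (fun i z => k i z = kF i z) (nbhs (0 : V)) _) => i.
    by have [] := kFP i.
  near=> z; transitivity (\sum_(i < p) h i z * k i z); first by near: z.
  rewrite -[RHS]/(hev z _) rmorph_sum; apply: eq_bigr => i _.
  by rewrite rmorphM; congr (_ * _); rewrite -[RHS]/(hfun (kF i) z); move: i; near: z.
apply: (ideal_gen_near e).
have : ideal_gen G (rep (cls F)).
  apply: idl_min (ideal_gen_is_ideal G) _ _ JF => x GAx.
  by apply: G2; rewrite repK.
by apply: ideal_gen_near; apply/cls_eq; rewrite repK.
Unshelve. all: by end_near. Qed.

Section Derivations.
(** Discharged over R[i] by [holo_germ_derive]; the algebra of germs itself is done over any
    [numFieldType]. *)
Hypothesis holo_derive : forall f (j : 'I_m),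
  holo_germ f -> holo_germ (fun z => 'D_(delta_mx 0 j) f z).

Definition hder (j : 'I_m) (F : H) : H :=
  HoloFun (asboolT (holo_derive j (asboolP _ (hfunP F)))).

Lemma near_derive f g (j : 'I_m) : (\forall z \near (0 : V), f z = g z) ->
  \forall z \near (0 : V), 'D_(delta_mx 0 j) f z = 'D_(delta_mx 0 j) g z.
Proof.
by move=> /nbhs_interior; apply: filterS => z fg; apply: near_eq_derive.
Qed.

Definition gder (j : 'I_m) (x : A) : A := cls (hder j (rep x)).

Lemma gder_cls j F : gder j (cls F) = cls (hder j F).
Proof. by apply/cls_eq/near_derive/cls_eq; rewrite repK. Qed.

Lemma hfun_derivable F (j : 'I_m) :
  \forall z \near (0 : V), derivable (hfun F) z (delta_mx 0 j).
Proof.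
by have /asboolP := hfunP F; apply: filterS => z; apply: diff_derivable.
Qed.

Lemma gder_is_der j : is_der (gder j).
Proof.
split=> x y; rewrite -(repK x) -(repK y).
  rewrite -rmorphD !gder_cls -rmorphD; apply/cls_eq.
  move: (hfun_derivable (rep x) j) (hfun_derivable (rep y) j).
  by apply: filterS2 => z dx dy; exact: (deriveD dx dy).
rewrite -rmorphM !gder_cls -!rmorphM -rmorphD; apply/cls_eq.
move: (hfun_derivable (rep x) j) (hfun_derivable (rep y) j).
apply: filterS2 => z dx dy.
by rewrite [LHS](deriveM dx dy) addrC; congr (_ + _); exact: mulrC.
Qed.

Lemma gder_coord i j : gder j (cls (hcoord i)) = (i == j)%:R.
Proof.
rewrite gder_cls; have -> : (i == j)%:R = cls (hcst (i == j)%:R) by rewrite !rmorph_nat.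
apply/cls_eq; near=> z.
apply: cvg_lim => //; apply: cvg_near_cst; near=> h.
have h0 : h != 0 by near: h; exact: nbhs_dnbhs_neq.
rewrite /= !mxE eqxx addrK.
by rewrite -[_ *: _]/(_ * _) mulKf.
Unshelve. all: by end_near. Qed.

Lemma germ_nat k : exists c : A, c * k.+1%:R = 1.
Proof.
exists (cls (hcst k.+1%:R^-1)).
rewrite -(rmorph_nat cls) -(rmorph_nat hcst) -rmorphM -rmorphM mulVf ?pnatr_eq0 //.
by rewrite !rmorph1.
Qed.

Lemma hev_det k (M : 'M[H]_k) z : hfun (\det M) z = \det (\matrix_(i, j) hfun (M i j) z).
Proof.
rewrite -[LHS]/(hev z _) -det_map_mx; congr (\det _).
by apply/matrixP => i j; rewrite !mxE.
Qed.

(** Near 0 the derivatives of a function depend only on its germ, and a minor has finitely many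
    entries, so a common neighbourhood exists. *)
Lemma Delta_sub_reps k (J : A -> Prop) : is_ideal J ->
  Delta_sub k (reps J) = reps (DeltaA gder k J).
Proof.
move=> iJ; apply: ideal_gen_reps => [f [Jf|]|F].
- by have [F JF e] := Jf; exists F => //; apply: idl_gen; left.
- move=> [p [F [rho [kap [JF hrho hkap ->]]]]].
  have /choice[G GP] : forall i, exists G : H, J (cls G) /\
      \forall z \near (0 : V), F i z = G z.
    by move=> i; have [G ? ?] := JF i; exists G.
  exists (\det (\matrix_(i, j) hder (kap j) (G (rho i)))).
    apply: idl_gen; right; exists p, (cls \o G), rho, kap; split=> // [i|].
      by have [] := GP i.
    rewrite -det_map_mx; congr (\det _); apply/matrixP => i j.
    by rewrite !mxE /= gder_cls.
  have eD : \forall z \near (0 : V), forall ij : 'I_k * 'I_k,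
      'D_(delta_mx 0 (kap ij.2)) (F (rho ij.1)) z = hder (kap ij.2) (G (rho ij.1)) z.
    apply: (@filter_forall V ('I_k * 'I_k)%type (fun ij z =>
      'D_(delta_mx 0 (kap ij.2)) (F (rho ij.1)) z = hder (kap ij.2) (G (rho ij.1)) z)
      (nbhs (0 : V)) _).
    by move=> [i j]; apply: near_derive; have [] := GP (rho i).
  near=> z; rewrite hev_det; congr (\det _); apply/matrixP => i j; rewrite !mxE.
  suff h : forall ij : 'I_k * 'I_k, 'D_(delta_mx 0 (kap ij.2)) (F (rho ij.1)) z =
      hder (kap ij.2) (G (rho ij.1)) z by exact: (h (i, j)).
  by near: z.
- case=> [JF|[p [G [rho [kap [JG hrho hkap e]]]]]].
    by apply: ideal_gen_incl; left; exists F => //; near=> z.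
  pose f z := \det (mxsub rho kap (jac (fun i => hfun (rep (G i))) z)).
  apply: (@ideal_gen_near _ _ f); last first.
    apply: ideal_gen_incl; right; exists p, (fun i => hfun (rep (G i))), rho, kap.
    split=> // i; exists (rep (G i)); first by rewrite repK.
    by near=> z.
  have : cls F = cls (\det (\matrix_(i, j) hder (kap j) (rep (G (rho i))))).
    by rewrite e -det_map_mx; congr (\det _); apply/matrixP => i j; rewrite !mxE.
  move=> /cls_eq; apply: filterS => z ->; rewrite hev_det; congr (\det _).
  by apply/matrixP => i j; rewrite !mxE.
Unshelve. all: by end_near. Qed.

End Derivations.

End GermRing.

(** * The theorem *)

Lemma gamma_quo (K : numFieldType) (n r : nat) (z : 'rV[K]_(n + r)) (i : nat) :
  (0 < r)%N -> (r <= n)%N -> (i < n %% r)%N ->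
  gamma z (n - n %% r + i) = (quo (fpoly z) (gpoly z) (n %/ r))`_i.
Proof. by case: n z => [|n'] z; [case: r z | apply: gamma_quoS]. Qed.

(** * The generators of the statement as germs *)

Section Generators.
Import Pdiv.CommonRing Pdiv.RingMonic.
Variables (K : numFieldType) (n r : nat).
Hypotheses (r0 : (0 < r)%N) (rn : (r <= n)%N).
Local Notation m := (n + r)%N.
Local Notation V := 'rV[K]_m.
Local Notation H := (holo_fun K m).
Local Notation A := (germ K m).
Local Notation c := (@hcst K m).
Local Notation q1 := (n %/ r)%N.
Local Notation r1 := (n %% r)%N.
Hypothesis r10 : (0 < r1)%N.

Definition fH : {poly H} := PsiTheory.fB (@hcoord K m).
Definition gH : {poly H} := PsiTheory.gB (@hcoord K m).
Definition hH : {poly H} := quo fH gH q1.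

Lemma hev_fH z : map_poly (hev z) fH = fpoly z.
Proof.
rewrite map_monic_of; congr (_ + _); apply: eq_poly => i iN /=.
by rewrite /acoef /vnth insubT !mxE.
Qed.

Lemma hev_gH z : map_poly (hev z) gH = gpoly z.
Proof.
rewrite map_monic_of; congr (_ + _); apply: eq_poly => i iN /=.
by rewrite /bcoef /vnth insubT !mxE.
Qed.

Lemma fH_monic : fH \is monic. Proof. exact: monic_of_monic. Qed.
Lemma gH_monic : gH \is monic. Proof. exact: monic_of_monic. Qed.
Lemma size_fH : size fH = n.+1. Proof. exact: size_monic_of. Qed.
Lemma size_gH : size gH = r.+1. Proof. exact: size_monic_of. Qed.

Lemma hH_monic : hH \is monic /\ size hH = r1.+1.
Proof.
have [-> ->] := quo_monic fH_monic gH_monic size_fH size_gH (leq_divM n r).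
by rewrite {1}(divn_eq n r) addKn.
Qed.

Definition fA : {poly A} := map_poly (@cls K m) fH.
Definition gA : {poly A} := map_poly (@cls K m) gH.

Lemma fA_monic : fA \is monic. Proof. exact: (monic_map _ fH_monic). Qed.
Lemma gA_monic : gA \is monic. Proof. exact: (monic_map _ gH_monic). Qed.
Lemma size_fA : size fA = n.+1.
Proof. by rewrite /fA map_monic_of size_monic_of. Qed.
Lemma size_gA : size gA = r.+1.
Proof. by rewrite /gA map_monic_of size_monic_of. Qed.

Definition JA : A -> Prop := idl (gens [::] fA gA 0 0 m).

Lemma Imu_reps : Imu K n r = reps JA.
Proof.
have fgE j : (fA * gA)`_j = cls (fH * gH)`_j by rewrite -rmorphM coef_map.
have ccE j z : ccoef j z = hev z (fH * gH)`_j.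
  by rewrite -coef_map rmorphM /= hev_fH hev_gH.
apply: ideal_gen_reps => [_ [j jm <-]|F].
  exists (fH * gH)`_j; last by near=> z; rewrite ccE.
  apply: idl_gen; right; exists j.
  by rewrite !expr1 coefB coefXn ltn_eqF // subr0 fgE.
case=> [//|[j]]; rewrite !expr1 coefB coefXn => e.
have [jm|mj] := ltnP j m.
  move: e; rewrite ltn_eqF // subr0 fgE => /cls_eq e.
  apply: (ideal_gen_near (g := ccoef j)); last by apply: ideal_gen_incl; exists j.
  by move: e; apply: filterS => z; rewrite ccE.
(* For j >= m the generator is zero: f g is monic of degree m and x^m removes its leading term. *)
have sfg : size (fA * gA) = m.+1.
  rewrite size_Mmonic ?fA_monic ?gA_monic // ?size_fA ?size_gA ?addnS //.
  by rewrite -size_poly_gt0 size_fA.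
have : cls F = cls 0.
  rewrite e rmorph0; move: mj; rewrite leq_eqVlt => /orP[/eqP <-|mj].
    have : lead_coef (fA * gA) = 1 by apply/monicP; rewrite monicMl ?fA_monic ?gA_monic.
    by rewrite lead_coefE sfg /= => ->; rewrite eqxx subrr.
  by rewrite gtn_eqF // subr0 nth_default // sfg.
move=> /cls_eq e0; apply: (ideal_gen_near e0); exists 0%N, (fun _ _ => 0), (fun _ _ => 0).
split=> [[]//|[]//|]; by near=> z; rewrite big_ord0.
Unshelve. all: by end_near. Qed.

Section Derivations.
Hypothesis holo_derive : forall (f : V -> K) (j : 'I_m),
  holo_germ f -> holo_germ (fun z => 'D_(delta_mx 0 j) f z).
Local Notation D := (gder holo_derive).

(** The coordinates are the coefficients of f and g, so the field wanted has those of dP and dQ as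
    components. *)
Lemma coordinate_chart : chart D [::] n r fA gA.
Proof.
split; [exact: fA_monic|exact: gA_monic|exact: size_fA|exact: size_gA|].
move=> eta dP dQ sP sQ.
pose w (j : 'I_m) := match fintype.split j with inl i => dP`_i | inr i => dQ`_i end.
have dw := vfield_der (gder_is_der holo_derive) w.
have wX j : vfield D w (cls (@hcoord K m j)) = w j.
  rewrite /vfield (bigD1 j) //= gder_coord eqxx mulr1 big1 ?addr0 // => i nij.
  by rewrite gder_coord eq_sym (negPf nij) mulr0.
exists w; split=> //; apply/polyP => i; rewrite coef_dpoly ?der0 //.
  rewrite /fA map_monic_of coef_monic_of /=; case: ltnP => iN.
    rewrite /vnth insubT !mxE wX /w.
    by rewrite (unsplitK (inl (Ordinal iN) : 'I_n + 'I_r)).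
  rewrite [RHS]nth_default ?(leq_trans sP) //.
  by case: eqP => _; rewrite ?der1 ?der0.
rewrite /gA map_monic_of coef_monic_of /=; case: ltnP => iN.
  rewrite /vnth insubT !mxE wX /w.
  by rewrite (unsplitK (inr (Ordinal iN) : 'I_n + 'I_r)).
rewrite [RHS]nth_default ?(leq_trans sQ) //.
by case: eqP => _; rewrite ?der1 ?der0.
Qed.

Lemma iter_Delta_reps k s (J : A -> Prop) : is_ideal J ->
  iter s (@Delta_sup K m k) (reps J) = reps (iter s (DeltaA D (m - k + 1)) J) /\
  is_ideal (iter s (DeltaA D (m - k + 1)) J).
Proof.
move=> iJ; elim: s => [|s [IH iI]] //; rewrite !iterS IH; split.
  exact: Delta_sub_reps.
exact: DeltaA_ideal.
Qed.

End Derivations.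

Definition psiH j : H := PsiTheory.PsiB c (@hcoord K m) j.

(** The substitution for phi: the b's for u and the coefficients of h for v. The latter take the
    values gamma at each point, by [gamma_quo]. *)
Definition phi_coord (i : 'I_(r + r1)) : H :=
  match fintype.split i with inl j => hcoord K (rshift n j) | inr j => hH`_j end.

Definition phiH j : H := PsiTheory.PsiB c phi_coord j.

Lemma hev_psiH j z : hev z (psiH j) = psi j z.
Proof.
rewrite /psiH PsiTheory.PsiB_at //; congr (MPsi.Psi_at _ j).
by apply/rowP => i; rewrite mxE.
Qed.

Lemma hev_phiH j z : hev z (phiH j) = phi j z.
Proof.
rewrite /phiH PsiTheory.PsiB_at //; congr (MPsi.Psi_at _ j).
apply/rowP => i; rewrite !mxE /phi_coord.
case: (fintype.split i) => k; rewrite !mxE // gamma_quo //.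
by rewrite -hev_fH -hev_gH -(map_quo _ _ _ gH_monic) coef_map.
Qed.

Lemma fB_phi : PsiTheory.fB phi_coord = gH.
Proof.
congr (_ + _); apply: eq_poly => i ir; rewrite /vnth !insubT !mxE.
by rewrite /phi_coord (unsplitK (inl (Ordinal ir) : 'I_r + 'I_r1)).
Qed.

Lemma gB_phi : PsiTheory.gB phi_coord = hH.
Proof.
have [hm sh] := hH_monic; apply/polyP => i; rewrite coef_monic_of.
case: ltnP => ir.
  rewrite /vnth insubT !mxE.
  by rewrite /phi_coord (unsplitK (inr (Ordinal ir) : 'I_r + 'I_r1)).
move: ir; rewrite leq_eqVlt => /orP[/eqP <-|ir].
  by rewrite eqxx; move/monicP: hm; rewrite lead_coefE sh.
by rewrite gtn_eqF // nth_default // sh.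
Qed.

Definition psiA k (x : A) := exists2 y, (exists2 j, (j < k)%N & y = psiH j) & x = cls y.
Definition phiA k (x : A) := exists2 y, (exists2 j, (j < k)%N & y = phiH j) & x = cls y.

Lemma ideal_gen_psi_phi k l :
  ideal_gen (Imu K n r `|` psi_phi K n r k l) =
  reps (idl (fun x => (JA x \/ psiA k x) \/ phiA l x)).
Proof.
apply: ideal_gen_reps => [f [If|[[j /= jk <-]|[j /= jl <-]]]|F [[JF|]|]].
- by move: If; rewrite Imu_reps => -[F JF e]; exists F => //; apply: idl_gen; do 2 left.
- exists (psiH j); last by near=> z; rewrite -hev_psiH.
  by apply: idl_gen; left; right; exists (psiH j) => //; exists j.
- exists (phiH j); last by near=> z; rewrite -hev_phiH.
  by apply: idl_gen; right; exists (phiH j) => //; exists j.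
- by apply: ideal_gen_incl; left; rewrite Imu_reps; exists F => //; near=> z.
- move=> [_ [j jk ->] /cls_eq e]; apply: (ideal_gen_near (g := psi j)).
    by move: e; apply: filterS => z ->; rewrite -hev_psiH.
  by apply: ideal_gen_incl; right; left; exists j.
- move=> [_ [j jk ->] /cls_eq e]; apply: (ideal_gen_near (g := phi j)).
    by move: e; apply: filterS => z ->; rewrite -hev_phiH.
  by apply: ideal_gen_incl; right; right; exists j.
Unshelve. all: by end_near. Qed.

Lemma idl_psiA : idl (psiA (q1 * r)) = idl (rems fA gA r q1).
Proof.
rewrite -(image_rems _ _ _ _ gH_monic); apply: idl_image.
exact: PsiTheory.idl_PsiB.
Qed.

Let hA := quo fA gA q1.

Lemma map_hH : map_poly (@cls K m) hH = hA.
Proof. by rewrite map_quo // gH_monic. Qed.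

Lemma idl_phiA s : (s <= r %/ r1)%N -> idl (phiA (s * r1)) = idl (rems gA hA r1 s).
Proof.
move=> sq; have [hm _] := hH_monic; rewrite -map_hH -(image_rems _ _ _ _ hm).
apply: idl_image; rewrite -fB_phi -gB_phi; apply: PsiTheory.idl_PsiB => //.
by rewrite ltnW // ltn_mod.
Qed.

Lemma idl_phiA_beta : idl (phiA (r %/ r1 * r1 + r %% r1)) =
  idl (fun x => rems gA hA r1 (r %/ r1) x
    \/ x \in coefs (r %% r1) (rmodp hA (quo gA hA (r %/ r1)))).
Proof.
have [hm sh] := hH_monic.
have qm : quo gH hH (r %/ r1) \is monic.
  by have [] := quo_monic gH_monic hm size_gH sh (leq_divM r r1).
have r1r : (r1 < r)%N by rewrite ltn_mod.
have := idl_image (@cls K m) (PsiTheory.idl_PsiB_beta c phi_coord r10 r1r).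
rewrite -/(phiA _) fB_phi gB_phi => ->; rewrite image_or; congr idl; apply/funext => y.
congr or; first by rewrite (congr1 (@^~ y) (image_rems (@cls K m) _ _ _ hm)) map_hH.
rewrite (congr1 (@^~ y) (image_coefs (@cls K m) _ _)) /=.
have [_ ->] := map_rdivp_monic (@cls K m) hH qm.
by rewrite map_quo // map_hH.
Qed.

Hypothesis holo_derive : forall (f : V -> K) (j : 'I_m),
  holo_germ f -> holo_germ (fun z => 'D_(delta_mx 0 j) f z).

Theorem iterated_jacobian_extension q2 r2 : q2 = (r %/ r1)%N -> r2 = (r %% r1)%N ->
  (forall s, (s <= q2)%N ->
     iter s (Delta_sup r1) (iter q1 (Delta_sup r) (Imu K n r)) =
     ideal_gen (Imu K n r `|` psi_phi K n r (q1 * r) (s * r1))) /\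
  ((0 < r2)%N ->
     Delta_sup r2 (iter q2 (Delta_sup r1) (iter q1 (Delta_sup r) (Imu K n r))) =
     ideal_gen (Imu K n r `|` psi_phi K n r (q1 * r) (q2 * r1 + r2))).
Proof.
move=> -> ->; set q2' := (_ %/ _)%N; set r2' := (_ %% r1)%N.
have r2r1 : (r2' <= r1)%N by rewrite ltnW // ltn_mod.
have [E1 E2] := DeltaA_euclid (gder_is_der holo_derive) (@germ_nat K m)
  (coordinate_chart holo_derive) erefl (divn_eq n r) (divn_eq r r1) r10 r0 r2r1.
have [e1 i1] := iter_Delta_reps holo_derive r q1 (idl_ideal (gens [::] fA gA 0 0 m)).
have e2 s := iter_Delta_reps holo_derive r1 s i1.
split=> [s sq|r20].
  rewrite ideal_gen_psi_phi Imu_reps e1 (e2 s).1 E1 //; congr reps.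
  apply: idl_or; last by rewrite idl_phiA.
  by apply: idl_or => //; rewrite idl_psiA.
rewrite ideal_gen_psi_phi Imu_reps e1 (e2 _).1 [LHS](Delta_sub_reps holo_derive _ (e2 _).2).
rewrite E2 //; congr reps.
transitivity (idl (fun x => (JA x \/ rems fA gA r q1 x) \/ (rems gA hA r1 q2' x \/
   x \in coefs r2' (rmodp hA (quo gA hA q2'))))).
  by congr idl; apply/funext => x; apply/propext; rewrite or_assoc.
apply: idl_or; last by rewrite idl_phiA_beta.
by apply: idl_or => //; rewrite idl_psiA.
Qed.

End Generators.

Local Open Scope complex_scope.

Theorem theorem3p14 (R : realType) (n r q1 r1 q2 r2 : nat)
    (hr : (1 <= r)%N) (hrn : (r <= n)%N)
    (hn : n = (q1 * r + r1)%N) (hr1 : (0 < r1 < r)%N)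
    (hq2 : r = (q2 * r1 + r2)%N) (hr2 : (r2 < r1)%N) :
  (forall s : nat, (1 <= s <= q2)%N ->
     iter s (Delta_sup r1) (iter q1 (Delta_sup r) (Imu R[i] n r))
     = ideal_gen (Imu R[i] n r `|` psi_phi R[i] n r (q1 * r) (s * r1)))
  /\
  ((0 < r2)%N ->
     Delta_sup r2
       (iter q2 (Delta_sup r1) (iter q1 (Delta_sup r) (Imu R[i] n r)))
     = ideal_gen (Imu R[i] n r `|` psi_phi R[i] n r (q1 * r) (q2 * r1 + r2))).
Proof.
have /andP[r10 r1r] := hr1.
have q1E : q1 = (n %/ r)%N by rewrite hn divnMDl // (divn_small r1r) addn0.
have r1E : r1 = (n %% r)%N by rewrite hn modnMDl modn_small.
have q2E : q2 = (r %/ r1)%N by rewrite hq2 divnMDl // (divn_small hr2) addn0.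
have r2E : r2 = (r %% r1)%N by rewrite hq2 modnMDl modn_small.
clear hn hq2; subst q1; subst r1.
have [E1 E2] := iterated_jacobian_extension hr hrn r10
  (@holo_germ_derive R (n + r)) q2E r2E.
by split=> // s /andP[_ sq]; apply: E1.
Qed.
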